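(* Let $k\ge2$. Then the sequence $$\mathcal{RM} \xrightarrow{\ \subseteq\ } \boldsymbol X_h \xrightarrow{\operatorname{sym}\operatorname{grad}} \boldsymbol\Phi_h \xrightarrow{\operatorname{curl}\operatorname{curl}^{\mathsf T}} \boldsymbol\Gamma_h \xrightarrow{\operatorname{div}} \boldsymbol Z_h \longrightarrow 0$$ is an exact complex; that is, each operator maps its space into the next one, the kernel of $\operatorname{sym}\operatorname{grad}$ on $\boldsymbol X_h$ is $\mathcal{RM}$, $\ker(\operatorname{curl}\operatorname{curl}^{\mathsf T}|_{\boldsymbol\Phi_h})=\operatorname{sym}\operatorname{grad}\boldsymbol X_h$, $\ker(\operatorname{div}|_{\boldsymbol\Gamma_h})=\operatorname{curl}\operatorname{curl}^{\mathsf T}\boldsymbol\Phi_h$, and $\operatorname{div}\boldsymbol\Gamma_h=\boldsymbol Z_h$.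
   Context: Notation. Coordinates are $(x_1,x_2,x_3)=(x,y,z)$, $\partial_i=\partial/\partial x_i$. Whenever indices $i,j,l$ occur together they are pairwise distinct, i.e. $\{i,j,l\}=\{1,2,3\}$. $\mathcal Q(i{:}a,j{:}b,l{:}c)$ is the space of polynomials of degree at most $a$ in $x_i$, at most $b$ in $x_j$ and at most $c$ in $x_l$ (separately); similarly with fewer variables on faces and edges; it is the zero space if some bound is negative. $\mathbb S$ is the space of symmetric real $3\times3$ matrices. $\operatorname{curl}$ and $\operatorname{div}$ act row-wise on matrix fields, $\operatorname{curl}^{\mathsf T}\boldsymbol\sigma=(\operatorname{curl}\boldsymbol\sigma^{\mathsf T})^{\mathsf T}$ (column-wise curl), $\operatorname{sym}\boldsymbol\sigma=\frac12(\boldsymbol\sigma+\boldsymbol\sigma^{\mathsf T})$. $\mathcal{RM}=\{\boldsymbol a+\boldsymbol b\times\boldsymbol x:\boldsymbol a,\boldsymbol b\in\mathbb R^3\}$. Mesh. $\Omega\subset\mathbb R^3$ is a contractible domain with Lipschitz boundary, partitioned by a (face-to-face) mesh $\mathcal T_h$ of axis-parallel cuboids. $e_i$ denotes an edge parallel to the $x_i$-axis; $F_{ij}=F_{ji}$ denotes a face parallel to the $x_i$- and $x_j$-axes (normal to the $x_l$-direction). A finite element space given by a shape function space on each cell $T$ and degrees of freedom (DOFs) on $T$ consists of all piecewise polynomial fields whose restriction to each cell is in the shape function space and such that each DOF attached to a vertex, edge or face has the same value from all cells containing that vertex, edge or face. ''Moments of $f$ on $G$ against $P$'' means the functionals $\int_G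 f\,p$ for all $p\in P$. $\boldsymbol X_h$ (values in $\mathbb R^3$): shape functions $u_i\in\mathcal Q(i{:}k,j{:}k+1,l{:}k+1)$. DOFs of $u_i$: $u_i,\partial_ju_i,\partial_lu_i,\partial_j\partial_lu_i$ at each vertex; moments of these same four functions on each $e_i$ against $\mathcal Q(i{:}k-2)$; for each $j\neq i$, moments of $u_i,\partial_lu_i$ on each $e_j$ against $\mathcal Q(j{:}k-3)$; moments of $u_i$ on each $F_{jl}$ against $\mathcal Q(j{:}k-3,l{:}k-3)$; for each $j\neq i$, moments of $u_i,\partial_lu_i$ on each $F_{ij}$ against $\mathcal Q(i{:}k-2,j{:}k-3)$; moments of $u_i$ on $T$ against $\mathcal Q(i{:}k-2,j{:}k-3,l{:}k-3)$. $\boldsymbol\Phi_h$ (values in $\mathbb S$): shape functions: symmetric $\boldsymbol\sigma$ with $\sigma_{ii}\in\mathcal Q(i{:}k-1,j{:}k+1,l{:}k+1)$ and, for $i\ne j$, $\sigma_{ij}=\sigma_{ji}\in\mathcal Q(i{:}k,j{:}k,l{:}k+1)$. DOFs of $\sigma_{ii}$: moments of $\sigma_{ii},\partial_j\sigma_{ii},\partial_l\sigma_{ii},\partial_j\partial_l\sigma_{ii}$ on each $e_i$ against $\mathcal Q(i{:}k-1)$; for each $j\ne i$, moments of $\sigma_{ii},\partial_l\sigma_{ii}$ on each $F_{ij}$ against $\mathcal Q(i{:}k-1,j{:}k-3)$; moments of $\sigma_{ii}$ on $T$ against $\mathcal Q(i{:}k-1,j{:}k-3,l{:}k-3)$. DOFs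 of $\sigma_{ij}$ ($i<j$): $\sigma_{ij},\partial_l\sigma_{ij}$ at each vertex; moments of $\sigma_{ij},\partial_l\sigma_{ij}$ on each $e_i$ against $\mathcal Q(i{:}k-2)$ and on each $e_j$ against $\mathcal Q(j{:}k-2)$; moments of $\sigma_{ij}$ on each $e_l$ against $\mathcal Q(l{:}k-3)$; moments of $\sigma_{ij},\partial_l\sigma_{ij}$ on each $F_{ij}$ against $\mathcal Q(i{:}k-2,j{:}k-2)$; moments of $\sigma_{ij}$ on each $F_{il}$ against $\mathcal Q(i{:}k-2,l{:}k-3)$ and on each $F_{jl}$ against $\mathcal Q(j{:}k-2,l{:}k-3)$; moments of $\sigma_{ij}$ on $T$ against $\mathcal Q(i{:}k-2,j{:}k-2,l{:}k-3)$. $\boldsymbol\Gamma_h$ (values in $\mathbb S$): shape functions: symmetric $\boldsymbol\sigma$ with $\sigma_{ii}\in\mathcal Q(i{:}k+1,j{:}k-1,l{:}k-1)$ and, for $i\neq j$, $\sigma_{ij}=\sigma_{ji}\in\mathcal Q(i{:}k,j{:}k,l{:}k-1)$. DOFs of $\sigma_{ii}$: moments of $\sigma_{ii},\partial_i\sigma_{ii}$ on each $F_{jl}$ against $\mathcal Q(j{:}k-1,l{:}k-1)$; moments of $\sigma_{ii}$ on $T$ against $\mathcal Q(i{:}k-3,j{:}k-1,l{:}k-1)$. DOFs of $\sigma_{ij}$ ($i<j$): moments on each $e_l$ against $\mathcal Q(l{:}k-1)$, on each $F_{il}$ against $\mathcal Q(i{:}k-2,l{:}k-1)$, on each $F_{jl}$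 against $\mathcal Q(j{:}k-2,l{:}k-1)$, and on $T$ against $\mathcal Q(i{:}k-2,j{:}k-2,l{:}k-1)$. $\boldsymbol Z_h$ (values in $\mathbb R^3$): shape functions $q_i\in\mathcal Q(i{:}k,j{:}k-1,l{:}k-1)$. DOFs of $q_i$: moments on each $F_{jl}$ against $\mathcal Q(j{:}k-1,l{:}k-1)$; moments on $T$ against $\mathcal Q(i{:}k-2,j{:}k-1,l{:}k-1)$. *)

(* Defs.v *)
From HB Require Import structures.
From mathcomp Require Import all_boot all_order all_algebra.
From mathcomp Require Import all_classical all_reals all_analysis.
(* mpoly's notations clash with those of MathComp-Analysis. *)
From mathcomp Require Import -(notations) mpoly.

Set Implicit Arguments.
Unset Strict Implicit.
Unset Printing Implicit Defensive.

Import Order.TTheory GRing.Theory Num.Theory.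
Import numFieldNormedType.Exports.

Local Open Scope classical_set_scope.
Local Open Scope ring_scope.

Section Domain.
Variable R : realType.
Implicit Types Omega : set 'rV[R]_3.

Definition is_domain Omega := [/\ open Omega, connected Omega & Omega !=set0].

Definition contractible Omega := exists x0 (H : R * 'rV[R]_3 -> 'rV[R]_3),
  [/\ Omega x0,
      {within `[0, 1]%classic `*` Omega, continuous H},
      (forall t x, t \in `[0, 1] -> Omega x -> Omega (H (t, x))),
      (forall x, Omega x -> H (0, x) = x)
    & (forall x, Omega x -> H (1, x) = x0)].

(* Strong Lipschitz condition: near each boundary point p, in the orthonormal
   coordinates y = (x - p) Q, Omega is the region above a Lipschitz graph. *)
Definition lipschitz_boundary Omega := forall p, (closure Omega `\` Omega^°) p ->
  exists (Q : 'M[R]_3) (r : R) (phi : R * R -> R),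
  [/\ Q *m Q^T = 1%:M, 0 < r, lipschitz phi
    & forall x, let y := (x - p) *m Q in
        (forall i, `|y 0 i| < r) ->
        (Omega x <-> phi (y 0 0, y 0 1) < y 0 2%:R)].

End Domain.

Section Mesh.
Variable R : realType.

Record box := Box { lo : 'rV[R]_3 ; hi : 'rV[R]_3 }.

Definition box_set (G : box) : set 'rV[R]_3 :=
  [set x | forall i, lo G 0 i <= x 0 i <= hi G 0 i].

(* G is a vertex, edge, face of the cuboid T, or T itself, parallel to exactly
   the axes listed in D: D = [::] for vertices, [:: i] for edges e_i,
   [:: i; j] for faces F_ij. *)
Definition face_of (D : seq 'I_3) (G T : box) := forall i,
  if i \in D then lo G 0 i = lo T 0 i /\ hi G 0 i = hi T 0 i
  else lo G 0 i = hi G 0 i /\ (lo G 0 i = lo T 0 i \/ lo G 0 i = hi T 0 i).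

Record mesh := Mesh {
  ncells : nat ;
  cell : 'I_ncells -> box ;
  cell_nondegenerate : forall c i, lo (cell c) 0 i < hi (cell c) 0 i ;
  face_to_face : forall c c', c != c' ->
    box_set (cell c) `&` box_set (cell c') = set0 \/
    exists D G, [/\ (size D < 3)%N, face_of D G (cell c), face_of D G (cell c')
                  & box_set (cell c) `&` box_set (cell c') = box_set G] }.

Definition partitions (M : mesh) (Omega : set 'rV[R]_3) :=
  closure Omega = \bigcup_(c in [set: 'I_(ncells M)]) box_set (cell c).

End Mesh.

Section Polynomials.
Variable R : realType.
Local Notation poly3 := (mpoly 3 R).

(* [:: (i, a); (j, b)] stands for Q(i:a, j:b): degree at most a in x_i and at
   most b in x_j, with no dependence on the variables that are not listed.
   Bounds are integers: if one is negative only the zero polynomial is left. *)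
Definition degbound (b : seq ('I_3 * int)) (i : 'I_3) : int :=
  nth 0 (unzip2 b) (index i (unzip1 b)).

Definition Qspace (b : seq ('I_3 * int)) (p : poly3) :=
  forall m, m \in msupp p -> forall i, (m i)%:Z <= degbound b i.

Definition derivs (s : seq 'I_3) (p : poly3) : poly3 := foldr (@mderiv 3 R) p s.

Definition int1 (a b : R) (f : R -> R) : R :=
  if a == b then f a else (\int[lebesgue_measure]_(t in `[a, b]) f t)%R.

(* Integral over G with respect to the measure of the dimension of G; the
   point value when G is a vertex. *)
Definition integral_on (G : box R) (p : poly3) : R :=
  int1 (lo G 0 0) (hi G 0 0) (fun x =>
  int1 (lo G 0 1) (hi G 0 1) (fun y =>
  int1 (lo G 0 2%:R) (hi G 0 2%:R) (fun z =>
    meval (fun i : 'I_3 => nth 0 [:: x; y; z] i) p))).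

End Polynomials.

Section FiniteElements.

(* The degrees of freedom (d, b) of a scalar f: the moments of the derivative
   of f in the directions d against the polynomials of Q(b), on every mesh
   entity parallel to exactly the axes listed in b. For b = [::] these are the
   multiples of the value of the derivative at a vertex. *)
Definition dof : Type := seq 'I_3 * seq ('I_3 * int).

Definition dofs (b : seq ('I_3 * int)) (ds : seq (seq 'I_3)) : seq dof :=
  [seq (d, b) | d <- ds].

(* Each list below is used for all pairwise distinct i, j, l, which accounts
   for the DOFs required for each j != i. *)

Definition X_dofs (k : int) (i j l : 'I_3) : seq dof :=
  dofs [::] [:: [::]; [:: j]; [:: l]; [:: j; l]] ++
  dofs [:: (i, k - 2)] [:: [::]; [:: j]; [:: l]; [:: j; l]] ++
  dofs [:: (j, k - 3)] [:: [::]; [:: l]] ++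
  dofs [:: (j, k - 3); (l, k - 3)] [:: [::]] ++
  dofs [:: (i, k - 2); (j, k - 3)] [:: [::]; [:: l]] ++
  dofs [:: (i, k - 2); (j, k - 3); (l, k - 3)] [:: [::]].

Definition Phi_diag_dofs (k : int) (i j l : 'I_3) : seq dof :=
  dofs [:: (i, k - 1)] [:: [::]; [:: j]; [:: l]; [:: j; l]] ++
  dofs [:: (i, k - 1); (j, k - 3)] [:: [::]; [:: l]] ++
  dofs [:: (i, k - 1); (j, k - 3); (l, k - 3)] [:: [::]].

Definition Phi_offdiag_dofs (k : int) (i j l : 'I_3) : seq dof :=
  dofs [::] [:: [::]; [:: l]] ++
  dofs [:: (i, k - 2)] [:: [::]; [:: l]] ++
  dofs [:: (j, k - 2)] [:: [::]; [:: l]] ++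
  dofs [:: (l, k - 3)] [:: [::]] ++
  dofs [:: (i, k - 2); (j, k - 2)] [:: [::]; [:: l]] ++
  dofs [:: (i, k - 2); (l, k - 3)] [:: [::]] ++
  dofs [:: (j, k - 2); (l, k - 3)] [:: [::]] ++
  dofs [:: (i, k - 2); (j, k - 2); (l, k - 3)] [:: [::]].

Definition Gamma_diag_dofs (k : int) (i j l : 'I_3) : seq dof :=
  dofs [:: (j, k - 1); (l, k - 1)] [:: [::]; [:: i]] ++
  dofs [:: (i, k - 3); (j, k - 1); (l, k - 1)] [:: [::]].

Definition Gamma_offdiag_dofs (k : int) (i j l : 'I_3) : seq dof :=
  dofs [:: (l, k - 1)] [:: [::]] ++
  dofs [:: (i, k - 2); (l, k - 1)] [:: [::]] ++
  dofs [:: (j, k - 2); (l, k - 1)] [:: [::]] ++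
  dofs [:: (i, k - 2); (j, k - 2); (l, k - 1)] [:: [::]].

Definition Z_dofs (k : int) (i j l : 'I_3) : seq dof :=
  dofs [:: (j, k - 1); (l, k - 1)] [:: [::]] ++
  dofs [:: (i, k - 2); (j, k - 1); (l, k - 1)] [:: [::]].

Variables (R : realType) (M : mesh R).
Local Notation poly3 := (mpoly 3 R).

(* Piecewise polynomial fields: one polynomial field for each cell. *)
Definition vfield := {ffun 'I_(ncells M) -> 'rV[poly3]_3}.
Definition mfield := {ffun 'I_(ncells M) -> 'M[poly3]_3}.

(* The condition on the DOFs interior to a cell is void, since such an entity
   belongs to a single cell. *)
Definition single_valued (ds : seq dof) (f : 'I_(ncells M) -> poly3) :=
  forall d, d \in ds -> forall G c c',
  face_of (unzip1 d.2) G (cell c) -> face_of (unzip1 d.2) G (cell c') ->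
  forall q, Qspace d.2 q ->
  integral_on G (derivs d.1 (f c) * q) = integral_on G (derivs d.1 (f c') * q).

Definition Xh (k : int) : set vfield :=
  [set u : vfield | forall i j l, uniq [:: i; j; l] ->
    (forall c, Qspace [:: (i, k); (j, k + 1); (l, k + 1)] (u c 0 i)) /\
    single_valued (X_dofs k i j l) (fun c => u c 0 i)].

Definition Phih (k : int) : set mfield :=
  [set s : mfield | (forall c, (s c)^T = s c) /\
    forall i j l, uniq [:: i; j; l] ->
    [/\ forall c, Qspace [:: (i, k - 1); (j, k + 1); (l, k + 1)] (s c i i),
        single_valued (Phi_diag_dofs k i j l) (fun c => s c i i),
        forall c, Qspace [:: (i, k); (j, k); (l, k + 1)] (s c i j)
      & (i < j)%N ->
        single_valued (Phi_offdiag_dofs k i j l) (fun c => s c i j)]].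

Definition Gammah (k : int) : set mfield :=
  [set s : mfield | (forall c, (s c)^T = s c) /\
    forall i j l, uniq [:: i; j; l] ->
    [/\ forall c, Qspace [:: (i, k + 1); (j, k - 1); (l, k - 1)] (s c i i),
        single_valued (Gamma_diag_dofs k i j l) (fun c => s c i i),
        forall c, Qspace [:: (i, k); (j, k); (l, k - 1)] (s c i j)
      & (i < j)%N ->
        single_valued (Gamma_offdiag_dofs k i j l) (fun c => s c i j)]].

Definition Zh (k : int) : set vfield :=
  [set q : vfield | forall i j l, uniq [:: i; j; l] ->
    (forall c, Qspace [:: (i, k); (j, k - 1); (l, k - 1)] (q c 0 i)) /\
    single_valued (Z_dofs k i j l) (fun c => q c 0 i)].

End FiniteElements.

Section Operators.
Variable R : realType.
Local Notation poly3 := (mpoly 3 R).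

(* Index arithmetic in 'I_3 is modulo 3. *)
Definition cross (A : pzRingType) (u v : 'rV[A]_3) : 'rV[A]_3 :=
  \row_i (u 0 (i + 1) * v 0 (i + 2%:R) - u 0 (i + 2%:R) * v 0 (i + 1)).

Definition grad (u : 'rV[poly3]_3) : 'M[poly3]_3 :=
  \matrix_(i, j) mderiv j (u 0 i).

Definition sym (s : 'M[poly3]_3) : 'M[poly3]_3 :=
  map_mx (fun p : poly3 => (2^-1 : R) *: p) (s + s^T).

Definition curl (s : 'M[poly3]_3) : 'M[poly3]_3 :=
  \matrix_(i, j) (mderiv (j + 1) (s i (j + 2%:R)) -
                  mderiv (j + 2%:R) (s i (j + 1))).

Definition curlT (s : 'M[poly3]_3) : 'M[poly3]_3 := (curl s^T)^T.

Definition div (s : 'M[poly3]_3) : 'rV[poly3]_3 :=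
  \row_i \sum_j mderiv j (s i j).

Definition rigid_motion (a b : 'rV[R]_3) : 'rV[poly3]_3 :=
  map_mx (@mpolyC 3 R) a +
  cross (map_mx (@mpolyC 3 R) b) (\row_i mpolyX R (mnm1 i)).

Variable M : mesh R.

Definition RM : set (vfield M) :=
  [set u | exists a b, forall c, u c = rigid_motion a b].

(* The operators act cell by cell on piecewise polynomial fields. *)
Definition sym_grad (u : vfield M) : mfield M := [ffun c => sym (grad (u c))].
Definition curl_curlT (s : mfield M) : mfield M := [ffun c => curl (curlT (s c))].
Definition divh (s : mfield M) : vfield M := [ffun c => div (s c)].

End Operators.

Arguments RM {R} M.
Arguments Xh {R} M k.
Arguments Phih {R} M k.
Arguments Gammah {R} M k.
Arguments Zh {R} M k.

(* Main.v *)
(* All four finite element spaces are, component by component, spaces of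
   splines: the degrees of freedom attached to an entity determine the jets
   there, so that they are single-valued if and only if the jets of order
   r < L m agree across the faces normal to x_m, where the degree in x_m is less
   than k + L m and the level L m is in {0, 1, 2}. This needs that the cells
   around a point are linked through common faces, which holds because the
   domain is connected near each boundary point.

   For spline spaces whose levels drop by one in the direction of each
   differential, the de Rham complex is exact. Hermite-type homotopies in one
   variable after the other push a closed form onto a finite-dimensional copy of
   the cellular cochains of the mesh, so that only the first and the second
   cohomology of the mesh have to vanish. The elasticity complex follows by the
   BGG diagram chase: if inc s = 0 then the rows of curlT s are gradients of
   functions w, and s corrected by w has rows that are gradients; if div g = 0
   then g = curl t, where t may be chosen trace-free because div is onto, and
   then the columns of t are divergence free.

   The cohomology vanishes because the closure of the domain contracts: pushing
   points inward along Lipschitz directions brings it inside the domain, where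
   the given contraction is uniformly continuous and may be cut into finitely
   many small steps. A small Alexander-Spanier cocycle on the closure is
   therefore a coboundary, and a Cech zigzag over the cells, which are boxes and
   so meet pairwise only if they have a common point, carries this over to the
   mesh. *)
From HB Require Import structures.
Require Import Defs.
From mathcomp Require Import all_boot all_order all_algebra.
From mathcomp Require Import all_classical all_reals all_analysis.
From mathcomp Require Import -(notations) mpoly.
From mathcomp Require Import -(notations) ssrcomplements.
From mathcomp Require Import ring lra zify.

Set Implicit Arguments.
Unset Strict Implicit.
Unset Printing Implicit Defensive.

Import Order.TTheory GRing.Theory Num.Theory.
Import numFieldNormedType.Exports.

Local Open Scope classical_set_scope.
Local Open Scope ring_scope.


(** * Tensor products of univariate operators *)

(** The analysis is done in one variable and then tensored. On an interval, [pi0] and [pi1] project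
    functions and derivatives onto the span of the two end functions and onto multiples of their
    derivative, and [hmt] is the homotopy from this projection to the identity. Its jets at the
    endpoints involve only endpoint values of the argument, so it can be applied cell by cell
    without breaking conformity. The end functions of level 2 are cubic and have to fit below degree
    k + 2, which is one place where [2 <= k] enters. Homotopies cannot remove the projected part,
    whose coefficients are integrals over edges, faces or cells; there the topology of the mesh
    comes in. The cells cover the closure of the domain, whereas the given contraction lives on the
    domain itself, hence the inward push. Alexander-Spanier cochains of a given scale only see
    nearby points, so a finite sequence of maps that moves points by small steps can replace a
    homotopy. *)

Section TensorLift.
Variable R : realType.
Local Notation poly3 := (mpoly 3 R).
Implicit Types (m n : 'I_3) (q : 'I_3 -> {poly R}) (p : poly3).
Implicit Types (L : {poly R} -> {poly R}).

Definition upd (T : Type) (q : 'I_3 -> T) m (x : T) : 'I_3 -> T :=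
  fun i => if i == m then x else q i.

Lemma upd_same T (q : 'I_3 -> T) m x : upd q m x m = x.
Proof. by rewrite /upd eqxx. Qed.

Lemma upd_other T (q : 'I_3 -> T) m x i : i != m -> upd q m x i = q i.
Proof. by rewrite /upd => /negbTE->. Qed.

Lemma upd_upd T (q : 'I_3 -> T) m x y : upd (upd q m x) m y = upd q m y.
Proof. by apply: funext => i; rewrite /upd; case: eqP. Qed.

Lemma upd_comm T (q : 'I_3 -> T) m n x y : m != n ->
  upd (upd q m x) n y = upd (upd q n y) m x.
Proof.
move=> mn; apply: funext => i; rewrite /upd.
by case: (eqVneq i n) => // ->; rewrite eq_sym (negbTE mn).
Qed.

Lemma upd_id T (q : 'I_3 -> T) m : upd q m (q m) = q.
Proof. by apply: funext => i; rewrite /upd; case: eqP => // ->. Qed.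

Definition Xvar m : poly3 := mpolyX R (mnm1 m).

Definition tens q : poly3 := \prod_(i < 3) horner_alg (Xvar i) (q i).

Lemma tens_upd q m r : tens (upd q m r) = horner_alg (Xvar m) r *
  \prod_(i < 3 | i != m) horner_alg (Xvar i) (q i).
Proof.
rewrite /tens (bigD1 m) //= upd_same; congr (_ * _); apply: eq_bigr => i im.
by rewrite upd_other.
Qed.

Lemma tens_upd_linear q m : linear (fun r => tens (upd q m r)).
Proof.
by move=> a x y; rewrite !tens_upd linearP /= mulr_algl mulrDl scalerAl.
Qed.

Definition tens_at q m r := tens (upd q m r).
HB.instance Definition _ q m := GRing.isLinear.Build R {poly R} poly3 *:%R
  (tens_at q m) (@tens_upd_linear q m).

Definition mono (a : 'I_3 -> nat) : 'I_3 -> {poly R} := fun i => 'X^(a i).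

Lemma tens_mono (a : multinom 3) : tens (mono a) = mpolyX R a.
Proof.
rewrite mpolyXE_id /tens; apply: eq_bigr => i _.
by rewrite /mono rmorphXn /= horner_algX.
Qed.

Lemma linear_sumZ (U V : lmodType R) (f : U -> V) : linear f ->
  forall I (r : seq I) (c : I -> R) (u : I -> U),
  f (\sum_(i <- r) c i *: u i) = \sum_(i <- r) c i *: f (u i).
Proof.
move=> fl I r c u; pose fL := GRing.isLinear.Build _ _ _ _ f fl.
pose F : {linear U -> V} := HB.pack f fL.
rewrite -[f]/(F : _ -> _) linear_sum; apply: eq_bigr => i _.
exact: linearZ_LR.
Qed.

Lemma linear_mono_eq (V : lmodType R) (f g : poly3 -> V) : linear f -> linear g ->
  (forall a : multinom 3, f (tens (mono a)) = g (tens (mono a))) -> f =1 g.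
Proof.
move=> fl gl fg p; rewrite (mpolyE p) !linear_sumZ //.
by apply: eq_bigr => a _; rewrite -tens_mono fg.
Qed.

(** The tensor product of [L] in the variable m with the identity in the other two. Only the values
    of [L] on powers of X enter, so [lift m L] is linear for every [L]; that it acts on the m-th
    factor of an arbitrary tensor requires [L] to be linear. *)
Definition lift m L p : poly3 :=
  \sum_(a <- msupp p) mcoeff a p *: tens (upd (mono a) m (L 'X^(a m))).

(** The support varies with the polynomial, so additivity is visible only over a fixed finite index
    set that contains the supports of all polynomials involved. *)
Lemma liftwE m L p k : (mmeasure mdeg p <= k)%N ->
  lift m L p = \sum_(a : bmultinom 3 k) mcoeff a p *: tens (upd (mono a) m (L 'X^(a m))).
Proof.
move=> le_pk; pose I : subFinType _ := bmultinom 3 k.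
rewrite /lift (big_mksub I) //=; first last.
- by move=> x /msize_mdeg_lt /leq_trans; apply.
- by rewrite msupp_uniq.
by rewrite big_rmcond //= => i /memN_msupp_eq0->; rewrite scale0r.
Qed.

Lemma lift_is_linear m L : linear (lift m L).
Proof.
move=> c p q; set k := maxn (mmeasure mdeg p) (maxn (mmeasure mdeg q) (mmeasure mdeg (c *: p + q))).
rewrite !(@liftwE m L _ k) ?leq_maxl ?leq_max ?leqnn ?orbT // scaler_sumr -big_split /=.
by apply: eq_bigr => a _; rewrite linearD linearZ /= scalerDl scalerA.
Qed.

HB.instance Definition _ m L := GRing.isLinear.Build R poly3 poly3 *:%R
  (lift m L) (@lift_is_linear m L).

Lemma lift_mono m L (a : multinom 3) :
  lift m L (tens (mono a)) = tens (upd (mono a) m (L 'X^(a m))).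
Proof. by rewrite tens_mono /lift msuppX big_seq1 mcoeffX eqxx scale1r. Qed.

(* A family of univariate polynomials is, slot by slot, a linear combination
   of families of monomials. *)
Lemma multilinear_mono_eq (V : lmodType R) (F G : ('I_3 -> {poly R}) -> V) :
  (forall q i, linear (fun r => F (upd q i r))) ->
  (forall q i, linear (fun r => G (upd q i r))) ->
  (forall a : 'I_3 -> nat, F (mono a) = G (mono a)) -> F =1 G.
Proof.
move=> Fl Gl FG.
have step (i : 'I_3) q : (forall j : nat, F (upd q i 'X^j) = G (upd q i 'X^j)) -> F q = G q.
  move=> FGj; rewrite -(upd_id q i).
  rewrite -(coefK (q i)) poly_def (linear_sumZ (Fl q i)) (linear_sumZ (Gl q i)).
  by apply: eq_bigr => j _; rewrite FGj.
move=> q; apply: (step 0) => j0; apply: (step 1) => j1; apply: (step 2%:R) => j2.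
set q' := upd _ _ _; suff -> : q' = mono (fun i => nth 0%N [:: j0; j1; j2] i) by exact: FG.
by apply: funext => -[[|[|[|//]]] ?]; rewrite /q' /mono /upd.
Qed.

Lemma lift_tens m L q : linear L -> lift m L (tens q) = tens (upd q m (L (q m))).
Proof.
move=> Ll; move: q.
pose F := fun q => lift m L (tens q); pose G := fun q => tens (upd q m (L (q m))).
apply: (@multilinear_mono_eq _ F G).
- by move=> q i c x y; rewrite /F tens_upd_linear linearP.
- move=> q i c x y; rewrite /G; case: (eqVneq m i) => [->|mi].
    by rewrite !upd_same !upd_upd Ll tens_upd_linear.
  by rewrite !upd_other // !(@upd_comm _ q i m) 1?eq_sym // tens_upd_linear.
- move=> a; rewrite /F /G.
  have -> : mono a = mono (Multinom [tuple a i | i < 3]).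
    by apply: funext => i; rewrite /mono mnmE.
  by rewrite lift_mono.
Qed.

(** Pure tensors span, so an identity between linear maps may be checked where the operators act on
    separate factors. Many identities between lifted operators and functionals below are obtained in
    this way. *)
Lemma linear_tens_eq (V : lmodType R) (f g : poly3 -> V) : linear f -> linear g ->
  (forall q, f (tens q) = g (tens q)) -> f =1 g.
Proof. by move=> fl gl fg; apply: linear_mono_eq => // a; exact: fg. Qed.

Lemma lift_comp m L L' : linear L -> linear L' ->
  forall p, lift m L (lift m L' p) = lift m (L \o L') p.
Proof.
move=> Ll L'l; apply: linear_tens_eq.
- by move=> c x y; rewrite !linearP.
- exact: linearP.
move=> q; rewrite !lift_tens // ?upd_upd ?upd_same //.
by move=> c x y; rewrite /= L'l Ll.
Qed.

Lemma lift_comm m n L L' : linear L -> linear L' -> m != n ->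
  forall p, lift m L (lift n L' p) = lift n L' (lift m L p).
Proof.
move=> Ll L'l mn; apply: linear_tens_eq; try by move=> c x y; rewrite !linearP.
move=> q; rewrite !lift_tens // !upd_other // 1?eq_sym // upd_comm // eq_sym //.
Qed.

Lemma eq_lift m L L' : L =1 L' -> lift m L =1 lift m L'.
Proof. by move=> LL' p; apply: eq_bigr => a _; rewrite LL'. Qed.

Lemma lift_deriv m p : lift m (@deriv R) p = mderiv m p.
Proof.
move: p; apply: linear_mono_eq; try exact: linearP.
move=> a; rewrite lift_mono tens_mono mderivX derivXn -scaler_nat -tens_mono.
rewrite -/(tens_at _ _ _) linearZ /= /tens_at; congr (_ *: tens _).
apply: funext => i; rewrite /mono /upd mnmBE mnm1E; case: (eqVneq i m) => [->|im].
  by rewrite subn1.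
by rewrite subn0.
Qed.

Lemma lift_id m p : lift m id p = p.
Proof.
by rewrite {2}(mpolyE p) /lift; apply: eq_bigr => a _; rewrite upd_id tens_mono.
Qed.

Lemma lift0 m p : lift m (fun=> 0) p = 0.
Proof.
rewrite /lift big1 // => a _; rewrite -/(tens_at _ _ _).
by rewrite linear0 scaler0.
Qed.

Lemma liftD m L L' p : lift m (fun x => L x + L' x) p = lift m L p + lift m L' p.
Proof.
rewrite /lift -big_split; apply: eq_bigr => a _ /=.
by rewrite -!/(tens_at _ _ _) linearD scalerDr.
Qed.

Lemma liftN m L p : lift m (fun x => - L x) p = - lift m L p.
Proof.
rewrite /lift -sumrN; apply: eq_bigr => a _ /=.
by rewrite -!/(tens_at _ _ _) linearN scalerN.
Qed.

Lemma liftB m L L' p : lift m (fun x => L x - L' x) p = lift m L p - lift m L' p.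
Proof. by rewrite liftD liftN. Qed.
End TensorLift.

(** * Hermite interpolation and homotopies on an interval *)

Section UnivariateOperators.
Variable R : realType.
Implicit Types (f g : {poly R}) (a b : R) (r l : nat).

Let horner1 (x : R) : (1 : {poly R}).[x] = 1.
Proof. by rewrite -polyC1 hornerC. Qed.

Let hE := (@hornerD R, @hornerN R, @hornerZ R, @horner_exp R, @hornerM R, @hornerX R, @hornerC R, horner1).

Definition primp f : {poly R} := \poly_(i < (size f).+1) (f`_i.-1 / i%:R).

(* At [i = 0] the quotient is [0], since the inverse of [0] is [0]. *)
Lemma coef_primp f i : (primp f)`_i = f`_i.-1 / i%:R.
Proof.
rewrite coef_poly; case: ltnP => // lt_fi; case: i lt_fi => // i; rewrite ltnS => lt_fi.
by rewrite nth_default ?mul0r.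
Qed.

Lemma primp_linear : linear primp.
Proof.
by move=> c f g; apply/polyP => i; rewrite !(coefD, coefZ, coef_primp) mulrDl mulrA.
Qed.

Lemma deriv_primp f : (primp f)^`() = f.
Proof.
by apply/polyP => i; rewrite coef_deriv coef_primp /= -[_ *+ _]mulr_natr mulfVK.
Qed.

Lemma primp_deriv f : primp f^`() = f - (f`_0)%:P.
Proof.
apply/polyP => -[|i]; rewrite coef_primp coefB coefC /=.
  by rewrite invr0 mulr0 subrr.
by rewrite coef_deriv subr0 -[_ *+ _]mulr_natr mulfK // pnatr_eq0.
Qed.

Lemma size_primp f d : (size f <= d)%N -> (size (primp f) <= d.+1)%N.
Proof. by move=> fd; apply: leq_trans (size_poly _ _) _. Qed.

Definition prim0 a f := primp f - (primp f).[a]%:P.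

Lemma prim0_linear a : linear (prim0 a).
Proof.
move=> c f g; apply/polyP => i; rewrite /prim0 !(coefD, coefN, coefZ, coef_primp, coefC).
by rewrite primp_linear hornerD hornerZ; case: eqP => _; ring.
Qed.

Lemma deriv_prim0 a f : (prim0 a f)^`() = f.
Proof. by rewrite derivB deriv_primp derivC subr0. Qed.

Lemma size_prim0 a f d : (size f <= d)%N -> (size (prim0 a f) <= d.+1)%N.
Proof.
move=> fd; rewrite (leq_trans (size_polyD _ _)) // geq_max size_polyN size_primp //.
by rewrite (leq_trans (size_polyC_leq1 _)).
Qed.

Definition defint a b f := (primp f).[b] - (primp f).[a].

Lemma defint_scalar a b : scalar (defint a b).
Proof.
by move=> c f g; rewrite /defint primp_linear !hornerD !hornerZ /=; ring.
Qed.

Lemma defint_deriv a b f : defint a b f^`() = f.[b] - f.[a].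
Proof. by rewrite /defint primp_deriv !hornerD !hornerN !hornerC; ring. Qed.

Definition jet r a f := (f^`(r)).[a].

Lemma jet_scalar r a : scalar (jet r a).
Proof. by move=> c f g; rewrite /jet linearP hornerD hornerZ. Qed.

Lemma jet_deriv r a f : jet r a f^`() = jet r.+1 a f.
Proof. by rewrite /jet derivSn. Qed.

Lemma linear_constP (mu : {poly R} -> R) : scalar mu -> linear (fun f => (mu f)%:P).
Proof. by move=> mul c f g; rewrite mul polyCD -mul_polyC -polyCM. Qed.

Lemma linear_scaleP (mu : {poly R} -> R) (w : {poly R}) : scalar mu ->
  linear (fun f => mu f *: w).
Proof. by move=> mul c f g; rewrite mul scalerDl scalerA. Qed.

(* The shape function of the endpoint [b] in C^(l-1) elements on [a, b]. *)
Definition lam l a b : {poly R} :=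
  let t := (b - a)^-1 *: ('X - a%:P) in
  if (l == 2)%N then 3 *: t ^+ 2 - 2 *: t ^+ 3 else t.

Lemma lam_a l a b : (lam l a b).[a] = 0.
Proof. by rewrite /lam; case: ifP => _; rewrite !hE; ring. Qed.

Lemma lam_b l a b : a != b -> (lam l a b).[b] = 1.
Proof.
move=> ab; have nz : b - a != 0 by rewrite subr_eq0 eq_sym.
by rewrite /lam; case: ifP => _; rewrite !hE; field.
Qed.

(** With t the affine coordinate, this is 6 t (1 - t) / (b - a): the factored form shows that the
    slope vanishes at both ends. *)
Lemma dlam2E a b : (lam 2%N a b)^`() =
  (6 * (b - a)^-1 ^+ 2) *: ('X - a%:P) * (1 - (b - a)^-1 *: ('X - a%:P)).
Proof.
rewrite /lam eqxx derivB !derivZ !deriv_exp derivZ derivXsubC /=.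
set x := 'X - a%:P; set c := (b - a)^-1.
by rewrite -!mul_polyC !polyCM !rmorph_nat; ring.
Qed.

(** One formula for the sizes 2 (affine) and 4 (cubic). Compared with the admissible size k + l, it
    amounts at l = 2 to [2 <= k]. *)
Lemma size_lam l a b : (size (lam l a b) <= 2 * l.-1 + 2)%N.
Proof.
rewrite /lam; set t := _^-1 *: _.
have st : (size t <= 2)%N by rewrite (leq_trans (size_scale_leq _ _)) // size_XsubC.
case: eqP => [->|_] /=; last by rewrite (leq_trans st) // leq_addl.
have s2 : (size (t ^+ 2) <= 3)%N.
  by rewrite expr2 (leq_trans (size_polyMleq _ _)) //; lia.
have s3 : (size (t ^+ 3) <= 4)%N.
  by rewrite exprS (leq_trans (size_polyMleq _ _)) //; lia.
rewrite (leq_trans (size_polyD _ _)) // geq_max size_polyN.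
by rewrite !(leq_trans (size_scale_leq _ _)) // (leq_trans s2).
Qed.

Lemma jet_lam_a l r a b : (r < l)%N -> (l <= 2)%N -> jet r a (lam l a b) = 0.
Proof.
move=> rl l2; case: r rl => [|[|r]] rl; [exact: lam_a| |by lia].
have -> : l = 2%N by lia.
by rewrite /jet derivn1 dlam2E !hE; ring.
Qed.

Lemma jet_lam_b l r a b : a != b -> (r < l)%N -> (l <= 2)%N ->
  jet r b (lam l a b) = (r == 0)%:R.
Proof.
move=> ab rl l2; have nz : b - a != 0 by rewrite subr_eq0 eq_sym.
case: r rl => [|[|r]] rl; [exact: lam_b| |by lia].
have -> : l = 2%N by lia.
by rewrite /jet derivn1 dlam2E !hE /=; field.
Qed.

(** The images of [pi0] and [pi1] are copies of the 0- and 1-cochains of the interval, given by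
    endpoint values and integral. The chain homotopy [hmt] contracts the complement: [deriv_hmt] and
    [hmt_deriv] are its two identities. *)
Definition pi0 l a b f := f.[a] *: (1 - lam l a b) + f.[b] *: lam l a b.
Definition pi1 l a b f := defint a b f *: (lam l a b)^`().
Definition hmt l a b f := prim0 a f - defint a b f *: lam l a b.

Lemma pi0_linear l a b : linear (pi0 l a b).
Proof. by move=> c f g; rewrite /pi0 !hornerD !hornerZ -!mul_polyC !polyCD !polyCM; ring. Qed.

Lemma pi1_linear l a b : linear (pi1 l a b).
Proof. exact: linear_scaleP (defint_scalar a b). Qed.

Lemma hmt_linear l a b : linear (hmt l a b).
Proof.
move=> c f g; apply/polyP => i; rewrite /hmt prim0_linear defint_scalar.
by rewrite !(coefD, coefN, coefZ); ring.
Qed.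

Lemma deriv_hmt l a b f : (hmt l a b f)^`() = f - pi1 l a b f.
Proof. by rewrite /hmt derivB deriv_prim0 derivZ. Qed.

Lemma hmt_deriv l a b f : hmt l a b f^`() = f - pi0 l a b f.
Proof.
rewrite /hmt /prim0 defint_deriv primp_deriv !hE /pi0 -!mul_polyC !polyCB.
ring.
Qed.

Lemma pi1_deriv l a b f : pi1 l a b f^`() = (pi0 l a b f)^`().
Proof.
rewrite /pi1 defint_deriv /pi0 derivD !derivZ derivB -polyC1 derivC sub0r.
by rewrite -!mul_polyC polyCB; ring.
Qed.

(** The primitive and its correction by [lam] agree at both ends, so the value is zero; at order one
    the slope of [lam] vanishes, which leaves the value of [f]. No other data of the interval
    survives, so neighbouring cells stay matched. *)
Lemma jet_hmt l r a b f c : (l <= 2)%N -> (r < l)%N -> a != b -> c = a \/ c = b ->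
  jet r c (hmt l a b f) = if r is 0 then 0 else jet 0 c f.
Proof.
move=> l2 rl ab cab; case: r rl => [|[|r]] rl; last by lia.
  rewrite /jet derivn0 /hmt /prim0 !hE /defint.
  by case: cab => ->; rewrite ?lam_a ?lam_b //; ring.
have -> : l = 2%N by lia.
rewrite /jet derivn1 deriv_hmt derivn0 /pi1 !hE.
suff -> : (lam 2%N a b)^`().[c] = 0 by ring.
by case: cab => ->; [have := @jet_lam_a 2 1 a b isT isT | have := jet_lam_b ab (isT : 1 < 2)%N isT].
Qed.

Lemma size_hmt l a b f d : (2 * l.-1 + 1 <= d)%N -> (size f <= d)%N ->
  (size (hmt l a b f) <= d.+1)%N.
Proof.
move=> ld fd; apply: leq_trans (size_polyD _ _) _; rewrite geq_max size_polyN size_prim0 //=.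
by rewrite (leq_trans (size_scale_leq _ _)) // (leq_trans (size_lam _ _ _)) //; lia.
Qed.

Lemma size_pi1 l a b f d : (2 * l.-1 + 1 <= d)%N -> (size (pi1 l a b f) <= d)%N.
Proof.
move=> ld; rewrite (leq_trans (size_scale_leq _ _)) //.
rewrite (leq_trans (size_poly _ _)) //; have := size_lam l a b; lia.
Qed.

Lemma size_pi0 l a b f d : (2 * l.-1 + 2 <= d)%N -> (size (pi0 l a b f) <= d)%N.
Proof.
move=> ld; have sl := leq_trans (size_lam l a b) ld.
apply: leq_trans (size_polyD _ _) _; rewrite geq_max.
apply/andP; split; rewrite (leq_trans (size_scale_leq _ _)) //.
by rewrite (leq_trans (size_polyD _ _)) // geq_max size_polyN size_poly1 sl andbT; lia.
Qed.
End UnivariateOperators.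

(** * Coordinate degrees and separation by functionals *)

Section Degrees.
Variable R : realType.
Local Notation poly3 := (mpoly 3 R).
Implicit Types (m n : 'I_3) (q : 'I_3 -> {poly R}) (p : poly3) (d : 'I_3 -> nat).
Implicit Types (L : {poly R} -> {poly R}).

Lemma mcoeff_tens q (b : multinom 3) : mcoeff b (tens q) = \prod_i (q i)`_(b i).
Proof.
move: q; pose F := fun q => mcoeff b (tens q) : R^o.
pose G := fun q => \prod_i (q i)`_(b i) : R^o.
apply: (@multilinear_mono_eq _ _ F G).
- by move=> q i c x y; rewrite /F tens_upd_linear mcoeffD mcoeffZ.
- move=> q i c x y.
  have E r : G (upd q i r) = r`_(b i) * \prod_(j | j != i) (q j)`_(b j).
    rewrite /G (bigD1 i) //= upd_same; congr (_ * _).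
    by apply: eq_bigr => j ji; rewrite upd_other.
  by rewrite !E coefD coefZ mulrDl -mulrA.
move=> a; rewrite /F /G.
have -> : mono R a = mono R (Multinom [tuple a i | i < 3]).
  by apply: funext => i; rewrite /mono mnmE.
rewrite tens_mono mcoeffX; case: eqVneq => [<-|ab].
  by rewrite big1 // => i _; rewrite coefXn eqxx.
apply/esym; have [i] : exists i, (Multinom [tuple a i | i < 3] : multinom 3) i != b i.
  by apply/existsP; apply: contra_neqT ab => /existsPn h; apply/mnmP => i; apply/eqP; have := h i; rewrite negbK.
by move=> iab; rewrite (bigD1 i) //= coefXn eq_sym (negbTE iab) mul0r.
Qed.

Definition deglt d p := forall a, a \in msupp p -> forall i, (a i < d i)%N.

Lemma deglt0 d : deglt d 0.
Proof. by move=> a; rewrite msupp0. Qed.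

Lemma degltD d p p' : deglt d p -> deglt d p' -> deglt d (p + p').
Proof. by move=> h h' a /msuppD_le; rewrite mem_cat => /orP[/h|/h']. Qed.

Lemma degltZ d c p : deglt d p -> deglt d (c *: p).
Proof. by move=> h a /msuppZ_le /h. Qed.

Lemma degltN d p : deglt d p -> deglt d (- p).
Proof. by move=> h; rewrite -scaleN1r; exact: degltZ. Qed.

Lemma degltB d p p' : deglt d p -> deglt d p' -> deglt d (p - p').
Proof. by move=> h h'; apply: degltD => //; exact: degltN. Qed.

Lemma deglt_sum d (I : Type) (r : seq I) (P : pred I) (F : I -> poly3) :
  (forall i, P i -> deglt d (F i)) -> deglt d (\sum_(i <- r | P i) F i).
Proof. by move=> h; elim/big_rec: _ => [|i x Pi]; [exact: deglt0|apply: degltD; exact: h]. Qed.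

Lemma deglt_tens d q : (forall i, (size (q i) <= d i)%N) -> deglt d (tens q).
Proof.
move=> h a; rewrite mcoeff_msupp mcoeff_tens => /prodf_neq0 nz i.
have := nz i isT; apply: contraR; rewrite -leqNgt => da.
by rewrite nth_default // (leq_trans (h i)).
Qed.

Lemma deglt_lift m L e d p : (forall j, (j < d m)%N -> (size (L 'X^j) <= e)%N) ->
  deglt d p -> deglt (upd d m e) (lift m L p).
Proof.
move=> Le dp; rewrite /lift big_seq; apply: deglt_sum => a /dp ad.
apply/degltZ/deglt_tens => i; rewrite /upd; case: eqP => [_|_]; first exact/Le/ad.
by rewrite /mono size_polyXn.
Qed.

Lemma deglt_lift_same m L d p :
  (forall f : {poly R}, (size f <= d m)%N -> (size (L f) <= d m)%N) ->
  deglt d p -> deglt d (lift m L p).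
Proof.
move=> Ld dp; rewrite -(upd_id d m); apply: deglt_lift => // j jd.
by apply: Ld; rewrite size_polyXn.
Qed.

(** The coefficient, a polynomial in the variable m, of the monomial with exponents [b] in the other
    two variables; the entry [b m] is ignored. *)
Definition slice m (b : 'I_3 -> nat) p : {poly R} :=
  \sum_(a <- msupp p | [forall i, (i != m) ==> (a i == b i)]) mcoeff a p *: 'X^(a m).

Lemma mcoeff_lift_const m (mu : {poly R} -> R) p (b : multinom 3) : scalar mu ->
  b m = 0%N -> mcoeff b (lift m (fun f => (mu f)%:P) p) = mu (slice m b p).
Proof.
move=> mul bm; have mul' : linear (mu : {poly R} -> R^o) by [].
rewrite /lift /slice linear_sum -[in RHS]big_filter (linear_sumZ mul') big_filter [RHS]big_mkcond /=.
apply: eq_bigr => a _; rewrite linearZ /= mcoeff_tens (bigD1 m) //= upd_same bm coefC eqxx.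
case: ifPn => [/forallP h|].
  rewrite [X in _ * (_ * X)]big1 ?mulr1 // => i im; rewrite upd_other // /mono coefXn.
  by have := h i; rewrite im /= => /eqP->; rewrite eqxx.
rewrite negb_forall => /existsP[i]; rewrite negb_imply => /andP[im ai].
by rewrite [X in _ * (_ * X)](bigD1 i) //= upd_other // /mono coefXn eq_sym (negbTE ai) mul0r !mulr0.
Qed.

Lemma coef_slice m (b : multinom 3) p : (slice m b p)`_(b m) = mcoeff b p.
Proof.
rewrite /slice coef_sum.
have [bp|bp] := boolP (b \in msupp p); last first.
  rewrite (memN_msupp_eq0 bp) big1_seq // => a /andP[/forallP h ap].
  rewrite coefZ coefXn; case: eqVneq => [ba|]; rewrite ?mulr0 //.
  suff ab : a = b by rewrite ab in ap; rewrite ap in bp.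
  apply/mnmP => i; case: (eqVneq i m) => [->//|im].
  by have := h i; rewrite im /= => /eqP.
rewrite big_mkcond (bigD1_seq b) ?msupp_uniq //= ifT; last first.
  by apply/forallP => i; rewrite eqxx implybT.
rewrite coefZ coefXn eqxx mulr1 big1 ?addr0 // => a ab.
case: ifP => // /forallP h.
rewrite coefZ coefXn; case: eqVneq => [bam|]; rewrite ?mulr0 //; case/eqP: ab.
apply/mnmP => i; case: (eqVneq i m) => [->//|im].
by have := h i; rewrite im /= => /eqP.
Qed.

Lemma size_slice m b d p : deglt d p -> (size (slice m b p) <= d m)%N.
Proof.
move=> dp; rewrite /slice big_seq_cond.
apply: (big_ind (fun f : {poly R} => (size f <= d m)%N)).
- by rewrite size_poly0.
- by move=> x y hx hy; rewrite (leq_trans (size_polyD _ _)) // geq_max hx hy.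
move=> a /andP[/dp/(_ m) ad _]; rewrite (leq_trans (size_scale_leq _ _)) //.
by rewrite size_polyXn.
Qed.

(** Every coefficient of [p] is a coefficient of a slice, and a lifted functional acts on each slice
    separately. *)
Lemma lift_separate m d p (Theta : set ({poly R} -> R)) :
  (forall mu, Theta mu -> scalar mu) ->
  (forall f : {poly R}, (size f <= d m)%N -> (forall mu, Theta mu -> mu f = 0) -> f = 0) ->
  deglt d p -> (forall mu, Theta mu -> lift m (fun f => (mu f)%:P) p = 0) -> p = 0.
Proof.
move=> Tl sep dp h; apply/mpolyP => b; rewrite mcoeff0 -(coef_slice m).
rewrite (sep (slice m b p)) ?coef0 ?size_slice // => mu Tmu.
(* A lifted functional produces a polynomial constant in the variable m, so its value on the slice
   is found at an exponent with m-th entry zero. The slice itself does not depend on that entry. *)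
pose b' : multinom 3 := Multinom [tuple upd b m 0%N i | i < 3].
have bb' : slice m b p = slice m b' p.
  rewrite /slice; apply: eq_bigl => a; apply: eq_forallb => i.
  by rewrite mnmE /upd; case: eqP.
have b'm : b' m = 0%N by rewrite mnmE upd_same.
by rewrite bb' -(@mcoeff_lift_const m mu p b' (Tl _ Tmu) b'm) h // mcoeff0.
Qed.

Lemma deglt_mderiv m d p : deglt d p -> deglt (upd d m (d m).-1) (mderiv m p).
Proof.
move=> dp; rewrite -lift_deriv; apply: deglt_lift dp => j jd.
case: j jd => [|j] jd; first by rewrite expr0 -polyC1 derivC size_poly0.
rewrite derivXn -scaler_nat (leq_trans (size_scale_leq _ _)) // size_polyXn /=; lia.
Qed.

Lemma degltW d d' p : (forall i, (d i <= d' i)%N) -> deglt d p -> deglt d' p.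
Proof. by move=> dd h a /h ad i; apply: leq_trans (dd i). Qed.
End Degrees.

(** * Geometry of face-to-face box meshes *)

Section MeshGeometry.
Variables (R : realType) (M : mesh R).
Implicit Types (c : 'I_(ncells M)) (m n : 'I_3).

Definition clo c n : R := lo (cell c) 0 n.
Definition chi c n : R := hi (cell c) 0 n.

Lemma clo_lt_chi c n : clo c n < chi c n.
Proof. exact: cell_nondegenerate. Qed.

Definition incell c (p : 'rV[R]_3) := box_set (cell c) p.

Definition adj m c c' := chi c m = clo c' m /\
  forall n, n != m -> clo c n = clo c' n /\ chi c n = chi c' n.

Definition same_cross m c c' := forall n, n != m -> clo c n = clo c' n /\ chi c n = chi c' n.

Lemma proper_dim (D : seq 'I_3) : (size D < 3)%N -> exists i, i \notin D.
Proof.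
move=> D3; apply/existsP; apply: contraLR D3; rewrite negb_exists -leqNgt => /forallP h.
rewrite -{1}(size_enum_ord 3); apply: uniq_leq_size; rewrite ?enum_uniq // => i _.
by have := h i; rewrite negbK.
Qed.

(** The intersection is a common face of dimension at most two. In a direction in which this face is
    degenerate the two intervals share a single point, so they abut there; in the other directions
    they coincide. *)
Lemma cells_meet c c' p : c != c' -> incell c p -> incell c' p ->
  (forall n, [\/ clo c n = clo c' n /\ chi c n = chi c' n,
                 p 0 n = chi c n /\ chi c n = clo c' n
               | p 0 n = clo c n /\ clo c n = chi c' n]) /\
  (exists n, ~ (clo c n = clo c' n /\ chi c n = chi c' n)).
Proof.
move=> cc' cp c'p; case: (face_to_face cc') => [e|[D [G [D3 Gc Gc' e]]]].
  have : (box_set (cell c) `&` box_set (cell c')) p by [].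
  by rewrite e.
have pG : box_set G p by rewrite -e.
have npt n : n \notin D -> [\/ clo c n = clo c' n /\ chi c n = chi c' n,
                 p 0 n = chi c n /\ chi c n = clo c' n
               | p 0 n = clo c n /\ clo c n = chi c' n] /\
               ~ (clo c n = clo c' n /\ chi c n = chi c' n).
  move=> nD; have := Gc n; have := Gc' n; rewrite (negbTE nD) -/(clo _ _) -/(chi _ _).
  move=> [gg g1] [_ g2]; have pg : p 0 n = lo G 0 n.
    by have := pG n; rewrite -gg => /andP[? ?]; apply/eqP; rewrite eq_le; apply/andP.
  have deg q : incell c q -> incell c' q -> q 0 n = lo G 0 n.
    move=> cq c'q; have : box_set G q by rewrite -e.
    by move=> /(_ n); rewrite -gg => /andP[? ?]; apply/eqP; rewrite eq_le; apply/andP.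
  (* Moving coordinate n of [p] within both intervals stays in both cells, hence in [G], which is
     flat in direction n. *)
  have nolap t : clo c n <= t <= chi c n -> clo c' n <= t <= chi c' n -> t = lo G 0 n.
    move=> tc tc'; pose q : 'rV[R]_3 := \row_i if i == n then t else p 0 i.
    have <- : q 0 n = t by rewrite mxE eqxx.
    apply: deg => i; rewrite mxE; case: eqP => [->|_] //.
  have := clo_lt_chi c n; have := clo_lt_chi c' n; rewrite /clo /chi in nolap g1 g2 *.
  move=> l1 l2; rewrite pg.
  (* If both lower ends or both upper ends were in [G], the intervals would overlap in more than one
     point; these are the first and the last case. *)
  case: g1 => g1; case: g2 => g2.
  - have := nolap (Num.min (hi (cell c) 0 n) (hi (cell c') 0 n)).
    by rewrite !le_min !ge_min => h; exfalso; case: (leP (hi (cell c) 0 n) (hi (cell c') 0 n)) h => _ h;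
      have := h _ _; lra.
  - by split; [constructor 2; split; lra|lra].
  - by split; [constructor 3; split; lra|lra].
  - have := nolap (Num.max (lo (cell c) 0 n) (lo (cell c') 0 n)).
    by rewrite !le_max !ge_max => h; exfalso; case: (leP (lo (cell c) 0 n) (lo (cell c') 0 n)) h => _ h;
      have := h _ _; lra.
split=> [n|]; last by have [i iD] := proper_dim D3; exists i; case: (npt i iD).
have [nD|nD] := boolP (n \in D); last by case: (npt n nD).
have := Gc n; have := Gc' n; rewrite nD /clo /chi => -[-> ->] [<- <-].
by constructor 1.
Qed.

Lemma cells_overlap c c' : (forall n, clo c n < chi c' n /\ clo c' n < chi c n) -> c = c'.
Proof.
move=> ov; apply/eqP; apply/negPn/negP => cc'.
pose p : 'rV[R]_3 := \row_n Num.max (clo c n) (clo c' n).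
have cp : incell c p.
  move=> n; rewrite mxE -/(clo _ _) -/(chi _ _) le_max lexx ge_max (ltW (clo_lt_chi _ _)) /=.
  by case: (ov n) => _ /ltW.
have c'p : incell c' p.
  move=> n; rewrite mxE -/(clo _ _) -/(chi _ _) le_max lexx orbT ge_max (ltW (clo_lt_chi _ _)) andbT /=.
  by case: (ov n) => /ltW.
have [tri [n]] := cells_meet cc' cp c'p; case: (tri n) => // -[] _ e _; have := ov n; rewrite e.
  by rewrite ltxx => -[].
by rewrite ltxx => -[].
Qed.

Lemma same_cross_sym m c c' : same_cross m c c' -> same_cross m c' c.
Proof. by move=> h n nm; case: (h n nm) => -> ->. Qed.

Lemma same_cross_trans m c c' c'' : same_cross m c c' -> same_cross m c' c'' -> same_cross m c c''.
Proof. by move=> h h' n nm; case: (h n nm) => -> ->; exact: h'. Qed.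

Lemma adj_cross m c c' : adj m c c' -> same_cross m c c'.
Proof. by case. Qed.

(** Cells with the same cross-section are stacked along the axis m, and none fits between two
    adjacent ones without overlapping the lower one. *)
Lemma column_step m c c' : adj m c c' -> forall t, same_cross m t c' ->
  (chi t m <= clo c' m) = (chi t m <= clo c m) || (t == c).
Proof.
move=> [e sc] t st; rewrite -e; case: eqVneq => [->|tc] /=; first by rewrite lexx orbT.
rewrite orbF; apply/idP/idP => [le1|/le_trans]; last by apply; exact/ltW/clo_lt_chi.
rewrite leNgt; apply/negP => lt1; case/eqP: tc; apply: cells_overlap => n.
have [->|nm] := eqVneq n m.
  by split=> //; apply: lt_le_trans (clo_lt_chi _ _) le1.
case: (sc n nm) (st n nm) => e1 e2 [e3 e4].
by rewrite e1 e2 e3 e4; split; exact: clo_lt_chi.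
Qed.
End MeshGeometry.

(** * Spline spaces and the de Rham complex *)

Section ConformingSplines.
Variables (R : realType) (M : mesh R) (k : nat).
Local Notation poly3 := (mpoly 3 R).
Local Notation cells := 'I_(ncells M).
Implicit Types (c : cells) (m n : 'I_3) (r : nat) (a b : R).
Implicit Types (L : 'I_3 -> nat) (f g : cells -> poly3).

(** The jet is kept as a polynomial in three variables that is constant in the variable m, so traces
    from different cells can be compared and differentiated like any other polynomial. *)
Definition trace r m a : poly3 -> poly3 := lift m (fun q => (jet r a q)%:P).

HB.instance Definition _ r m a := GRing.Linear.on (trace r m a).

Lemma trace_comm m n r a (o : {poly R} -> {poly R}) (p : poly3) : m != n -> linear o ->
  trace r m a (lift n o p) = lift n o (trace r m a p).
Proof. by move=> mn ol; rewrite /trace lift_comm //; apply: linear_constP; exact: jet_scalar. Qed.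

Lemma mderiv_lift_comm m n (o : {poly R} -> {poly R}) (p : poly3) : m != n -> linear o ->
  mderiv m (lift n o p) = lift n o (mderiv m p).
Proof. by move=> mn ol; rewrite -!lift_deriv lift_comm //; exact: linearP. Qed.

Lemma trace_mderiv_comm m n r a (p : poly3) : m != n ->
  trace r m a (mderiv n p) = mderiv n (trace r m a p).
Proof. by move=> mn; rewrite -!lift_deriv trace_comm //; exact: linearP. Qed.

Lemma trace_lift m r a (o : {poly R} -> {poly R}) (p : poly3) : linear o ->
  trace r m a (lift m o p) = lift m (fun q => (jet r a (o q))%:P) p.
Proof. by move=> ol; rewrite /trace lift_comp //; apply: linear_constP; exact: jet_scalar. Qed.

Lemma trace_mderiv m r a (p : poly3) : trace r m a (mderiv m p) = trace r.+1 m a p.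
Proof.
rewrite -lift_deriv trace_lift; last exact: linearP.
by apply: eq_lift => f; rewrite jet_deriv.
Qed.

Lemma mderiv_trace m r a (p : poly3) : mderiv m (trace r m a p) = 0.
Proof.
rewrite -lift_deriv /trace lift_comp; [|exact: linearP|apply: linear_constP; exact: jet_scalar].
by rewrite -[RHS](lift0 m p); apply: eq_lift => f /=; rewrite derivC.
Qed.

Definition conf L f :=
  (forall c, deglt (fun i => (k + L i)%N) (f c)) /\
  (forall m c c' r, adj m c c' -> (r < L m)%N ->
     trace r m (chi c m) (f c) = trace r m (chi c m) (f c')).

Lemma eq_conf L L' f : L =1 L' -> conf L f -> conf L' f.
Proof.
move=> LL [fd fj]; split=> [c a /fd h i|m c c' r cc' rl]; first by rewrite -LL.
by apply: fj => //; rewrite LL.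
Qed.

Lemma conf0 L : conf L (fun=> 0).
Proof. by split=> *; [exact: deglt0|]. Qed.

Lemma confD L f g : conf L f -> conf L g -> conf L (fun c => f c + g c).
Proof.
move=> [fd fj] [gd gj]; split=> [c|m c c' r cc' rl]; first exact: degltD.
by rewrite !linearD /= (fj _ _ _ _ cc') // (gj _ _ _ _ cc').
Qed.

Lemma confZ L x f : conf L f -> conf L (fun c => x *: f c).
Proof.
move=> [fd fj]; split=> [c|m c c' r cc' rl]; first exact: degltZ.
by rewrite !linearZ /= (fj _ _ _ _ cc').
Qed.

Lemma confN L f : conf L f -> conf L (fun c => - f c).
Proof.
move=> /(confZ (-1)); congr (conf L _); apply: funext => c; exact: scaleN1r.
Qed.

Lemma confB L f g : conf L f -> conf L g -> conf L (fun c => f c - g c).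
Proof. by move=> hf hg; apply: confD => //; exact: confN. Qed.

Lemma conf_mderiv m L f : conf L f -> conf (upd L m (L m).-1) (fun c => mderiv m (f c)).
Proof.
move=> [fd fj]; split=> [c|n c c' r cc'].
  apply: degltW (deglt_mderiv (m := m) (fd c)) => i; rewrite /upd; case: eqP => // _; lia.
rewrite /upd; case: eqVneq => [nm|nm] rl.
  by rewrite nm in cc' *; rewrite !trace_mderiv; apply: (fj m) => //; lia.
by rewrite !trace_mderiv_comm // (fj n c c').
Qed.

(** Only faces normal to m have to be checked: across any other face the two cells have the same
    interval in direction m, so the same operator is applied on both sides and it commutes with the
    trace. *)
Lemma conf_lift m L l f (o : R -> R -> {poly R} -> {poly R}) : conf L f ->
  (forall a b, linear (o a b)) ->
  (forall a b (q : {poly R}), (size q <= k + L m)%N -> (size (o a b q) <= k + l)%N) ->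
  (forall c c' r, adj m c c' -> (r < l)%N ->
     trace r m (chi c m) (lift m (o (clo c m) (chi c m)) (f c)) =
     trace r m (chi c m) (lift m (o (clo c' m) (chi c' m)) (f c'))) ->
  conf (upd L m l) (fun c => lift m (o (clo c m) (chi c m)) (f c)).
Proof.
move=> [fd fj] ol od oj; split=> [c|n c c' r cc'].
  have := deglt_lift (m := m) (L := o (clo c m) (chi c m)) (e := k + l) _ (fd c).
  move=> h; apply: degltW (h _) => [i|j jl]; first by rewrite /upd; case: eqP.
  by apply: od; rewrite size_polyXn.
rewrite /upd; case: eqVneq => [nm|nm] rl; first by rewrite nm in cc' *; exact: oj.
rewrite !trace_comm // (fj n c c') //; case: cc' => _ /(_ m); rewrite eq_sym => /(_ nm) [-> ->] //.
Qed.

Section Homotopy.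
Variables (m : 'I_3) (L : 'I_3 -> nat).
Hypothesis (k2 : (2 <= k)%N) (Lm : (0 < L m <= 2)%N).
Let l := L m.
Let L1 := upd L m l.-1.

Definition hmt_at c : poly3 -> poly3 := lift m (hmt l (clo c m) (chi c m)).
Definition pi0_at c : poly3 -> poly3 := lift m (pi0 l (clo c m) (chi c m)).
Definition pi1_at c : poly3 -> poly3 := lift m (pi1 l (clo c m) (chi c m)).

Lemma conf_hmt f : conf L1 f -> conf L (fun c => hmt_at c (f c)).
Proof.
move=> cf; have [fd fj] := cf.
have eL : upd L1 m l =1 L by move=> i; rewrite /L1 upd_upd upd_id.
apply: (eq_conf eL).
apply: (conf_lift (o := hmt l) cf) => [a b|a b q sq|c c' r cc' rl].
- exact: hmt_linear.
- rewrite /L1 upd_same in sq; have -> : (k + l = (k + l.-1).+1)%N by rewrite /l; lia.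
  by apply: size_hmt => //; rewrite /l; lia.
have l2 : (l <= 2)%N by rewrite /l; lia.
rewrite !trace_lift; try exact: hmt_linear.
have ne t : clo t m != chi t m by rewrite lt_eqF // clo_lt_chi.
rewrite (eq_lift m (L' := fun q => (if r is 0 then 0 else jet 0 (chi c m) q)%:P)); last first.
  by move=> q; rewrite jet_hmt //; right.
rewrite [RHS](eq_lift m (L' := fun q => (if r is 0 then 0 else jet 0 (chi c m) q)%:P)); last first.
  by move=> q; rewrite jet_hmt //; left; case: cc'.
case: r rl => [|r] rl; first by rewrite !(lift0 m).
by rewrite -/(trace 0 m (chi c m) _) (fj m c c' 0%N) // /L1 upd_same; lia.
Qed.

Lemma conf_pi0 f : conf L f -> conf L (fun c => pi0_at c (f c)).
Proof.
move=> cf; have [fd fj] := cf.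
have ne t : clo t m != chi t m by rewrite lt_eqF // clo_lt_chi.
have eL : upd L m l =1 L by move=> i; rewrite upd_id.
apply: (eq_conf eL).
apply: (conf_lift (o := pi0 l) cf) => [a b|a b q sq|c c' r cc' rl].
- exact: pi0_linear.
- by apply: size_pi0; rewrite /l; lia.
have l2 : (l <= 2)%N by rewrite /l; lia.
rewrite !trace_lift; try exact: pi0_linear.
have jpi a b e q : a != b -> e = a \/ e = b ->
    jet r e (pi0 l a b q) = (r == 0)%:R * jet 0 e q.
  move=> ab eab; have j1 : jet r e (1 - lam l a b) = (r == 0)%:R - jet r e (lam l a b).
    rewrite /jet derivnB !hornerD !hornerN; congr (_ - _).
    by rewrite -polyC1 derivnC; case: (r) => [|r']; rewrite ?hornerC ?horner0.
  have -> : jet r e (pi0 l a b q) = q.[a] * jet r e (1 - lam l a b) + q.[b] * jet r e (lam l a b).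
    by rewrite /pi0 /jet derivnD !derivnZ hornerD !hornerZ.
  rewrite j1; case: eab => ->; rewrite ?jet_lam_a ?jet_lam_b // /jet derivn0; ring.
rewrite (eq_lift m (L' := fun q => ((r == 0)%:R * jet 0 (chi c m) q)%:P)); last first.
  by move=> q; rewrite jpi //; right.
rewrite [RHS](eq_lift m (L' := fun q => ((r == 0)%:R * jet 0 (chi c m) q)%:P)); last first.
  by move=> q; rewrite jpi //; left; case: cc'.
case: (r == 0)%N.
  have e1 (x : {poly R}) : (1%:R * jet 0 (chi c m) x)%:P = (jet 0 (chi c m) x)%:P by rewrite mul1r.
  by rewrite !(eq_lift m e1) -!/(trace 0 m (chi c m) _) (fj m c c' 0%N) // -/l; lia.
have e0 (x : {poly R}) : (0%:R * jet 0 (chi c m) x)%:P = 0 by rewrite mul0r.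
by rewrite !(eq_lift m e0) !(lift0 m).
Qed.

Lemma trace_pi1 c r e (p : poly3) : (r < l.-1)%N -> e = clo c m \/ e = chi c m ->
  trace r m e (pi1_at c p) = 0.
Proof.
move=> rl ec; have l2 : l = 2%N by rewrite /l in rl *; lia.
have r0 : r = 0%N by rewrite l2 in rl; lia.
have ne : clo c m != chi c m by rewrite lt_eqF // clo_lt_chi.
rewrite /pi1_at trace_lift; last exact: pi1_linear.
rewrite -[RHS](lift0 m p); apply: eq_lift => q.
suff -> : jet r e (pi1 l (clo c m) (chi c m) q) = 0 by [].
rewrite /pi1 /jet r0 derivn0 hornerZ; apply/eqP; rewrite mulf_eq0; apply/orP; right; apply/eqP.
rewrite l2; case: ec => ->.
  exact: (@jet_lam_a R 2 1 (clo c m) (chi c m) isT isT).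
exact: (jet_lam_b ne (isT : 1 < 2)%N isT).
Qed.

Lemma conf_pi1 f : conf L1 f -> conf L1 (fun c => pi1_at c (f c)).
Proof.
have eL : upd L1 m l.-1 =1 L1 by move=> i; rewrite /L1 upd_upd.
move=> cf; apply: (eq_conf eL).
apply: (conf_lift (o := pi1 l) cf) => [a b|a b q sq|c c' r cc' rl].
- exact: pi1_linear.
- by apply: size_pi1; rewrite /l; lia.
rewrite (@trace_pi1 c) //; last by right.
by rewrite (@trace_pi1 c') //; left; case: cc'.
Qed.

Lemma mderiv_hmt c p : mderiv m (hmt_at c p) = p - pi1_at c p.
Proof.
rewrite -lift_deriv /hmt_at lift_comp; [|exact: linearP|exact: hmt_linear].
rewrite (eq_lift m (L' := fun q => q - pi1 l (clo c m) (chi c m) q)); last first.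
  by move=> q /=; rewrite deriv_hmt.
by rewrite liftB (lift_id m).
Qed.

Lemma hmt_mderiv c p : hmt_at c (mderiv m p) = p - pi0_at c p.
Proof.
rewrite -lift_deriv /hmt_at lift_comp; [|exact: hmt_linear|exact: linearP].
rewrite (eq_lift m (L' := fun q => q - pi0 l (clo c m) (chi c m) q)); last first.
  by move=> q /=; rewrite hmt_deriv.
by rewrite liftB (lift_id m).
Qed.

Lemma pi1_mderiv c p : pi1_at c (mderiv m p) = mderiv m (pi0_at c p).
Proof.
rewrite -!lift_deriv /pi0_at /pi1_at !lift_comp; try exact: linearP; try exact: pi0_linear; try exact: pi1_linear.
by apply: eq_lift => q /=; rewrite pi1_deriv.
Qed.
End Homotopy.

(** The primitive along a column is continued from cell to cell by adding the integrals over all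
    cells below. Neighbouring columns may be stacked differently, and the accumulated integrals
    match across their sides because their traces vanish there. Gaps in a column do no harm, since
    only adjacent cells have to match. *)
Lemma column_integral m L f : conf L f ->
  (forall n c r e, n != m -> (r < L n)%N -> e = clo c n \/ e = chi c n -> trace r n e (f c) = 0) ->
  exists2 G, conf (upd L m (L m).+1) G & forall c, mderiv m (G c) = f c.
Proof.
move=> [fd fj] fv.
pose P a := lift m (prim0 a).
pose I a b := lift m (fun q : {poly R} => (defint a b q)%:P).
have Pl a : linear (prim0 a) := prim0_linear a.
have Il a b : linear (fun q : {poly R} => (defint a b q)%:P).
  by apply: linear_constP; exact: defint_scalar.
pose below c t := `[< same_cross m t c /\ chi t m <= clo c m >].
pose G c := P (clo c m) (f c) + \sum_(t | below c t) I (clo t m) (chi t m) (f t).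
exists G => [|c]; last first.
  rewrite /G linearD [X in _ + X]linear_sum [X in _ + X]big1 /= => [|t _].
    rewrite addr0 -lift_deriv /P lift_comp //; last exact: linearP.
    by rewrite -[RHS](lift_id m); apply: eq_lift => q; exact: deriv_prim0.
  rewrite -lift_deriv /I lift_comp //; last exact: linearP.
  by rewrite -[RHS](lift0 m (f t)); apply: eq_lift => q /=; rewrite derivC.
split=> [c|n c c' r cc'].
  apply: degltD.
    apply: degltW (deglt_lift (e := k + (L m).+1) _ (fd c)) => [i|j jl].
      by rewrite /upd; case: eqP.
    by rewrite addnS size_prim0 // size_polyXn.
  apply: deglt_sum => t _; apply: degltW (deglt_lift (e := k + (L m).+1) _ (fd t)) => [i|j jl].
    by rewrite /upd; case: eqP.
  by rewrite (leq_trans (size_polyC_leq1 _)) ?addnS.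
have traceI t s a x b : trace 0 m x (I a b (f t)) = I a b (f t) /\ trace s.+1 m x (I a b (f t)) = 0.
  rewrite /I !trace_lift //; split.
    by apply: eq_lift => q; rewrite /jet derivn0 hornerC.
  rewrite -[RHS](lift0 m (f t)); apply: eq_lift => q.
  by rewrite /jet derivnC /= horner0.
rewrite /upd; case: eqVneq => [nm|nm] rl.
  rewrite nm in cc' *; have [e sc] := cc'.
  have belowE t : below c' t = below c t || (t == c).
    rewrite /below; apply/asboolP/orP => [[st]|[/asboolP[st le1]|/eqP->]].
    - rewrite (column_step cc' st) => /orP[le1|]; [left|by right].
      by apply/asboolP; split=> //; apply: same_cross_trans st _; exact/same_cross_sym/adj_cross.
    - by split; [exact: same_cross_trans st (adj_cross cc')|rewrite -e (le_trans le1) // ltW // clo_lt_chi].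
    - by split; [exact: adj_cross|rewrite e].
  have nbc : ~~ below c c by apply/asboolP => -[_]; rewrite leNgt clo_lt_chi.
  have sumE (F : cells -> poly3) : \sum_(t | below c' t) F t = F c + \sum_(t | below c t) F t.
    rewrite (bigD1 c) /=; last by rewrite belowE eqxx orbT.
    congr (_ + _); apply: eq_bigl => t; rewrite belowE.
    by case: eqVneq => [->|]; rewrite ?(negbTE nbc) ?orbF ?andbF ?andbT.
  rewrite /G sumE.
  rewrite addrA 2!linearD /=; congr (_ + _); rewrite linearD /=.
  (* At the common face the primitive in [c] equals the integral over [c], which is the additional
     summand for [c'], and the primitive in [c'] starts at zero. Jets of positive order are jets of
     [f]. *)
  case: r rl => [|r] rl.
    rewrite (traceI c 0%N _ _ _).1 /P !trace_lift // -e.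
    rewrite [X in _ = X + _](_ : _ = 0); last first.
      by rewrite -[RHS](lift0 m (f c')); apply: eq_lift => q; rewrite /jet derivn0 !hornerE subrr.
    by rewrite add0r; apply: eq_lift => q; rewrite /jet derivn0 !hornerE.
  rewrite (traceI c r _ _ _).2 addr0.
  have tP a t : trace r.+1 m (chi c m) (P a (f t)) = trace r m (chi c m) (f t).
    by rewrite /P trace_lift //; apply: eq_lift => q; rewrite -jet_deriv deriv_prim0.
  by rewrite !tP (fj m c c' r).
have traceG s e t : trace s n e (G t) = trace s n e (P (clo t m) (f t)) +
    \sum_(u | below t u) trace s n e (I (clo u m) (chi u m) (f u)).
  by rewrite /G linearD; congr (_ + _); rewrite linear_sum.
rewrite !traceG.
rewrite (_ : trace r n (chi c n) (P (clo c m) (f c)) = trace r n (chi c n) (P (clo c' m) (f c'))); last first.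
  rewrite /P !trace_comm // (fj n c c') //; case: cc' => _ /(_ m); rewrite eq_sym => /(_ nm) [-> _] //.
(* The cells below [c] and those below [c'] are not paired with each other; every single summand has
   zero trace on this face. *)
congr (_ + _); transitivity (0 : poly3).
  apply: big1 => t /asboolP[st _]; rewrite /I trace_comm // (fv n t) ?linear0 //.
  by right; case: (st n nm).
apply/esym/big1 => t /asboolP[st _]; rewrite /I trace_comm // (fv n t) ?linear0 //.
by left; case: cc' => -> _; case: (st n nm).
Qed.
End ConformingSplines.

Section TensorFunctionals.
Variable R : realType.
Local Notation poly3 := (mpoly 3 R).
Implicit Types (m n i : 'I_3) (q : 'I_3 -> {poly R}) (p : poly3).
Implicit Types (o : 'I_3 -> {poly R} -> {poly R}) (mu : 'I_3 -> {poly R} -> R).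

Lemma ord3P m : [\/ m = 0, m = 1 | m = 2%:R].
Proof.
by case: m => -[|[|[|//]]] h; [constructor 1|constructor 2|constructor 3]; apply: val_inj.
Qed.

Lemma ord3E : (0 + 1 = 1 :> 'I_3) * (0 + 2%:R = 2%:R :> 'I_3) * (1 + 1 = 2%:R :> 'I_3) *
  (1 + 2%:R = 0 :> 'I_3) * (2%:R + 1 = 0 :> 'I_3) * (2%:R + 2%:R = 1 :> 'I_3).
Proof. by repeat split; apply: val_inj. Qed.

Lemma ord3A m : (m + 1 + 1 = m + 2%:R) * (m + 1 + 2%:R = m) * (m + 2%:R + 1 = m) *
  (m + 2%:R + 2%:R = m + 1).
Proof. by case: (ord3P m) => ->; repeat split; apply: val_inj. Qed.

Lemma ord3_neq m : [/\ m + 1 != m, m + 2%:R != m & m + 1 != m + 2%:R].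
Proof. by case: (ord3P m) => ->; split. Qed.

Lemma ord3F m : ((m + 1 == m) = false) * ((m == m + 1) = false) * ((m + 2%:R == m) = false) *
  ((m == m + 2%:R) = false) * ((m + 1 == m + 2%:R) = false) * ((m + 2%:R == m + 1) = false).
Proof. by case: (ord3P m) => ->. Qed.

Lemma ord3_rel m i : [\/ i = m, i = m + 1 | i = m + 2%:R].
Proof.
by case: (ord3P m) => ->; case: (ord3P i) => ->;
  [constructor 1|constructor 2|constructor 3|constructor 3|constructor 1|constructor 2
  |constructor 2|constructor 3|constructor 1]; apply: val_inj.
Qed.

Lemma sum3 (V : nmodType) (F : 'I_3 -> V) m : \sum_i F i = F m + F (m + 1) + F (m + 2%:R).
Proof.
have [n1 n2 n3] := ord3_neq m.
rewrite (bigD1 m) //= (bigD1 (m + 1)) //= (bigD1 (m + 2%:R)) /=; last by rewrite n2 eq_sym.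
rewrite big1 ?addr0 => [|i /andP[/andP[i1 i2] i3]]; first exact: addrA.
by case: (ord3_rel m i) i1 i2 i3 => ->; rewrite eqxx.
Qed.

Definition lift3 o p := lift 0 (o 0) (lift 1 (o 1) (lift 2%:R (o 2%:R) p)).

Lemma lift3_tens o q : (forall i, linear (o i)) -> lift3 o (tens q) = tens (fun i => o i (q i)).
Proof.
move=> ol; rewrite /lift3 !lift_tens //; congr tens; apply: funext => i.
by case: (ord3P i) => ->.
Qed.

Lemma lift3_linear o : linear (lift3 o).
Proof. by move=> c x y; rewrite /lift3 !linearP. Qed.

Lemma tens_const (c : 'I_3 -> R) : tens (fun i => (c i)%:P) = mpolyC 3 (\prod_i c i).
Proof.
rewrite /tens rmorph_prod; apply: eq_bigr => i _.
by rewrite horner_algC alg_mpolyC.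
Qed.

(** The tensor product of three functionals: after lifting all of them the polynomial is constant,
    and its constant coefficient is the value. *)
Definition fun3 mu p : R := mcoeff (@mnm0 3) (lift3 (fun i f => (mu i f)%:P) p).

Lemma fun3_tens mu q : (forall i, scalar (mu i)) -> fun3 mu (tens q) = \prod_i mu i (q i).
Proof.
move=> mul; rewrite /fun3 lift3_tens => [|i]; last exact: linear_constP.
by rewrite tens_const mcoeffC eqxx mulr1.
Qed.

Lemma fun3_scalar mu : scalar (fun3 mu).
Proof. by move=> c x y; rewrite /fun3 lift3_linear mcoeffD mcoeffZ. Qed.

Lemma fun30 mu : fun3 mu 0 = 0.
Proof. by rewrite /fun3 /lift3 !linear0. Qed.

Lemma fun3D mu p p' : fun3 mu (p + p') = fun3 mu p + fun3 mu p'.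
Proof. by have := fun3_scalar mu 1 p p'; rewrite scale1r mul1r. Qed.

Lemma fun3B mu p p' : fun3 mu (p - p') = fun3 mu p - fun3 mu p'.
Proof.
have -> : p - p' = -1 *: p' + p by rewrite scaleN1r addrC.
by rewrite fun3_scalar; ring.
Qed.

Lemma fun3_lift mu m (f : {poly R} -> {poly R}) p : (forall i, scalar (mu i)) -> linear f ->
  fun3 mu (lift m f p) = fun3 (upd mu m (mu m \o f)) p.
Proof.
move=> mul fl; move: p.
have mul' i : scalar (upd mu m (mu m \o f) i).
  rewrite /upd; case: eqP => // _ c x y /=; by rewrite fl mul.
apply: (@linear_tens_eq _ R^o (fun p => fun3 mu (lift m f p)) (fun3 (upd mu m (mu m \o f)))).
- by move=> c x y; rewrite linearP fun3_scalar.
- exact: fun3_scalar.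
move=> q; rewrite lift_tens // !fun3_tens //; apply: eq_bigr => i _.
by rewrite /upd; case: eqP => // ->.
Qed.

Lemma eq_fun3 mu mu' p : (forall i, mu i =1 mu' i) -> fun3 mu p = fun3 mu' p.
Proof.
move=> h; suff -> : mu = mu' by [].
by apply: funext => i; apply: funext => f; exact: h.
Qed.

Lemma mderiv_tens m q : mderiv m (tens q) = tens (upd q m (q m)^`()).
Proof. by rewrite -lift_deriv lift_tens //; exact: linearP. Qed.

Lemma tens0 q m : q m = 0 -> tens q = 0.
Proof. by move=> q0; rewrite -(upd_id q m) -/(tens_at _ _ _) q0 linear0. Qed.

Lemma const_mderiv p : (forall m, mderiv m p = 0) -> p = mpolyC 3 (mcoeff (@mnm0 3) p).
Proof.
move=> dp; apply/mpolyP => a; rewrite mcoeffC; case: eqVneq => [->|a0]; rewrite ?mulr1 ?mulr0 //.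
have [i ai] : exists i, a i != 0%N.
  apply/existsP; apply: contra_neqT a0 => /existsPn h; apply/mnmP => i.
  by rewrite mnm0E; apply/eqP; have := h i; rewrite negbK.
have := congr1 (mcoeff (mnm_sub a (mnm1 i))) (dp i); rewrite mcoeff_deriv mcoeff0.
have -> : mnm_add (mnm_sub a (mnm1 i)) (mnm1 i) = a.
  by apply/mnmP => j; rewrite mnmDE mnmBE mnm1E; case: eqVneq => [<-|] /=; lia.
by move/eqP; rewrite mulrn_eq0 /= => /eqP.
Qed.

Lemma meval_tens (v : 'I_3 -> R) q : meval v (tens q) = \prod_i (q i).[v i].
Proof.
rewrite /tens rmorph_prod; apply: eq_bigr => i _ /=.
elim/poly_ind: (q i) => [|s c IH]; first by rewrite linear0 horner0 meval0.
have -> : horner_alg (Xvar R i) (s * 'X + c%:P) =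
    horner_alg (Xvar R i) s * Xvar R i + mpolyC 3 c.
  rewrite rmorphD rmorphM; congr (_ * _ + _); first exact: horner_algX.
  by rewrite -alg_mpolyC; exact: horner_algC.
by rewrite hornerMXaddC mevalD mevalM IH mevalXU mevalC.
Qed.

Lemma meval_linear (v : 'I_3 -> R) : scalar (meval v : poly3 -> R).
Proof. by move=> c x y; rewrite mevalD mevalZ. Qed.
End TensorFunctionals.

(** * Surjectivity of the divergence and potentials of curl-free fields *)

Section DeRhamTop.
Variables (R : realType) (M : mesh R) (k : nat).
Hypothesis k2 : (2 <= k)%N.
Local Notation poly3 := (mpoly 3 R).
Local Notation cells := 'I_(ncells M).
Implicit Types (c : cells) (m n i : 'I_3) (L : 'I_3 -> nat).

Definition regular L := forall m, (0 < L m <= 2)%N.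

(* Levels of the components of k-forms, when functions have level [L]. *)
Definition lev1 L m := upd L m (L m).-1.
Definition lev2 L m := upd (fun n => (L n).-1) m (L m).
Definition lev3 L n := (L n).-1.

Lemma lev2_same L m : lev2 L m m = L m.
Proof. exact: upd_same. Qed.

Lemma upd_lev3 L m : upd (lev2 L m) m (L m).-1 = lev3 L.
Proof. by rewrite /lev2 upd_upd; exact: upd_id. Qed.

Lemma conf_hmt' m L f : regular L -> conf k (lev3 L) f ->
  conf k (lev2 L m) (fun c => hmt_at m (lev2 L m) c (f c : poly3)).
Proof.
move=> rL cf; apply: conf_hmt => //.
  by rewrite lev2_same; exact: rL.
by rewrite lev2_same upd_lev3.
Qed.

Lemma hmt_at_eq m L L' c : L m = L' m -> @hmt_at R M m L c =1 hmt_at m L' c.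
Proof. by move=> e p; rewrite /hmt_at e. Qed.

Lemma pi0_at_eq m L L' c : L m = L' m -> @pi0_at R M m L c =1 pi0_at m L' c.
Proof. by move=> e p; rewrite /pi0_at e. Qed.

Lemma pi1_at_eq m L L' c : L m = L' m -> @pi1_at R M m L c =1 pi1_at m L' c.
Proof. by move=> e p; rewrite /pi1_at e. Qed.

Lemma conf_pi1' m L f : regular L -> conf k (lev3 L) f ->
  conf k (lev3 L) (fun c => pi1_at m L c (f c : poly3)).
Proof.
move=> rL; have := @conf_pi1 R M k m (lev2 L m) k2.
rewrite !lev2_same upd_lev3 => /(_ (rL m) f) h cf; have := h cf; congr (conf k _ _).
by apply: funext => c; apply: pi1_at_eq; exact: lev2_same.
Qed.

Lemma div_step m L (h : cells -> poly3) : regular L -> conf k (lev3 L) h ->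
  exists2 g, conf k (lev2 L m) g & forall c, h c = mderiv m (g c) + pi1_at m L c (h c).
Proof.
move=> rL ch; exists (fun c => hmt_at m (lev2 L m) c (h c)); first exact: conf_hmt'.
move=> c; rewrite mderiv_hmt (pi1_at_eq (L' := L)) ?subrK //.
exact: lev2_same.
Qed.

(** Homotopies in two directions reduce [h] to its projections by [pi1], whose traces vanish on the
    faces normal to these directions up to the order that the level demands. The rest is integrated
    along the columns of the third direction. This works on every mesh: the top cohomology
    vanishes. *)
Lemma div_surjective L (h : cells -> poly3) : regular L -> conf k (lev3 L) h ->
  exists2 g : 'I_3 -> cells -> poly3, (forall m, conf k (lev2 L m) (g m)) &
    forall c, \sum_m mderiv m (g m c) = h c.
Proof.
move=> rL ch.
have [g2 cg2 e2] := div_step 2%:R rL ch.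
have ch2 := conf_pi1' 2%:R rL ch.
have [g1 cg1 e1] := div_step 1 rL ch2.
have ch1 := conf_pi1' 1 rL ch2.
have tr0 m n c r e p : m != n -> (r < lev3 L m)%N -> e = clo c m \/ e = chi c m ->
    trace r m e (p : poly3) = 0 -> trace r m e (pi1_at n L c p) = 0.
  by move=> mn rl ec p0; rewrite /pi1_at trace_comm ?p0 ?linear0 //; exact: pi1_linear.
have [|G cG eG] := column_integral (m := 0) ch1.
  move=> n c r e n0 rl ec; case: (ord3P n) n0 rl ec => -> // _ rl ec.
    by apply: trace_pi1 => //; exact: rL.
  by apply: tr0 => //; apply: trace_pi1 => //; exact: rL.
exists (fun m => if m == 0 then G else if m == 1 then g1 else g2) => [m|c].
  case: (ord3P m) => -> //=; apply: eq_conf cG => n; rewrite /lev2 /lev3 /upd.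
  by case: eqP => // _; rewrite prednK //; case/andP: (rL 0).
rewrite (sum3 _ 0) !add0r /= eG [RHS]e2 [in RHS]e1 addrC; congr (_ + _).
by rewrite addrC.
Qed.

(* The first cohomology of the mesh vanishes. *)
Definition jumps_removable := forall w : cells -> 'rV[R]_3 -> R,
  (forall m c c', adj m c c' -> forall p q, incell c p -> incell c' p ->
     incell c q -> incell c' q -> w c p - w c' p = w c q - w c' q) ->
  exists rho : cells -> R, forall m c c', adj m c c' -> forall p,
     incell c p -> incell c' p -> w c p - rho c = w c' p - rho c'.

(** Integration along the axis-parallel path from the corner [a] that follows the directions 2, 1, 0
    in turn. Each integration raises the degree in its own variable only, which gives the
    coordinatewise degree bound. *)
Lemma cell_potential (a : 'I_3 -> R) (d : 'I_3 -> nat) (f : 'I_3 -> poly3) :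
  (forall m, (0 < d m)%N) ->
  (forall m, deglt (upd d m (d m).-1) (f m)) ->
  (forall m n, mderiv m (f n) = mderiv n (f m)) ->
  exists2 w, deglt d w & forall m, mderiv m w = f m.
Proof.
move=> d0 df cl.
have ol b : linear (@prim0 R b) := @prim0_linear R b.
pose P m := lift m (prim0 (a m)); pose E m := trace 0 m (a m).
have dP m p : mderiv m (P m p) = p.
  rewrite -lift_deriv /P lift_comp //; last exact: linearP.
  by rewrite -[RHS](lift_id m); apply: eq_lift => q; exact: deriv_prim0.
have Pd m p : P m (mderiv m p) = p - E m p.
  rewrite -lift_deriv /P lift_comp //; last exact: linearP.
  rewrite -{2}(lift_id m p) /E /trace -liftB; apply: eq_lift => q /=.
  by rewrite /prim0 primp_deriv /jet derivn0 !hornerE polyCB; ring.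
have dPo m n p : m != n -> mderiv m (P n p) = P n (mderiv m p).
  by move=> mn; rewrite /P mderiv_lift_comm.
have dEo m n p : m != n -> mderiv m (E n p) = E n (mderiv m p).
  by move=> mn; rewrite /E trace_mderiv_comm // eq_sym.
have dE m p : mderiv m (E m p) = 0 by exact: mderiv_trace.
have degP m p : deglt (upd d m (d m).-1) p -> deglt d (P m p).
  move=> dp; apply: degltW (deglt_lift (e := d m) _ dp) => [i|j].
    by rewrite upd_upd upd_id.
  by rewrite upd_same => jd; rewrite -(prednK (d0 m)) size_prim0 // size_polyXn.
have degE m n p : deglt (upd d m (d m).-1) p -> n != m -> deglt (upd d m (d m).-1) (E n p).
  move=> dp nm; apply: deglt_lift_same => // q _; rewrite upd_other //.
  by rewrite (leq_trans (size_polyC_leq1 _)) ?d0.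
exists (P 0 (f 0) + P 1 (E 0 (f 1)) + P 2%:R (E 1 (E 0 (f 2%:R)))).
  apply: degltD; first apply: degltD; apply: degP => //; first exact: degE.
  by apply: (degE) => //; exact: degE.
have [P0 P1 P2] : [/\ P 0 0 = 0, P 1 0 = 0 & P 2%:R 0 = 0] by rewrite /P !linear0.
have [E0 E1] : E 0 0 = 0 /\ E 1 0 = 0 by rewrite /E !linear0.
move=> m; rewrite !mderivD; case: (ord3P m) => ->.
- by rewrite dP (dPo 0 1) // dE (dPo 0 2%:R) // (dEo 0 1) // dE E1 P1 P2 !addr0.
- rewrite (dPo 1 0) // (cl 1 0) Pd dP (dPo 1 2%:R) // dE P2 addr0.
  exact: subrK.
rewrite (dPo _ 0) // (cl _ 0) Pd (dPo _ 1) // (dEo _ 0) // (cl _ 1) -(dEo 1 0) // Pd dP.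
by rewrite addrA subrK subrK.
Qed.

Lemma trace0_meval (p : poly3) m (v : 'I_3 -> R) :
  meval v (trace 0 m (v m) p) = meval v p.
Proof.
move: p; apply: (@linear_tens_eq _ R^o (fun p => meval v (trace 0 m (v m) p)) (meval v)).
- by move=> x q s; rewrite linearP meval_linear.
- by move=> x q s; rewrite meval_linear.
move=> q; rewrite /trace lift_tens; last by apply: linear_constP; exact: jet_scalar.
rewrite !meval_tens; apply: eq_bigr => i _; rewrite /upd; case: eqP => // ->.
by rewrite hornerC.
Qed.

Lemma trace_mpolyC m a (x : R) : trace 0 m a (mpolyC 3 x) = mpolyC 3 x.
Proof.
have -> : mpolyC 3 x = x *: tens (fun=> 1%:P) by rewrite tens_const big1 // mpolyC1 alg_mpolyC.
rewrite linearZ /= /trace lift_tens; last by apply: linear_constP; exact: jet_scalar.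
by congr (_ *: tens _); apply: funext => i; rewrite /upd /jet derivn0 hornerC; case: eqP.
Qed.

(** Potentials exist in each cell. Across a face their tangential derivatives agree, so their traces
    differ by a constant, and the hypothesis on the mesh removes all these constants at once. Normal
    jets of positive order are jets of the given field. *)
Lemma curl_free_gradient L (f : 'I_3 -> cells -> poly3) : jumps_removable -> regular L ->
  (forall m, conf k (lev1 L m) (f m)) ->
  (forall m n c, mderiv m (f n c) = mderiv n (f m c)) ->
  exists2 w, conf k L w & forall m c, mderiv m (w c) = f m c.
Proof.
move=> jr rL cf cl.
have pot c : {w : poly3 | deglt (fun i => (k + L i)%N) w & forall m, mderiv m w = f m c}.
  apply: cid2; apply: (cell_potential (clo c)) => [m|m|m n]; last exact: cl.
    by have := rL m; lia.
  apply: degltW ((cf m).1 c) => i; rewrite /lev1 /upd; case: eqP => // _.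
  by have := rL m; lia.
pose w c := s2val (pot c).
have wd c : deglt (fun i => (k + L i)%N) (w c) by exact: s2valP.
have dw c m : mderiv m (w c) = f m c by rewrite /w; case: (pot c).
have jump m c c' : adj m c c' ->
    exists x, trace 0 m (chi c m) (w c) - trace 0 m (chi c m) (w c') = mpolyC 3 x.
  move=> cc'; set J := _ - _; exists (mcoeff (@mnm0 3) J); apply: const_mderiv => n.
  rewrite /J mderivB; have [->|nm] := eqVneq n m; first by rewrite !mderiv_trace subrr.
  rewrite -!trace_mderiv_comm 1?eq_sym // !dw.
  apply/eqP; rewrite subr_eq0; apply/eqP; apply: (cf n).2 => //.
  by rewrite /lev1 upd_other 1?eq_sym //; case/andP: (rL m).
pose ev c (p : 'rV[R]_3) := meval (fun i => p 0 i) (w c).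
have evJ m c c' p x : adj m c c' -> incell c p -> incell c' p ->
    trace 0 m (chi c m) (w c) - trace 0 m (chi c m) (w c') = mpolyC 3 x -> ev c p - ev c' p = x.
  move=> cc' cp c'p e.
  have pm : p 0 m = chi c m.
    have := cp m; have := c'p m; case: cc' => ch _; rewrite -/(clo _ _) -/(chi _ _) -ch.
    by move=> /andP[h1 _] /andP[_ h2]; apply/eqP; rewrite eq_le h1 h2.
  have := congr1 (meval (fun i => p 0 i)) e.
  by rewrite mevalB mevalC -pm !(trace0_meval _ m (fun i => p 0 i)).
have [|rho hrho] := jr ev.
  move=> m c c' cc' p q cp c'p cq c'q; have [x ex] := jump m c c' cc'.
  by rewrite !(evJ m _ _ _ x).
exists (fun c => w c - mpolyC 3 (rho c)) => [|m c]; last by rewrite mderivB mderivC subr0 dw.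
split=> [c|m c c' r cc' rl].
  apply: degltB => // a; rewrite msuppC; case: ifP => // _; rewrite inE => /eqP-> i.
  by rewrite mnm0E; lia.
rewrite !linearB /=; case: r rl => [|r] rl; last first.
  have tC x : trace r.+1 m (chi c m) (mpolyC 3 x) = 0.
    by rewrite -trace_mderiv mderivC /trace linear0.
  rewrite !tC !subr0 -!trace_mderiv !dw; apply: (cf m).2 => //.
  by rewrite /lev1 upd_same; lia.
have [x ex] := jump m c c' cc'; rewrite !trace_mpolyC.
pose p : 'rV[R]_3 := \row_n (if n == m then chi c m else clo c n).
have cp : incell c p.
  move=> n; rewrite mxE; case: eqP => [->|_]; rewrite ?lexx ?andbT.
    exact/ltW/clo_lt_chi.
  by apply: ltW; exact: clo_lt_chi.
have c'p : incell c' p.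
  case: cc' => e sc n; rewrite mxE; case: eqVneq => [->|nm].
    by rewrite e lexx /=; apply: ltW; exact: clo_lt_chi.
  have [-> _] := sc n nm; rewrite lexx /=; exact/ltW/clo_lt_chi.
have e1 := evJ m c c' p x cc' cp c'p ex; have e2 := hrho m c c' cc' p cp c'p.
have -> : rho c = x + rho c' by lra.
by rewrite mpolyCD -ex; ring.
Qed.
End DeRhamTop.

(** * Divergence-free fields and the embedding of cellular cochains *)

Section DeRhamCurl.
Variables (R : realType) (M : mesh R) (k : nat).
Hypothesis k2 : (2 <= k)%N.
Local Notation poly3 := (mpoly 3 R).
Local Notation cells := 'I_(ncells M).
Implicit Types (c : cells) (m n i : 'I_3) (L : 'I_3 -> nat) (b s : bool).

(* Mesh entities are identified by their pair of extreme corners. *)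
Definition key : Type := ('rV[R]_3 * 'rV[R]_3)%type.

Definition setc (x : 'rV[R]_3) m (t : R) : 'rV[R]_3 := \row_i (if i == m then t else x 0 i).

Definition side m s (F : key) : key :=
  let t := if s then F.2 0 m else F.1 0 m in (setc F.1 m t, setc F.2 m t).

Definition ckey c : key := (lo (cell c), hi (cell c)).

Lemma setc_other x m t i : i != m -> setc x m t 0 i = x 0 i.
Proof. by move=> im; rewrite mxE (negbTE im). Qed.

Lemma setc_comm x m n t u : m != n -> setc (setc x m t) n u = setc (setc x n u) m t.
Proof.
move=> mn; apply/rowP => i; rewrite !mxE; case: eqVneq => [->|] //.
by rewrite eq_sym (negbTE mn).
Qed.

Lemma side_comm m n s s' F : m != n -> side m s (side n s' F) = side n s' (side m s F).
Proof.
move=> mn; rewrite /side /= !(@setc_other _ n _ m) // !(@setc_other _ m _ n) 1?eq_sym //.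
by rewrite setc_comm 1?eq_sym // [X in (_, X)]setc_comm 1?eq_sym.
Qed.

Lemma sideE m s F n : ((side m s F).1 0 n = if n == m then (if s then F.2 0 m else F.1 0 m) else F.1 0 n)
  /\ ((side m s F).2 0 n = if n == m then (if s then F.2 0 m else F.1 0 m) else F.2 0 n).
Proof. by rewrite /side /= !mxE. Qed.

Lemma eq_side m c c' s s' : side m s (ckey c) = side m s' (ckey c') ->
  same_cross m c c' /\ (if s then chi c m else clo c m) = (if s' then chi c' m else clo c' m).
Proof.
move=> e; split.
  move=> n nm; have [a1 a2] := sideE m s (ckey c) n; have [b1 b2] := sideE m s' (ckey c') n.
  by rewrite e b1 b2 (negbTE nm) in a1 a2.
have [a1 _] := sideE m s (ckey c) m; have [b1 _] := sideE m s' (ckey c') m.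
by rewrite e b1 eqxx in a1.
Qed.

Lemma side_adj m c c' : adj m c c' -> side m true (ckey c) = side m false (ckey c').
Proof.
move=> [e sc]; congr (_, _); apply/rowP => n; rewrite !mxE /=; case: eqVneq => // nm.
  by case: (sc n nm).
by case: (sc n nm).
Qed.

(** Two cells on the same side of a common face overlap, hence are equal. *)
Lemma eq_side_cells m c c' s s' : side m s (ckey c) = side m s' (ckey c') ->
  [\/ c = c' /\ s = s', [/\ s, ~~ s' & adj m c c'] | [/\ ~~ s, s' & adj m c' c]].
Proof.
move=> /eq_side[sc]; case: s; case: s' => e.
- constructor 1; split=> //; apply: cells_overlap => n; have [->|nm] := eqVneq n m.
    by split; [rewrite -e|rewrite e]; exact: clo_lt_chi.
  by case: (sc n nm) => -> ->; split; exact: clo_lt_chi.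
- by constructor 2.
- by constructor 3; split=> //; split=> //; exact: same_cross_sym.
- constructor 1; split=> //; apply: cells_overlap => n; have [->|nm] := eqVneq n m.
    by split; [rewrite e|rewrite -e]; exact: clo_lt_chi.
  by case: (sc n nm) => -> ->; split; exact: clo_lt_chi.
Qed.

(* [psi i] is defined on the edges parallel to [i], and the result at [m] on
   the faces normal to [m]. *)
Definition coboundary (psi : 'I_3 -> key -> R) m (F : key) : R :=
  (psi (m + 2%:R) (side (m + 1) true F) - psi (m + 2%:R) (side (m + 1) false F)) -
  (psi (m + 1) (side (m + 2%:R) true F) - psi (m + 1) (side (m + 2%:R) false F)).

Definition cell_closed (phi : 'I_3 -> key -> R) := forall c,
  \sum_m (phi m (side m true (ckey c)) - phi m (side m false (ckey c))) = 0.

(* The second cohomology of the mesh vanishes. *)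
Definition closed_coboundary := forall phi : 'I_3 -> key -> R, cell_closed phi ->
  exists psi, forall c m s, phi m (side m s (ckey c)) = coboundary psi m (side m s (ckey c)).

Definition node L c n s : {poly R} :=
  if s then lam (L n) (clo c n) (chi c n) else 1 - lam (L n) (clo c n) (chi c n).
Arguments node : simpl never.
Definition bump L c n : {poly R} := (lam (L n) (clo c n) (chi c n))^`().

Lemma deriv_node L c n s : (node L c n s)^`() = (if s then 1 else -1) *: bump L c n.
Proof.
rewrite /node /bump; case: s; rewrite ?scale1r //.
by rewrite derivB -polyC1 derivC sub0r scaleN1r.
Qed.

Lemma size_node L c n s : regular L -> (size (node L c n s) <= k + L n)%N.
Proof.
move=> /(_ n) rL; have sl := leq_trans (size_lam (L n) (clo c n) (chi c n)) _.
rewrite /node; case: s; first by apply: sl; lia.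
by rewrite (leq_trans (size_polyD _ _)) // geq_max size_polyN size_poly1 sl; lia.
Qed.

Lemma size_bump L c n : regular L -> (size (bump L c n) <= k + (L n).-1)%N.
Proof.
move=> /(_ n) rL; have sl := size_lam (L n) (clo c n) (chi c n).
by rewrite /bump (leq_trans (size_poly _ _)) //; lia.
Qed.

Lemma jet_node L c n s e r : regular L -> (r < L n)%N ->
  jet r (if e then chi c n else clo c n) (node L c n s) = ((r == 0%N) && (s == e))%:R.
Proof.
move=> /(_ n) rL rl; have ne : clo c n != chi c n by rewrite lt_eqF // clo_lt_chi.
have L2 : (L n <= 2)%N by lia.
have jl : jet r (if e then chi c n else clo c n) (lam (L n) (clo c n) (chi c n)) =
    ((r == 0%N) && e)%:R.
  by case: e; rewrite ?jet_lam_b ?jet_lam_a ?andbT ?andbF.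
rewrite /node; case: s; first by rewrite jl; case: e {jl}.
have -> : jet r (if e then chi c n else clo c n) (1 - lam (L n) (clo c n) (chi c n)) =
    (r == 0%N)%:R - ((r == 0%N) && e)%:R.
  rewrite -jl /jet derivnB hornerD hornerN; congr (_ - _).
  by rewrite -polyC1 derivnC; case: (r) => [|r']; rewrite ?hornerC ?horner0.
by case: (r == 0%N); case: e {jl} => /=; ring.
Qed.

Lemma jet_bump L c n e r : regular L -> (r < (L n).-1)%N ->
  jet r (if e then chi c n else clo c n) (bump L c n) = 0.
Proof.
move=> rL rl; rewrite /bump -[lam _ _ _]/(node L c n true) jet_deriv jet_node //.
by have := rL n; lia.
Qed.

Definition edge_form L (psi : 'I_3 -> key -> R) i c : poly3 :=
  \sum_(s : bool) \sum_(s' : bool)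
    psi i (side (i + 1) s (side (i + 2%:R) s' (ckey c))) *:
    tens (fun n => if n == i then bump L c n
                   else node L c n (if n == i + 1 then s else s')).

Definition face_form L (phi : 'I_3 -> key -> R) i c : poly3 :=
  \sum_(s : bool) phi i (side i s (ckey c)) *:
    tens (fun n => if n == i then node L c n s else bump L c n).

(** The derivative of a nodal function is plus or minus the bump of its interval, and the signs are
    those of the cellular coboundary. *)
Lemma curl_edge_form L psi m c :
  mderiv (m + 1) (edge_form L psi (m + 2%:R) c) - mderiv (m + 2%:R) (edge_form L psi (m + 1) c) =
  face_form L (coboundary psi) m c.
Proof.
have [n1 n2 n3] := ord3_neq m.
rewrite /edge_form /face_form !ord3A.
have nn : m + 2%:R != m + 1 by rewrite eq_sym.
have E1 s s' : mderiv (m + 1) (tens (fun n => if n == m + 2%:R then bump L c n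
      else node L c n (if n == m then s else s'))) =
    (if s' then 1 else -1) *: tens (fun n => if n == m then node L c n s else bump L c n).
  rewrite mderiv_tens (negbTE n3) (negbTE n1) deriv_node -/(tens_at _ _ _) linearZ /=.
  congr (_ *: tens _); apply: funext => n; rewrite /upd.
  by case: (ord3_rel m n) => ->; rewrite ?eqxx ?ord3F.
have E2 s s' : mderiv (m + 2%:R) (tens (fun n => if n == m + 1 then bump L c n
      else node L c n (if n == m + 2%:R then s else s'))) =
    (if s then 1 else -1) *: tens (fun n => if n == m then node L c n s' else bump L c n).
  rewrite mderiv_tens (negbTE nn) eqxx deriv_node -/(tens_at _ _ _) linearZ /=.
  congr (_ *: tens _); apply: funext => n; rewrite /upd.
  by case: (ord3_rel m n) => ->; rewrite ?eqxx ?ord3F.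
rewrite !big_bool /= !mderivD !mderivZ !E1 !E2 /coboundary !scale1r !scaleN1r.
rewrite !(@side_comm (m + 1) m) // !(@side_comm (m + 2%:R) m) //.
set t1 := tens _; set t0 := tens _.
rewrite !scalerN !scalerBl.
set x1 := _ *: t1; set x2 := _ *: t1; set x3 := _ *: t1; set x4 := _ *: t1.
set y1 := _ *: t0; set y2 := _ *: t0; set y3 := _ *: t0; set y4 := _ *: t0.
ring.
Qed.

Lemma tens_upd0 (q : 'I_3 -> {poly R}) m : tens (upd q m 0) = 0.
Proof. by rewrite (@tens0 _ _ m) // upd_same. Qed.

Lemma trace_tens r m a (q : 'I_3 -> {poly R}) :
  trace r m a (tens q) = tens (upd q m (jet r a (q m))%:P).
Proof. by rewrite /trace lift_tens //; apply: linear_constP; exact: jet_scalar. Qed.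

Lemma trace_edge_form r m a L psi i c : trace r m a (edge_form L psi i c) =
  \sum_(s : bool) \sum_(s' : bool)
    psi i (side (i + 1) s (side (i + 2%:R) s' (ckey c))) *:
    tens (upd (fun n => if n == i then bump L c n
                        else node L c n (if n == i + 1 then s else s')) m
      (jet r a (if m == i then bump L c m else node L c m (if m == i + 1 then s else s')))%:P).
Proof.
rewrite /edge_form !big_bool.
have E x y : trace r m a (x + y) = trace r m a x + trace r m a y by rewrite linearD.
have Z x (y : poly3) : trace r m a (x *: y) = x *: trace r m a y by rewrite linearZ.
by rewrite !E !Z !trace_tens.
Qed.

(** Along the edge the bump has zero jets at the ends below its level. Transversally only the nodal
    functions of the end in question survive, with coefficients on edges of the common face; both
    cells name these edges by the same keys. *)
Lemma conf_edge_form L psi i : regular L -> conf k (lev1 L i) (edge_form L psi i).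
Proof.
move=> rL; have [n1 n2 n3] := ord3_neq i.
have nn : i + 2%:R != i + 1 by rewrite eq_sym.
split=> [c|m c c' r cc'].
  apply: deglt_sum => s _; apply: deglt_sum => s' _; apply/degltZ/deglt_tens => n.
  rewrite /lev1 /upd; case: eqP => [->|_]; [exact: size_bump|exact: size_node].
have scn n : n != m -> forall s, node L c n s = node L c' n s.
  by case: cc' => _ sc nm s; case: (sc n nm) => e1 e2; rewrite /node e1 e2.
have scb n : n != m -> bump L c n = bump L c' n.
  by case: cc' => _ sc nm; case: (sc n nm) => e1 e2; rewrite /bump e1 e2.
have ej : chi c m = clo c' m by case: cc'.
have sd := side_adj cc'.
rewrite /lev1 /upd; case: (ord3_rel i m) => em; rewrite em ?eqxx ?ord3F => rl.
- have T t e : trace r i (if e then chi t i else clo t i) (edge_form L psi i t) = 0.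
    rewrite trace_edge_form eqxx jet_bump //.
    by rewrite big1 // => s _; rewrite big1 // => s' _; rewrite tens_upd0 scaler0.
  rewrite em in ej; have := T c true; rewrite /= => ->; rewrite ej.
  by have := T c' false; rewrite /= => ->.
- have T t e : trace r (i + 1) (if e then chi t (i + 1) else clo t (i + 1)) (edge_form L psi i t) =
      (r == 0%N)%:R *: \sum_(s' : bool) psi i (side (i + 2%:R) s' (side (i + 1) e (ckey t))) *:
        tens (upd (fun n => if n == i then bump L t n else node L t n s') (i + 1) 1%:P).
    rewrite trace_edge_form !big_bool (negbTE n1) eqxx /= !jet_node //.
    rewrite !(@side_comm (i + 2%:R) (i + 1)) //.
    have U x y z : tens (upd (fun n => if n == i then bump L t n
          else node L t n (if n == i + 1 then x else y)) (i + 1) z) =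
        tens (upd (fun n => if n == i then bump L t n else node L t n y) (i + 1) z).
      by congr tens; apply: funext => n; rewrite /upd; case: (n == i + 1).
    by rewrite !U; case: (r == 0%N); case: e => /=; rewrite !tens_upd0 !scaler0 ?scale0r ?scale1r ?addr0 ?add0r.
  rewrite em in cc' scn scb ej sd; have := T c true; rewrite /= => ->; rewrite ej.
  have := T c' false; rewrite /= => ->; congr (_ *: _); apply: eq_bigr => s' _; rewrite sd.
  congr (_ *: tens _); apply: funext => n; rewrite /upd; case: eqVneq => // nm.
  by rewrite scn // scb.
have T t e : trace r (i + 2%:R) (if e then chi t (i + 2%:R) else clo t (i + 2%:R)) (edge_form L psi i t) =
    (r == 0%N)%:R *: \sum_(s' : bool) psi i (side (i + 1) s' (side (i + 2%:R) e (ckey t))) *: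
      tens (upd (fun n => if n == i then bump L t n else node L t n s') (i + 2%:R) 1%:P).
  rewrite trace_edge_form !big_bool (negbTE n2) (negbTE nn) /= !jet_node //.
  have U x y z : tens (upd (fun n => if n == i then bump L t n
        else node L t n (if n == i + 1 then x else y)) (i + 2%:R) z) =
      tens (upd (fun n => if n == i then bump L t n else node L t n x) (i + 2%:R) z).
    congr tens; apply: funext => n; rewrite /upd.
    by case: (ord3_rel i n) => ->; rewrite ?eqxx ?ord3F.
  by rewrite !U; case: (r == 0%N); case: e => /=; rewrite !tens_upd0 !scaler0 ?scale0r ?scale1r ?addr0 ?add0r.
rewrite em in cc' scn scb ej sd; have := T c true; rewrite /= => ->; rewrite ej.
have := T c' false; rewrite /= => ->; congr (_ *: _); apply: eq_bigr => s' _; rewrite sd.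
congr (_ *: tens _); apply: funext => n; rewrite /upd; case: eqVneq => // nm.
by rewrite scn // scb.
Qed.

(** The homotopy of direction m on 2-forms: [g] is contracted with the axis m and then [hmt] is
    applied. In component m of the curl, the divergence condition turns the transversal derivatives
    into minus the derivative of [g m] along m, where [hmt_mderiv] applies. *)
Lemma curl_step m L (g : 'I_3 -> cells -> poly3) : regular L ->
  (forall i, conf k (lev2 L i) (g i)) -> (forall c, \sum_i mderiv i (g i c) = 0) ->
  let g' i c := if i == m then pi0_at m L c (g i c) else pi1_at m L c (g i c) in
  [/\ forall i, conf k (lev2 L i) (g' i), forall c, \sum_i mderiv i (g' i c) = 0 &
   exists2 f, forall i, conf k (lev1 L i) (f i) & forall i c,
     g i c = mderiv (i + 1) (f (i + 2%:R) c) - mderiv (i + 2%:R) (f (i + 1) c) + g' i c].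
Proof.
move=> rL cg dg g'; have [n1 n2 n3] := ord3_neq m.
have nn : m + 2%:R != m + 1 by rewrite eq_sym.
have rm := rL m.
split.
- move=> i; have [im|im] := eqVneq i m.
    have := @conf_pi0 R M k m (lev2 L m) k2; rewrite lev2_same => /(_ rm _ (cg m)).
    rewrite im; congr (conf k _ _); apply: funext => c; rewrite /g' eqxx.
    by apply: pi0_at_eq; rewrite lev2_same.
  have e : upd (upd (lev2 L i) m (L m)) m (L m).-1 =1 lev2 L i.
    by move=> n; rewrite upd_upd /upd; case: eqP => // ->; rewrite /lev2 upd_other // eq_sym.
  have := @conf_pi1 R M k m (upd (lev2 L i) m (L m)) k2; rewrite upd_same => /(_ rm (g i)).
  move=> h; have {h} := h (eq_conf (fun n => esym (e n)) (cg i)).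
  move=> /(eq_conf e); congr (conf k _ _); apply: funext => c; rewrite /g' (negbTE im).
  by apply: pi1_at_eq; rewrite upd_same.
- move=> c; transitivity (pi1_at m L c (\sum_i mderiv i (g i c))); last by rewrite dg /pi1_at linear0.
  have piD x y : pi1_at m L c (x + y) = pi1_at m L c x + pi1_at m L c y by rewrite /pi1_at linearD.
  rewrite !(sum3 _ m) !piD /g' eqxx (negbTE n1) (negbTE n2) pi1_mderiv; congr (_ + _ + _).
    by rewrite /pi1_at mderiv_lift_comm //; exact: pi1_linear.
  by rewrite /pi1_at mderiv_lift_comm //; exact: pi1_linear.
have ch j j' : j != m -> j' != m -> j != j' -> conf k (lev1 L j) (fun c => hmt_at m L c (g j' c)).
  move=> jm j'm jj'.
  have e : upd (lev1 L j) m (L m).-1 =1 lev2 L j'.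
    move=> n; rewrite /lev1 /lev2 /upd; case: (eqVneq n m) => [->|nm].
      by rewrite eq_sym (negbTE j'm).
    case: (ord3_rel m n) nm jm j'm jj' => ->; rewrite ?eqxx // => _;
    by case: (ord3_rel m j) => ->; rewrite ?eqxx // => _; case: (ord3_rel m j') => ->;
      rewrite ?eqxx // => _ _; rewrite ?ord3F.
  have lm : lev1 L j m = L m by rewrite /lev1 upd_other // eq_sym.
  have := @conf_hmt R M k m (lev1 L j) k2; rewrite !lm => /(_ rm (g j')).
  move=> h; have := h (eq_conf (fun n => esym (e n)) (cg j')).
  by congr (conf k _ _); apply: funext => c; apply: hmt_at_eq.
exists (fun i c => if i == m + 1 then hmt_at m L c (g (m + 2%:R) c)
   else if i == m + 2%:R then - hmt_at m L c (g (m + 1) c) else 0).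
  move=> i; case: (ord3_rel m i) => ->; rewrite ?eqxx ?ord3F.
  - exact: conf0.
  - exact: ch.
  - by apply: confN; exact: ch.
move=> i c; case: (ord3_rel m i) => ->; rewrite /g' ?ord3A ?eqxx ?ord3F.
- have e : mderiv (m + 1) (g (m + 1) c) + mderiv (m + 2%:R) (g (m + 2%:R) c) = - mderiv m (g m c).
    by apply/eqP; rewrite -addr_eq0 addrC addrA -(sum3 (fun i => mderiv i (g i c)) m) dg.
  rewrite mderivN -[- _ - _]opprD /hmt_at !mderiv_lift_comm //; try exact: hmt_linear.
  by rewrite -linearD e linearN opprK /= -/(hmt_at m L c _) hmt_mderiv subrK.
- by rewrite mderiv0 sub0r mderivN opprK mderiv_hmt subrK.
- by rewrite mderiv0 subr0 mderiv_hmt subrK.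
Qed.

Definition flux_fun i c s : 'I_3 -> {poly R} -> R :=
  upd (fun n => defint (clo c n) (chi c n)) i (jet 0 (if s then chi c i else clo c i)).

Lemma flux_fun_scalar i c s n : scalar (flux_fun i c s n).
Proof. by rewrite /flux_fun /upd; case: eqP => _; [exact: jet_scalar|exact: defint_scalar]. Qed.

(** [pi0] sees only the two end values and [pi1] only the integral, so the full projection depends
    only on the fluxes through the two faces normal to i. *)
Lemma project_face_form L i c (p : poly3) :
  lift3 (fun n => if n == i then pi0 (L n) (clo c n) (chi c n) else pi1 (L n) (clo c n) (chi c n)) p =
  \sum_(s : bool) fun3 (flux_fun i c s) p *:
    tens (fun n => if n == i then node L c n s else bump L c n).
Proof.
move: p; pose F (p : poly3) := lift3 (fun n => if n == i then pi0 (L n) (clo c n) (chi c n)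
  else pi1 (L n) (clo c n) (chi c n)) p.
pose G (p : poly3) := \sum_(s : bool) fun3 (flux_fun i c s) p *:
    tens (fun n => if n == i then node L c n s else bump L c n).
apply: (@linear_tens_eq _ _ F G); first exact: lift3_linear.
  move=> x p q; rewrite /G scaler_sumr -big_split; apply: eq_bigr => s _ /=.
  by rewrite fun3_scalar scalerDl scalerA.
move=> q; rewrite /F /G lift3_tens => [|n]; last first.
  by case: eqP => _; [exact: pi0_linear|exact: pi1_linear].
pose e : R := \prod_(n | n != i) defint (clo c n) (chi c n) (q n).
have E s : fun3 (flux_fun i c s) (tens q) = (q i).[if s then chi c i else clo c i] * e.
  rewrite fun3_tens; last exact: flux_fun_scalar.
  rewrite (bigD1 i) //= /flux_fun upd_same; congr (_ * _); apply: eq_bigr => n ni.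
  by rewrite upd_other.
pose Q s := fun n => if n == i then node L c n s else bump L c n.
have -> : (fun n => (if n == i then pi0 (L n) (clo c n) (chi c n) else pi1 (L n) (clo c n) (chi c n)) (q n)) =
    (fun n => (if n == i then 1 else defint (clo c n) (chi c n) (q n)) *:
       (if n == i then pi0 (L n) (clo c n) (chi c n) (q n) else bump L c n)).
  by apply: funext => n; case: eqP => _; rewrite ?scale1r.
have S (x : 'I_3 -> R) (u : 'I_3 -> {poly R}) : tens (fun n => x n *: u n) = (\prod_n x n) *: tens u.
  rewrite /tens -scaler_prod; apply: eq_bigr => n _.
  by rewrite -mul_polyC rmorphM -[X in X * _]/(horner_alg _ _) horner_algC mulr_algl.
rewrite S (bigD1 i) //= eqxx mul1r.
rewrite (eq_bigr (fun n => defint (clo c n) (chi c n) (q n))) => [|n /negbTE->//].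
rewrite -/e big_bool !E.
have T w : tens (fun n => if n == i then w else bump L c n) = tens (upd (bump L c) i w).
  by congr tens; apply: funext => n; rewrite /upd; case: eqP.
have TQ s : tens (fun n => if n == i then node L c n s else bump L c n) =
    tens_at (bump L c) i (node L c i s).
  by rewrite /tens_at -T; congr tens; apply: funext => n; case: eqP => // ->.
rewrite !TQ (_ : tens _ = tens_at (bump L c) i (pi0 (L i) (clo c i) (chi c i) (q i))); last first.
  by rewrite /tens_at -T; congr tens; apply: funext => n; case: eqP => // ->.
rewrite /pi0 linearD !linearZ /= /node scalerDr !scalerA addrC; congr (_ *: _ + _ *: _); exact: mulrC.
Qed.

(** After homotopies in all three directions a face form remains, with the fluxes of [g] as
    coefficients. By the divergence theorem on each cell these fluxes form a closed cochain, and a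
    primitive of it on the edges supplies the missing part of the potential. *)
Lemma divergence_free_curl L (g : 'I_3 -> cells -> poly3) : closed_coboundary -> regular L ->
  (forall i, conf k (lev2 L i) (g i)) -> (forall c, \sum_i mderiv i (g i c) = 0) ->
  exists2 f, forall i, conf k (lev1 L i) (f i) & forall i c,
    mderiv (i + 1) (f (i + 2%:R) c) - mderiv (i + 2%:R) (f (i + 1) c) = g i c.
Proof.
move=> cc rL cg dg.
have [cg2 dg2 [f2 cf2 e2]] := curl_step 2%:R rL cg dg.
have [cg1 dg1 [f1 cf1 e1]] := curl_step 1 rL cg2 dg2.
have [_ _ [f0 cf0 e0]] := curl_step 0 rL cg1 dg1.
pose flux i (x : cells * bool) := fun3 (flux_fun i x.1 x.2) (g i x.1).
(* The flux through a face is read off from an arbitrary cell having this face; [adjflux] makes the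
   choice immaterial. *)
pose phi i F := if [pick x : cells * bool | side i x.2 (ckey x.1) == F] is Some x then flux i x else 0.
have adjflux i c c' : adj i c c' -> flux i (c, true) = flux i (c', false).
  move=> a; have [ec sc] := a.
  have E t s : flux i (t, s) = fun3 (flux_fun i t s) (trace 0 i (if s then chi t i else clo t i) (g i t)).
    rewrite /trace fun3_lift; [|exact: flux_fun_scalar|by apply: linear_constP; exact: jet_scalar].
    apply: eq_fun3 => n q; rewrite /= /flux_fun /upd; case: (n == i) => //=.
    by rewrite eqxx /jet !derivn0 hornerC.
  rewrite !E /= -ec ((cg i).2 i c c' 0%N a); last by rewrite lev2_same; case/andP: (rL i).
  apply: eq_fun3 => n q; rewrite /flux_fun /upd; case: eqVneq => [_|ni]; first by rewrite /= ec.
  by case: (sc n ni) => -> ->.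
have phiE i c s : phi i (side i s (ckey c)) = flux i (c, s).
  rewrite /phi; case: pickP => [[c' s'] /= /eqP /eq_side_cells|/(_ (c, s))]; last by rewrite /= eqxx.
  case=> [[-> ->]//|[h h' a]|[h h' a]].
    by rewrite h (negbTE h'); exact: adjflux.
  by rewrite h' (negbTE h); apply/esym; exact: adjflux.
have [|psi hpsi] := cc phi.
  move=> c; transitivity (fun3 (fun n => defint (clo c n) (chi c n)) (\sum_i mderiv i (g i c))); last first.
    by rewrite dg fun30.
  have D i : fun3 (fun n => defint (clo c n) (chi c n)) (mderiv i (g i c)) =
      phi i (side i true (ckey c)) - phi i (side i false (ckey c)).
    rewrite !phiE /flux /= -lift_deriv fun3_lift; [|by move=> n; exact: defint_scalar|exact: linearP].
    move: (g i c); set mu := upd _ _ _ => p.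
    have mul n : scalar (mu n).
      rewrite /mu /upd; case: eqP => _; last exact: defint_scalar.
      by move=> x u v /=; rewrite linearP defint_scalar.
    apply: (@linear_tens_eq _ R^o (fun3 mu) (fun p => fun3 (flux_fun i c true) p - fun3 (flux_fun i c false) p)).
    - exact: fun3_scalar.
    - by move=> x u v; rewrite !fun3_scalar scalerBr opprD addrACA.
    move=> q; rewrite !fun3_tens //; try exact: flux_fun_scalar.
    rewrite (bigD1 i) //= [X in _ = X - _](bigD1 i) //= [X in _ = _ - X](bigD1 i) //=.
    rewrite /mu /flux_fun !upd_same /= defint_deriv mulrBl /jet !derivn0.
    by congr (_ * _ - _ * _); apply: eq_bigr => n ni; rewrite !upd_other.
  by rewrite (sum3 _ 0) [in RHS](sum3 _ 0) !fun3D !D.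
exists (fun i c => f2 i c + f1 i c + f0 i c + edge_form L psi i c) => [i|i c].
  by apply: confD; [apply: confD; [apply: confD|]|exact: conf_edge_form].
have last_proj : (if i == 0 then pi0_at 0 L c (if i == 1 then pi0_at 1 L c
      (if i == 2%:R then pi0_at 2%:R L c (g i c) else pi1_at 2%:R L c (g i c)) else
      pi1_at 1 L c (if i == 2%:R then pi0_at 2%:R L c (g i c) else pi1_at 2%:R L c (g i c)))
    else pi1_at 0 L c (if i == 1 then pi0_at 1 L c
      (if i == 2%:R then pi0_at 2%:R L c (g i c) else pi1_at 2%:R L c (g i c)) else
      pi1_at 1 L c (if i == 2%:R then pi0_at 2%:R L c (g i c) else pi1_at 2%:R L c (g i c)))) =
    face_form L (coboundary psi) i c.
  transitivity (lift3 (fun n => if n == i then pi0 (L n) (clo c n) (chi c n)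
      else pi1 (L n) (clo c n) (chi c n)) (g i c)).
    by case: (ord3P i) => ->.
  rewrite project_face_form /face_form; apply: eq_bigr => s _.
  by rewrite -hpsi phiE.
have := e2 i c; rewrite (e1 i c) (e0 i c) last_proj -curl_edge_form => ->.
rewrite !mderivD !opprD !addrA.
by rewrite (ACl (1*5*2*6*3*7*4*8)).
Qed.
End DeRhamCurl.

(** * The diagram chase *)

Section ElasticityExactness.
Variables (R : realType) (M : mesh R) (k : nat).
Hypothesis k2 : (2 <= k)%N.
Local Notation poly3 := (mpoly 3 R).
Local Notation cells := 'I_(ncells M).
Implicit Types (c : cells) (m n i j : 'I_3).

Definition lvX i m : nat := 2 - (m == i).
Definition lvPhi i j m : nat := 2 - (m == i) - (m == j).
Definition lvGamma i j m : nat := (m == i) + (m == j).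
Definition lvZ i m : nat := (m == i).
(** The level of none of the four spaces. It belongs to the auxiliary complex of the diagram chase,
    in which the rows of [curlT s] are 1-forms and the rows of a field in [Gammah] are 2-forms. *)
Definition lvW i m : nat := (m == i).+1.

Lemma regular_lvX i : regular (lvX i).
Proof. by move=> m; rewrite /lvX; case: eqP. Qed.

Lemma regular_lvW i : regular (lvW i).
Proof. by move=> m; rewrite /lvW; case: eqP. Qed.

Lemma regular2 : regular (fun=> 2%N).
Proof. by []. Qed.

Lemma conf_deriv m L L' (f : cells -> poly3) : upd L m (L m).-1 =1 L' -> conf k L f ->
  conf k L' (fun c => mderiv m (f c)).
Proof. by move=> e cf; apply: (eq_conf e); exact: conf_mderiv. Qed.

Lemma lev1_lvW i j m : lev1 (lvW i) j m = (1 + (m == i) - (m == j))%N.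
Proof. by rewrite /lev1 /upd /lvW; case: (eqVneq m j) => [->|_]; case: eqP. Qed.

Lemma lev1_lvX i j m : lev1 (lvX i) j m = lvPhi i j m.
Proof. by rewrite /lev1 /upd /lvX /lvPhi; case: (eqVneq m j) => [->|_]; case: eqP. Qed.

Lemma lev2_lvW i j m : lev2 (lvW i) j m = lvGamma i j m.
Proof. by rewrite /lev2 /upd /lvW /lvGamma; case: (eqVneq m j) => [->|_]; case: eqP. Qed.

(** The compatibility behind the diagram chase: the entry (i, j) of a matrix is component i of a
    2-form in the complex of [lvX j] and, with the same level, component j of a 1-form in the
    complex of [lvW i]. One matrix can therefore be treated by rows and by columns. *)
Lemma lev2_lvX i j m : lev2 (lvX j) i m = lev1 (lvW i) j m.
Proof.
rewrite lev1_lvW /lev2 /upd /lvX; case: (eqVneq m i) => [->|_]; first by case: eqP.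
by case: eqP.
Qed.

Lemma curl_coef (s : 'M[poly3]_3) i m : curl s i m =
  mderiv (m + 1) (s i (m + 2%:R)) - mderiv (m + 2%:R) (s i (m + 1)).
Proof. by rewrite mxE. Qed.

Lemma curlT_coef (s : 'M[poly3]_3) i j : curlT s i j =
  mderiv (i + 1) (s (i + 2%:R) j) - mderiv (i + 2%:R) (s (i + 1) j).
Proof. by rewrite !mxE. Qed.

Lemma curl_row0 (f : 'I_3 -> poly3) :
  (forall m, mderiv (m + 1) (f (m + 2%:R)) - mderiv (m + 2%:R) (f (m + 1)) = 0) ->
  forall m n, mderiv m (f n) = mderiv n (f m).
Proof.
move=> h m n.
case: (ord3_rel m n) => -> //; apply/eqP; rewrite -subr_eq0; apply/eqP.
  by have := h (m + 2%:R); rewrite !ord3A.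
by have := h (m + 1); rewrite !ord3A => /eqP; rewrite subr_eq0 => /eqP->; rewrite subrr.
Qed.

Lemma curl_gradient0 (w : poly3) m :
  mderiv (m + 1) (mderiv (m + 2%:R) w) - mderiv (m + 2%:R) (mderiv (m + 1) w) = 0.
Proof. by rewrite mderiv_comm subrr. Qed.

Lemma sym_coef (s : 'M[poly3]_3) i j : sym s i j = (2^-1 : R) *: (s i j + s j i).
Proof. by rewrite !mxE. Qed.

Lemma conf_sym_grad (u : vfield M) : (forall i, conf k (lvX i) (fun c => u c 0 i)) ->
  forall i j, conf k (lvPhi i j) (fun c => sym (grad (u c)) i j).
Proof.
move=> cu i j.
have -> : (fun c => sym (grad (u c)) i j) =
    (fun c => (2^-1 : R) *: (mderiv j (u c 0 i) + mderiv i (u c 0 j))).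
  by apply: funext => c; rewrite sym_coef !mxE.
apply/confZ/confD; first by apply: conf_deriv (cu i) => n; rewrite -lev1_lvX.
by apply: conf_deriv (cu j) => n; rewrite -[LHS]/(lev1 (lvX j) i n) lev1_lvX /lvPhi; lia.
Qed.

Lemma conf_curlT (s : mfield M) : (forall i j, conf k (lvPhi i j) (fun c => s c i j)) ->
  forall i j, conf k (lev1 (lvW i) j) (fun c => curlT (s c) i j).
Proof.
move=> cs i j.
have -> : (fun c => curlT (s c) i j) = (fun c => mderiv (i + 1) (s c (i + 2%:R) j) -
    mderiv (i + 2%:R) (s c (i + 1) j)).
  by apply: funext => c; rewrite curlT_coef.
apply: confB; apply: conf_deriv (cs _ _) => n; rewrite lev1_lvW /upd /lvPhi;
  by case: (ord3P i) => ->; case: (ord3P j) => ->; case: (ord3P n) => ->.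
Qed.

Lemma conf_curl_curlT (s : mfield M) : (forall i j, conf k (lvPhi i j) (fun c => s c i j)) ->
  forall i m, conf k (lvGamma i m) (fun c => curl (curlT (s c)) i m).
Proof.
move=> /conf_curlT ct i m.
have -> : (fun c => curl (curlT (s c)) i m) = (fun c => mderiv (m + 1) (curlT (s c) i (m + 2%:R)) -
    mderiv (m + 2%:R) (curlT (s c) i (m + 1))).
  by apply: funext => c; rewrite curl_coef.
apply: confB; apply: conf_deriv (ct _ _) => n; rewrite /upd !lev1_lvW /lvGamma;
  by case: (ord3P i) => ->; case: (ord3P m) => ->; case: (ord3P n) => ->.
Qed.

Lemma curl_curlT_sym (s : 'M[poly3]_3) : s^T = s -> (curl (curlT s))^T = curl (curlT s).
Proof.
move=> ss; have sE i j : s i j = s j i by rewrite -{1}ss mxE.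
apply/matrixP => i m; rewrite mxE !curl_coef !curlT_coef !mderivB.
rewrite !(mderiv_comm (m + 1)) !(mderiv_comm (m + 2%:R)).
rewrite (sE (m + 2%:R) (i + 2%:R)) (sE (m + 1) (i + 2%:R)) (sE (m + 2%:R) (i + 1)) (sE (m + 1) (i + 1)).
by rewrite !opprB !addrA [RHS](ACl (1*4*3*2)).
Qed.

Lemma conf_div (s : mfield M) : (forall i j, conf k (lvGamma i j) (fun c => s c i j)) ->
  forall i, conf k (lvZ i) (fun c => div (s c) 0 i).
Proof.
move=> cs i.
have -> : (fun c => div (s c) 0 i) = (fun c => mderiv i (s c i i) +
    mderiv (i + 1) (s c i (i + 1)) + mderiv (i + 2%:R) (s c i (i + 2%:R))).
  by apply: funext => c; rewrite mxE (sum3 _ i).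
by do 2?apply: confD; apply: conf_deriv (cs _ _) => n; rewrite /upd /lvGamma /lvZ;
  case: (ord3P i) => ->; case: (ord3P n) => ->.
Qed.

Hypothesis (H1 : jumps_removable M) (H2 : closed_coboundary M).

(** A diagonal field suffices. Component i of [q] has level 0 in the directions other than i, so it
    can be integrated in each column along i independently. *)
Lemma div_onto (q : vfield M) : (forall i, conf k (lvZ i) (fun c => q c 0 i)) ->
  exists s : mfield M, [/\ forall c, (s c)^T = s c,
    forall i j, conf k (lvGamma i j) (fun c => s c i j) & forall c, div (s c) = q c].
Proof.
move=> cq.
have G i : {G : cells -> poly3 | conf k (lvGamma i i) G & forall c, mderiv i (G c) = q c 0 i}.
  apply: cid2; have [|G cG dG] := column_integral (m := i) (cq i).
    by move=> n c r e /negbTE ni; rewrite /lvZ ni.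
  by exists G => //; apply: eq_conf cG => n; rewrite /upd /lvZ /lvGamma; case: eqP => // _; rewrite eqxx.
pose s : mfield M := [ffun c => \matrix_(i, j) (if i == j then s2val (G i) c else 0)].
exists s; split.
- by move=> c; apply/matrixP => i j; rewrite ffunE !mxE eq_sym; case: eqP => // ->.
- move=> i j; have [<-|ij] := eqVneq i j.
    have -> : (fun c => s c i i) = s2val (G i).
      by apply: funext => c; rewrite ffunE mxE eqxx.
    by case: (G i).
  have -> : (fun c => s c i j) = (fun=> 0).
    by apply: funext => c; rewrite ffunE mxE (negbTE ij).
  exact: conf0.
move=> c; apply/rowP => i; rewrite mxE (bigD1 i) //= ffunE mxE eqxx.
rewrite big1 ?addr0 => [|j ji]; last by rewrite mxE eq_sym (negbTE ji) mderiv0.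
by case: (G i).
Qed.

Lemma inc_free_sym_grad (s : mfield M) : (forall c, (s c)^T = s c) ->
  (forall i j, conf k (lvPhi i j) (fun c => s c i j)) ->
  (forall c, curl (curlT (s c)) = 0) ->
  exists2 u : vfield M, forall i, conf k (lvX i) (fun c => u c 0 i) &
    forall c, sym (grad (u c)) = s c.
Proof.
move=> ss cs inc0; have sE c i j : s c i j = s c j i by rewrite -{1}ss mxE.
pose tau i j c := curlT (s c) i j.
have W i : {w : cells -> poly3 | conf k (lvW i) w & forall j c, mderiv j (w c) = tau i j c}.
  apply: cid2; apply: (curl_free_gradient k2 (f := tau i) H1 (regular_lvW i)).
    by move=> j; exact: conf_curlT.
  move=> m n c; apply: (@curl_row0 (fun j => tau i j c)) => j.
  by rewrite -curl_coef inc0 mxE.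
pose w i := s2val (W i).
have cw i : conf k (lvW i) (w i) by rewrite /w; case: (W i).
have dw i j c : mderiv j (w i c) = mderiv (i + 1) (s c (i + 2%:R) j) - mderiv (i + 2%:R) (s c (i + 1) j).
  by rewrite -curlT_coef /w; case: (W i) => /= v _ ->.
(* The skew matrix of the vector [w] is added to [s]: it cancels the curl of every row and
   disappears again in the symmetric gradient. *)
pose f i j c := if j == i then s c i i else if j == i + 1 then s c i j - w (i + 2%:R) c
  else s c i j + w (i + 1) c.
have fE i c : [/\ f i i c = s c i i, f i (i + 1) c = s c i (i + 1) - w (i + 2%:R) c &
    f i (i + 2%:R) c = s c i (i + 2%:R) + w (i + 1) c].
  have [n1 n2 n3] := ord3_neq i.
  by rewrite /f !eqxx (negbTE n1) (negbTE n2) eq_sym (negbTE n3).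
have U i : {u : cells -> poly3 | conf k (lvX i) u & forall j c, mderiv j (u c) = f i j c}.
  apply: cid2.
  apply: (curl_free_gradient k2 (f := f i) H1 (regular_lvX i)) => [j|m n c].
    apply: (eq_conf (fun n => esym (lev1_lvX i j n))); case: (ord3_rel i j) => ->.
    - have -> : f i i = (fun c => s c i i) by apply: funext => c; case: (fE i c).
      exact: cs.
    - have -> : f i (i + 1) = (fun c => s c i (i + 1) - w (i + 2%:R) c) by apply: funext => c; case: (fE i c).
      apply: confB => //; apply: eq_conf (cw _) => n; rewrite /lvW /lvPhi.
      by case: (ord3P i) => ->; case: (ord3P n) => ->.
    - have -> : f i (i + 2%:R) = (fun c => s c i (i + 2%:R) + w (i + 1) c) by apply: funext => c; case: (fE i c).
      apply: confD => //; apply: eq_conf (cw _) => n; rewrite /lvW /lvPhi.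
      by case: (ord3P i) => ->; case: (ord3P n) => ->.
  apply: (@curl_row0 (fun j => f i j c)) => j; have [e0 e1 e2] := fE i c.
  case: (ord3_rel i j) => ->; rewrite ?ord3A ?e0 ?e1 ?e2 !(mderivD, mderivB) ?mderivN !dw ?ord3A.
  - rewrite (sE c (i + 2%:R) (i + 1)) (sE c i (i + 1)) (sE c i (i + 2%:R)); ring.
  - rewrite (sE c i (i + 2%:R)); ring.
  - rewrite (sE c (i + 1) i); ring.
pose u : vfield M := [ffun c => \row_i s2val (U i) c].
have du i j c : mderiv j (u c 0 i) = f i j c by rewrite ffunE mxE; case: (U i) => /= v _ ->.
exists u => [i|c].
  have -> : (fun c => u c 0 i) = s2val (U i) by apply: funext => c; rewrite ffunE mxE.
  by case: (U i).
have half (x y z : poly3) : x + y = z + z -> (2^-1 : R) *: (x + y) = z.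
  have h2 : (2^-1 : R) * (1 + 1) = 1 by rewrite mulVf // pnatr_eq0.
  by move=> ->; rewrite -{1 2}[z]scale1r -scalerDl scalerA h2 scale1r.
apply/matrixP => i j; rewrite sym_coef ![grad _ _ _]mxE !du; apply: half.
have [n1 n2 n3] := ord3_neq i.
have [e0 e1 e2] := fE i c.
have [_ e4 e5] := fE j c.
case: (ord3_rel i j) e4 e5 => ->; rewrite ?ord3A => e4 e5.
- by rewrite e0.
- by rewrite e1 e5 (sE c (i + 1) i); ring.
- by rewrite e2 e4 (sE c (i + 2%:R) i); ring.
Qed.

(** Once the trace-free [t] is found, its columns are the curls of fields [r0 j]. The vanishing
    trace is then used a second time: it says that the axial vector of the skew part of [r0] is
    divergence free, hence the curl of some [v]. Subtracting the gradient of [v] makes [r0]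
    symmetric and leaves the curls unchanged. *)
Lemma div_free_inc (g : mfield M) : (forall c, (g c)^T = g c) ->
  (forall i j, conf k (lvGamma i j) (fun c => g c i j)) ->
  (forall c, div (g c) = 0) ->
  exists s : mfield M, [/\ forall c, (s c)^T = s c,
    forall i j, conf k (lvPhi i j) (fun c => s c i j) & forall c, curl (curlT (s c)) = g c].
Proof.
move=> gs cg dg; have gE c i j : g c i j = g c j i by rewrite -{1}gs mxE.
have D2 L f := @divergence_free_curl R M k k2 L f H2.
have T i : {t : 'I_3 -> cells -> poly3 | forall j, conf k (lev1 (lvW i) j) (t j) &
    forall m c, mderiv (m + 1) (t (m + 2%:R) c) - mderiv (m + 2%:R) (t (m + 1) c) = g c i m}.
  apply: cid2; apply: (D2 (lvW i) (fun m c => g c i m)) (regular_lvW i) _ _ => [j|c].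
    by apply: eq_conf (cg i j) => n; rewrite lev2_lvW.
  by have := congr1 (fun v : 'rV[poly3]_3 => v 0 i) (dg c); rewrite !mxE.
pose t0 i := s2val (T i).
have ct0 i j : conf k (lev1 (lvW i) j) (t0 i j) by rewrite /t0; case: (T i).
have dt0 i m c : mderiv (m + 1) (t0 i (m + 2%:R) c) - mderiv (m + 2%:R) (t0 i (m + 1) c) = g c i m.
  by rewrite /t0; case: (T i).
(* Adding gradients to the rows of [t0] keeps their curls and changes the trace by a divergence. For
   functions of constant level 2, component i of a 2-form has level [lvW i], as the gradients
   require. *)
have [|w cw dw] := div_surjective k2 (h := fun c => - \sum_i t0 i i c) regular2.
  apply: confN; have -> : (fun c => \sum_i t0 i i c) =
      (fun c => t0 0 0 c + t0 (0 + 1) (0 + 1) c + t0 (0 + 2%:R) (0 + 2%:R) c).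
    by apply: funext => c; rewrite (sum3 _ 0).
  by do 2?apply: confD; apply: eq_conf (ct0 _ _) => n; rewrite lev1_lvW /lev3; case: eqP.
pose t i j c := t0 i j c + mderiv j (w i c).
have ct i j : conf k (lev1 (lvW i) j) (t i j).
  apply: confD => //; apply: conf_deriv (cw i) => n; rewrite lev1_lvW /lev2 /upd.
  by case: (ord3P i) => ->; case: (ord3P j) => ->; case: (ord3P n) => ->.
have dt i m c : mderiv (m + 1) (t i (m + 2%:R) c) - mderiv (m + 2%:R) (t i (m + 1) c) = g c i m.
  rewrite /t !mderivD opprD addrACA dt0.
  by rewrite (mderiv_comm (m + 2%:R)) subrr addr0.
have tr i c : t i i c + t (i + 1) (i + 1) c + t (i + 2%:R) (i + 2%:R) c = 0.
  rewrite -(sum3 (fun i => t i i c)) /t big_split /= dw subrr //.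
clearbody t.
(* Symmetry of [g], the matrix of row-wise curls of [t], equates the divergence of column j with the
   j-th derivative of the trace. *)
have divt j c : \sum_i mderiv i (t i j c) = 0.
  have := gE c (j + 1) (j + 2%:R); rewrite -!dt !ord3A => e.
  have := congr1 (mderiv j) (tr j c); rewrite !mderivD mderiv0 => e'.
  rewrite (sum3 _ j).
  have -> : mderiv j (t j j c) = - mderiv j (t (j + 1) (j + 1) c) - mderiv j (t (j + 2%:R) (j + 2%:R) c).
    by apply/eqP; rewrite -subr_eq0 -opprD opprK addrA e'.
  move/eqP: e; rewrite -subr_eq0 => /eqP e.
  by rewrite -[RHS]oppr0 -e; ring.
have P j : {r : 'I_3 -> cells -> poly3 | forall m, conf k (lev1 (lvX j) m) (r m) &
    forall i c, mderiv (i + 1) (r (i + 2%:R) c) - mderiv (i + 2%:R) (r (i + 1) c) = t i j c}.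
  apply: cid2; apply: (D2 (lvX j) (fun i c => t i j c)) (regular_lvX j) _ _ => [i|c]; last exact: divt.
  by apply: eq_conf (ct i j) => n; rewrite lev2_lvX.
pose r0 j := s2val (P j).
have cr0 j m : conf k (lvPhi j m) (r0 j m).
  by apply: (eq_conf (lev1_lvX j m)); rewrite /r0; case: (P j).
have dr0 j i c : mderiv (i + 1) (r0 j (i + 2%:R) c) - mderiv (i + 2%:R) (r0 j (i + 1) c) = t i j c.
  by rewrite /r0; case: (P j).
have [||v cv dv] := D2 (fun=> 2%N) (fun l c => r0 (l + 2%:R) (l + 1) c - r0 (l + 1) (l + 2%:R) c) regular2.
- move=> l; apply: confB; apply: eq_conf (cr0 _ _) => n; rewrite /lev2 /upd /lvPhi;
  by case: (ord3P l) => ->; case: (ord3P n) => ->.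
- move=> c; have := tr 0 c; rewrite -!dr0 !ord3E => e.
  by rewrite (sum3 _ 0) !mderivB -[RHS]e !ord3E; ring.
pose s i j c := r0 i j c - mderiv j (v i c).
have sS i j c : s i j c = s j i c.
  have hh l : s (l + 2%:R) (l + 1) c = s (l + 1) (l + 2%:R) c.
    apply/eqP; rewrite -subr_eq0 /s opprB addrACA -opprB.
    apply/eqP; have := dv l c => /eqP; rewrite -subr_eq0 => /eqP e.
    by rewrite -[RHS]oppr0 -e; ring.
  case: (ord3_rel i j) => -> //.
    by have := hh (i + 2%:R); rewrite !ord3A.
  by have := hh (i + 1); rewrite !ord3A.
exists [ffun c => \matrix_(i, j) s i j c]; split.
- by move=> c; apply/matrixP => i j; rewrite ffunE !mxE sS.
- move=> i j; have -> : (fun c => ([ffun c => \matrix_(i, j) s i j c] : mfield M) c i j) = s i j.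
    by apply: funext => c; rewrite ffunE mxE.
  apply: confB => //; apply: conf_deriv (cv i) => n; rewrite /lev1 /lvPhi /upd.
  by case: (ord3P i) => ->; case: (ord3P j) => ->; case: (ord3P n) => ->.
move=> c; apply/matrixP => i m; rewrite ffunE curl_coef.
have E j : curlT (\matrix_(i, j) s i j c) i j = t i j c.
  rewrite curlT_coef !mxE (sS (i + 2%:R)) (sS (i + 1)) /s !mderivB opprD addrACA dr0.
  by rewrite opprK (mderiv_comm (i + 2%:R)) addNr addr0.
by rewrite !E dt.
Qed.
End ElasticityExactness.

(** * Degrees of freedom *)

Section Integrals.
Variable R : realType.
Local Notation poly3 := (mpoly 3 R).
Implicit Types (a b : R) (q f : {poly R}) (p : poly3) (m : 'I_3).

Lemma is_derive_horner f x : is_derive x (1 : R) (horner f) (f^`().[x]).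
Proof.
by apply: DeriveDef; [exact: derivable_horner|rewrite -derive1E -derivE].
Qed.

Lemma continuous_horner f : continuous (horner f).
Proof.
by move=> x; apply/differentiable_continuous/derivable1_diffP; exact: derivable_horner.
Qed.

Definition intf a b f := if a == b then f.[a] else defint a b f.

Lemma intf_scalar a b : scalar (intf a b).
Proof.
move=> c f g; rewrite /intf; case: eqP => _; last exact: defint_scalar.
by rewrite hornerD hornerZ.
Qed.

Lemma int1_horner a b f : a <= b -> int1 a b (horner f) = intf a b f.
Proof.
rewrite le_eqVlt /int1 /intf; case: eqVneq => [//|_ /= ab].
rewrite /Rintegral (continuous_FTC2 (F := horner (primp f)) ab) //.
- by apply: continuous_subspaceT => x; exact: continuous_horner.
- split=> [x _||]; first exact: derivable_horner.
    by apply: cvg_at_right_filter; exact: continuous_horner.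
  by apply: cvg_at_left_filter; exact: continuous_horner.
- by move=> x _; rewrite -derivE deriv_primp.
Qed.

Definition pev m (v : 'I_3 -> R) p : {poly R} :=
  mmap (@polyC R) (fun i => if i == m then 'X else (v i)%:P) p.

Lemma pev_linear m v : linear (pev m v).
Proof. by move=> c x y; rewrite /pev mmapD mmapZ mul_polyC. Qed.

Lemma pev_mono m v (a : multinom 3) :
  pev m v (tens (mono R a)) = (\prod_(i | i != m) v i ^+ a i) *: 'X^(a m).
Proof.
rewrite tens_mono /pev mmapX /mmap1 (bigD1 m) //= eqxx mulrC -mul_polyC rmorph_prod.
by congr (_ * _); apply: eq_bigr => i /negbTE ->; rewrite rmorphXn.
Qed.

Lemma horner_pev m v p x : (pev m v p).[x] = meval (upd v m x) p.
Proof.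
move: p; apply: (@linear_mono_eq _ R^o (fun p => (pev m v p).[x]) (meval (upd v m x))).
- by move=> c s t; rewrite pev_linear hornerD hornerZ.
- exact: meval_linear.
move=> a; rewrite pev_mono hornerZ hornerXn meval_tens [in RHS](bigD1 m) //= /upd eqxx hornerXn mulrC.
by congr (_ * _); apply: eq_bigr => i /negbTE im; rewrite im hornerXn.
Qed.

Lemma scalar_pev m v (mu : {poly R} -> R) p : scalar mu ->
  mu (pev m v p) = meval v (lift m (fun f => (mu f)%:P) p).
Proof.
move=> mul; move: p.
apply: (@linear_mono_eq _ R^o (fun p => mu (pev m v p)) (fun p => meval v (lift m (fun f => (mu f)%:P) p))).
- by move=> c s t; rewrite pev_linear mul.
- by move=> c s t; rewrite linearP meval_linear.
move=> a; rewrite pev_mono.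
have muZ c s : mu (c *: s) = c * mu s.
  have := mul c s 0; rewrite !addr0 => ->; have := mul 1 0 0.
  rewrite scale1r addr0 mul1r => h; have -> : mu 0 = 0 by lra.
  exact: addr0.
rewrite muZ lift_mono meval_tens [in RHS](bigD1 m) //= /upd eqxx hornerC mulrC.
by congr (_ * _); apply: eq_bigr => i /negbTE im; rewrite im hornerXn.
Qed.

Lemma int1_meval m v a b p : a <= b ->
  int1 a b (fun x => meval (upd v m x) p) = meval v (lift m (fun f => (intf a b f)%:P) p).
Proof.
move=> ab; rewrite -(scalar_pev _ _ _ (@intf_scalar a b)) -int1_horner //.
by congr int1; apply: funext => x; rewrite horner_pev.
Qed.

Definition box_fun (G : box R) i := intf (lo G 0 i) (hi G 0 i).

Lemma box_fun_scalar G i : scalar (box_fun G i).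
Proof. exact: intf_scalar. Qed.

Lemma integral_onE (G : box R) p : (forall i, lo G 0 i <= hi G 0 i) ->
  integral_on G p = fun3 (box_fun G) p.
Proof.
move=> le_lh; rewrite /integral_on.
have E0 x y : (fun z => meval (fun i : 'I_3 => nth 0 [:: x; y; z] i) p) =
    (fun z => meval (upd (fun i : 'I_3 => nth 0 [:: x; y] i) 2%:R z) p).
  apply: funext => z; congr (meval _ p); apply: funext => i.
  by case: (ord3P i) => ->.
under eq_fun => x do under eq_fun => y do rewrite E0 int1_meval //.
have E1 x (q : poly3) : (fun y => meval (fun i : 'I_3 => nth 0 [:: x; y] i) q) =
    (fun y => meval (upd (fun i : 'I_3 => nth 0 [:: x] i) 1 y) q).
  apply: funext => z; congr (meval _ q); apply: funext => i.
  by case: (ord3P i) => ->.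
under eq_fun => x do rewrite E1 int1_meval //.
have E2 (q : poly3) : (fun x => meval (fun i : 'I_3 => nth 0 [:: x] i) q) =
    (fun x => meval (upd (fun i : 'I_3 => 0) 0 x) q).
  apply: funext => z; congr (meval _ q); apply: funext => i.
  by case: (ord3P i) => ->.
rewrite E2 int1_meval //; move: p {E0}.
pose mu i f := intf (lo G 0 i) (hi G 0 i) f.
apply: (@linear_tens_eq _ R^o (fun p => meval (fun=> 0) (lift3 (fun i f => (mu i f)%:P) p)) (fun3 mu)).
- by move=> c s t; rewrite lift3_linear meval_linear.
- exact: fun3_scalar.
move=> q; rewrite fun3_tens => [|i]; last exact: intf_scalar.
rewrite lift3_tens => [|i]; last by apply: linear_constP; exact: intf_scalar.
by rewrite meval_tens; apply: eq_bigr => i _; rewrite hornerC.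
Qed.

(** The primitive is monotone with equal end values, so it is constant on the interval and hence as
    a polynomial. *)
Lemma defint_ge0_eq0 a b f : a < b -> (forall x, a < x < b -> 0 <= f.[x]) ->
  defint a b f = 0 -> f = 0.
Proof.
move=> ab f0 int0; pose F := primp f.
have mono x y : a <= x -> y <= b -> x <= y -> F.[x] <= F.[y].
  rewrite le_eqVlt => ax yb; rewrite le_eqVlt => /orP[/eqP->//|xy].
  have [z] := MVT xy (fun z _ => is_derive_horner F z)
    (continuous_subspaceT (fun z => @continuous_horner F z)).
  rewrite in_itv /= => /andP[xz zy] e; rewrite -subr_ge0 e; apply: mulr_ge0; last by rewrite subr_ge0 ltW.
  by rewrite deriv_primp f0 //; case/orP: ax => [/eqP->|ax]; lra.
have cst x : a <= x <= b -> F.[x] = F.[a].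
  move=> /andP[ax xb]; have h1 := mono a x (lexx _) xb ax.
  have h2 := mono x b ax (lexx _) xb; move: int0; rewrite /defint -/F => ?; lra.
have -> : f = (F - F.[a]%:P)^`() by rewrite derivB derivC subr0 deriv_primp.
suff -> : F - F.[a]%:P = 0 by rewrite deriv0.
pose pts := [seq a + (b - a) / i.+1%:R | i <- iota 0 (size (F - F.[a]%:P))].
apply: (@roots_geq_poly_eq0 _ _ pts); last by rewrite size_map size_iota.
- apply/allP => x /mapP[i _ ->]; rewrite rootE !hornerE cst ?subrr //.
  have i1 : 0 < i.+1%:R^-1 :> R by rewrite invr_gt0 ltr0Sn.
  have i2 : i.+1%:R^-1 <= 1 :> R by rewrite invf_le1 ?ltr0Sn // ler1n.
  set t := i.+1%:R^-1 in i1 i2 *; have ba : 0 < b - a by rewrite subr_gt0.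
  have h1 := mulr_gt0 ba i1; have h2 : 0 <= (b - a) * (1 - t) by apply: mulr_ge0; lra.
  by apply/andP; split; nra.
rewrite map_inj_uniq ?iota_uniq // => i j /addrI /mulfI h.
have : (i.+1%:R : R) = j.+1%:R by apply: invr_inj; apply: h; rewrite subr_eq0 gt_eqF.
by move/eqP; rewrite eqr_nat => /eqP [].
Qed.

Lemma double_root f a l : (l <= 2)%N -> (forall r, (r < l)%N -> jet r a f = 0) ->
  exists g, f = g * ('X - a%:P) ^+ l.
Proof.
case: l => [|[|[|//]]] _ h; first by exists f; rewrite expr0 mulr1.
  have /factor_theorem[g ->] : root f a by rewrite rootE; apply/eqP; exact: (h 0%N).
  by exists g; rewrite expr1.
have /factor_theorem[g eg] : root f a by rewrite rootE; apply/eqP; exact: (h 0%N).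
have : root g a.
  have := h 1%N isT; rewrite /jet derivn1 eg derivM derivXsubC mulr1 !hornerE subrr mulr0 add0r.
  by move=> e; rewrite rootE e.
by move/factor_theorem=> [g' eg']; exists g'; rewrite eg eg' expr2 mulrA.
Qed.

(** The end conditions make [f] divisible by ((X - a)(X - b))^l, and the cofactor [q] is small
    enough to be an admissible test function. Testing with it gives the integral of q^2 against a
    weight of constant sign (-1)^l. *)
Lemma unisolvence1 k l a b f : (2 <= k)%N -> (l <= 2)%N -> a < b ->
  (size f <= k + l)%N ->
  (forall r, (r < l)%N -> jet r a f = 0 /\ jet r b f = 0) ->
  (forall q, (size q <= k - l)%N -> defint a b (f * q) = 0) -> f = 0.
Proof.
move=> k2 l2 ab sf jf mf.
have [g eg] := double_root l2 (fun r rl => (jf r rl).1).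
have jg r : (r < l)%N -> jet r b g = 0.
  have ba : b - a != 0 by rewrite subr_eq0 gt_eqF.
  move=> rl; have := (jf r rl).2.
  have e0 : (0 < l)%N -> g.[b] = 0.
    move=> l0; have := (jf 0%N l0).2; rewrite /jet derivn0 eg hornerM horner_exp !hornerE.
    by move/eqP; rewrite mulf_eq0 expf_eq0 (negbTE ba) andbF orbF => /eqP.
  case: r rl => [|[|r]] rl; [by move=> _; exact: e0| |by lia].
  rewrite /jet !derivn1 eg derivM hornerD !hornerM horner_exp (e0 (ltnW rl)) mul0r addr0 !hornerE.
  by move/eqP; rewrite mulf_eq0 expf_eq0 (negbTE ba) andbF orbF => /eqP.
have [q eq] := double_root l2 jg.
pose B := (('X - a%:P) * ('X - b%:P)) ^+ l.
have fq : f = q * B by rewrite eg eq /B exprMn mulrAC mulrA.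
have mB : B \is monic by rewrite monic_exp // monicMl ?monicXsubC.
have sB : size B = (l.*2).+1.
  have := size_exp (('X - a%:P) * ('X - b%:P)) l.
  rewrite size_Mmonic ?monicXsubC ?polyXsubC_eq0 // !size_XsubC /= mul2n -/B => <-.
  by rewrite prednK // lt0n size_poly_eq0 monic_neq0.
have sq : (size q <= k - l)%N.
  have [->|q0] := eqVneq q 0; first by rewrite size_poly0.
  move: sf; rewrite fq size_Mmonic // sB addnS /= -addnn addnA leq_add2r => h.
  by rewrite leq_subRL ?(leq_trans l2) // addnC.
pose s : R := (-1) ^+ l.
have : defint a b (s *: (f * q)) = 0.
  have := defint_scalar a b s (f * q) 0; rewrite addr0 mf // mulr0 => ->.
  by have := mf 0; rewrite size_poly0 mulr0 add0r; apply.
move/(defint_ge0_eq0 ab) => h.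
have /eqP : s *: (f * q) = 0.
  apply: h => x /andP[ax xb]; rewrite fq /B hornerZ !hornerM horner_exp hornerM !hornerXsubC.
  have -> : s * (q.[x] * ((x - a) * (x - b)) ^+ l * q.[x]) = q.[x] ^+ 2 * ((x - a) * (b - x)) ^+ l.
    have -> : (x - a) * (b - x) = -1 * ((x - a) * (x - b)) by ring.
    by rewrite [in RHS]exprMn -/s; set Y := (_ * _) ^+ l; ring.
  by rewrite mulr_ge0 ?sqr_ge0 // exprn_ge0 // mulr_ge0 // subr_ge0 ltW.
rewrite scaler_eq0 signr_eq0 /= fq -mulrA [B * q]mulrC mulrA mulf_eq0 (negbTE (monic_neq0 mB)) orbF.
by rewrite -expr2 expf_eq0 /= => /eqP->; rewrite mul0r.
Qed.
End Integrals.

Section DegreesOfFreedom.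
Variables (R : realType) (M : mesh R) (k : nat).
Hypothesis k2 : (2 <= k)%N.
Local Notation poly3 := (mpoly 3 R).
Local Notation cells := 'I_(ncells M).
Implicit Types (c : cells) (m n : 'I_3) (L : 'I_3 -> nat) (p : 'rV[R]_3) (F : cells -> poly3).

Definition star_link p : rel cells := fun c c' =>
  `[< [/\ incell c p, incell c' p & exists m, adj m c c' \/ adj m c' c] >].

Definition star_connected := forall p c c', incell c p -> incell c' p ->
  connect (star_link p) c c'.

Lemma connect_eq (T : finType) (e : rel T) (U : Type) (F : T -> U) :
  (forall x y, e x y -> F x = F y) -> forall x y, connect e x y -> F x = F y.
Proof.
move=> eF x y /connectP[s]; elim: s x => [|z s IH] x /= ; first by move=> _ ->.
by move=> /andP[xz ps] ey; rewrite (eF _ _ xz); exact: IH.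
Qed.

Lemma tensM (q q' : 'I_3 -> {poly R}) : tens q * tens q' = tens (fun i => q i * q' i).
Proof. by rewrite /tens -big_split; apply: eq_bigr => i _; rewrite rmorphM. Qed.

Lemma fun3_tensM mu (x : poly3) (q : 'I_3 -> {poly R}) : (forall i, scalar (mu i)) ->
  fun3 mu (x * tens q) = fun3 (fun i f => mu i (f * q i)) x.
Proof.
move=> mul; move: x.
have mul' i : scalar (fun f => mu i (f * q i)).
  by move=> c u v; rewrite mulrDl -scalerAl mul.
apply: (@linear_tens_eq _ R^o (fun x => fun3 mu (x * tens q)) (fun3 (fun i f => mu i (f * q i)))).
- by move=> c u v; rewrite mulrDl -scalerAl fun3_scalar.
- exact: fun3_scalar.
by move=> s; rewrite tensM !fun3_tens.
Qed.

(** A functional that evaluates at x_m = a sees only the restriction to that plane. *)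
Lemma fun3_traceM mu m a (x y : poly3) : (forall i, scalar (mu i)) -> (forall f, mu m f = f.[a]) ->
  fun3 mu (x * y) = fun3 mu (trace 0 m a x * y).
Proof.
move=> mul mm; move: y; apply: (@linear_tens_eq _ R^o (fun y => fun3 mu (x * y))
  (fun y => fun3 mu (trace 0 m a x * y))).
- by move=> c u v; rewrite mulrDr -scalerAr fun3_scalar.
- by move=> c u v; rewrite mulrDr -scalerAr fun3_scalar.
move=> q; move: x; apply: (@linear_tens_eq _ R^o (fun x => fun3 mu (x * tens q))
  (fun x => fun3 mu (trace 0 m a x * tens q))).
- by move=> c u v; rewrite mulrDl -scalerAl fun3_scalar.
- by move=> c u v; rewrite linearP mulrDl -scalerAl fun3_scalar.
move=> s; rewrite trace_tens !tensM !fun3_tens //; apply: eq_bigr => i _; rewrite /upd.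
by case: eqP => // ->; rewrite !mm !hornerM hornerC.
Qed.

Lemma trace_derivs r m a (d : seq 'I_3) (x y : poly3) :
  (forall r', (r' <= r + count_mem m d)%N -> trace r' m a x = trace r' m a y) ->
  trace r m a (derivs d x) = trace r m a (derivs d y).
Proof.
elim: d r => [|n d IH] r h /=; first by apply: h; rewrite addn0.
have [nm|nm] := eqVneq n m.
  by rewrite nm !trace_mderiv; apply: IH => r' hr; apply: h; rewrite /= nm eqxx addnCA.
by rewrite !trace_mderiv_comm 1?eq_sym // (IH r) // => r' hr; apply: h; rewrite /= (negbTE nm).
Qed.

Definition dof_ok L (d : dof) := forall m, m \notin unzip1 d.2 -> (count_mem m d.1 < L m)%N.

(** Two cells that share an entity are linked by a chain of faces through its midpoint. Each
    crossing affects the functional only through normal jets on the crossed face, and these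
    agree. *)
Lemma conf_single_valued L F (ds : seq dof) : star_connected -> conf k L F ->
  (forall d, d \in ds -> dof_ok L d) -> single_valued ds F.
Proof.
move=> sc [_ cF] ok d dds G c c' fG fG' q _.
have inD i : i \in unzip1 d.2 -> lo G 0 i = clo c i /\ hi G 0 i = chi c i.
  by move=> iD; have := fG i; rewrite iD.
have ninD i : i \notin unzip1 d.2 -> lo G 0 i = hi G 0 i /\ (lo G 0 i = clo c i \/ lo G 0 i = chi c i).
  by move=> iD; have := fG i; rewrite (negbTE iD).
have leG i : lo G 0 i <= hi G 0 i.
  case: (boolP (i \in unzip1 d.2)) => [/inD[-> ->]|/ninD[-> //]].
  by apply: ltW; exact: clo_lt_chi.
(* In the directions along [G] the midpoint is inside the interval of every cell that contains it,
   so the faces crossed in its star are all normal to directions in which [G] is flat. *)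
pose p : 'rV[R]_3 := \row_i ((lo G 0 i + hi G 0 i) / 2).
have cp : incell c p.
  move=> i; rewrite mxE -/(clo _ _) -/(chi _ _); have lc := clo_lt_chi c i.
  by case: (boolP (i \in unzip1 d.2)) => [/inD[-> ->]|/ninD[<- [->|->]]]; lra.
have c'p : incell c' p.
  move=> i; rewrite mxE -/(clo _ _) -/(chi _ _); have lc := clo_lt_chi c' i.
  by have := fG' i; case: ifP => _; rewrite -/(clo _ _) -/(chi _ _) => -[e1 e2];
    [rewrite e1 e2|rewrite -e1; case: e2 => ->]; lra.
rewrite !integral_onE //.
suff step t t' m : incell t p -> incell t' p -> adj m t t' ->
    fun3 (box_fun G) (derivs d.1 (F t) * q) = fun3 (box_fun G) (derivs d.1 (F t') * q).
  apply: (@connect_eq _ (star_link p) _ (fun t => fun3 (box_fun G) (derivs d.1 (F t) * q)) _ _ _ (sc p c c' cp c'p)).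
  move=> t t' /asboolP[tp t'p [m [a|a]]]; [exact: step a|].
  by apply/esym; exact: step a.
move=> tp t'p a.
have pm : p 0 m = chi t m.
  have := tp m; have := t'p m; rewrite -!/(clo _ _) -!/(chi _ _); have [<- _] := a; lra.
have mD : m \notin unzip1 d.2.
  apply/negP => /inD[e1 e2]; have lc := clo_lt_chi c m.
  have pc : p 0 m = (clo c m + chi c m) / 2 by rewrite mxE e1 e2.
  have [ct|ct] := eqVneq c t; first by rewrite -ct in pm; lra.
  by have [/(_ m) tri _] := cells_meet ct cp tp; case: tri => -[]; lra.
have [eG _] := ninD m mD.
have mm f : box_fun G m f = f.[chi t m].
  by rewrite /box_fun /intf eG eqxx -pm mxE eG; congr (f.[_]); lra.
have bs i : scalar (box_fun G i) by exact: box_fun_scalar.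
have E : trace 0 m (chi t m) (derivs d.1 (F t)) = trace 0 m (chi t m) (derivs d.1 (F t')).
  apply: trace_derivs => r' hr; apply: cF => //; apply: leq_ltn_trans hr _.
  by rewrite add0n; exact: ok.
by rewrite (fun3_traceM (derivs d.1 (F t)) q bs mm) (fun3_traceM (derivs d.1 (F t')) q bs mm) E.
Qed.

Lemma fun3_derivs mu (d : seq 'I_3) (x : poly3) : (forall i, scalar (mu i)) ->
  fun3 mu (derivs d x) = fun3 (fun i q => mu i q^`(count_mem i d)) x.
Proof.
elim: d mu => [|n d IH] mu mul /=; first exact: eq_fun3.
rewrite -lift_deriv fun3_lift //; last exact: linearP.
rewrite IH => [|i]; last first.
  by rewrite /upd; case: eqP => // _ c u v; rewrite /= linearP mul.
by apply: eq_fun3 => i q; rewrite /upd eq_sym; case: eqVneq => [->|].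
Qed.

Lemma lift_const m mu (x : poly3) : (forall i, scalar (mu i)) ->
  lift (m + 2%:R) (fun q => (mu (m + 2%:R) q)%:P)
    (lift (m + 1) (fun q => (mu (m + 1) q)%:P) (lift m (fun q => (mu m q)%:P) x)) =
  mpolyC 3 (fun3 mu x).
Proof.
move=> mul; have mul' i : linear (fun q => (mu i q)%:P) by exact: linear_constP.
move: x; apply: linear_tens_eq; first by move=> c u v; rewrite !linearP.
  by move=> c u v; rewrite fun3_scalar mpolyCD mpolyCM mul_mpolyC.
move=> q; rewrite fun3_tens // -tens_const !lift_tens //; congr tens; apply: funext => i.
by rewrite /upd; case: (ord3_rel m i) => ->; rewrite ?eqxx ?ord3F.
Qed.

(* [t n] is the order of the jet in direction [n], or [None] for a moment. *)
Definition dof_matches L (t : 'I_3 -> option nat) (d : dof) := forall n,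
  [/\ count_mem n d.1 = odflt 0%N (t n), (n \in unzip1 d.2) = ~~ isSome (t n) &
      t n = None -> degbound d.2 n = k%:Z - 1 - (L n)%:Z].

Definition end_of c (e : bool) n := if e then chi c n else clo c n.

Definition dof_fun c (t : 'I_3 -> option nat) (e : 'I_3 -> bool) (q : 'I_3 -> {poly R}) n f :=
  if t n is Some r then jet r (end_of c (e n) n) f else defint (clo c n) (chi c n) (f * q n).

Lemma dof_fun_scalar c t e q n : scalar (dof_fun c t e q n).
Proof.
rewrite /dof_fun; case: (t n) => [r|]; first exact: jet_scalar.
by move=> x u v; rewrite mulrDl -scalerAl defint_scalar.
Qed.

Lemma degbound_notin (b : seq ('I_3 * int)) n : n \notin unzip1 b -> degbound b n = 0.
Proof. by move=> nb; rewrite /degbound memNindex // nth_default // !size_map. Qed.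

Lemma single_valued_dof L F t d m c c' e (q : 'I_3 -> {poly R}) : dof_matches L t d -> single_valued [:: d] F ->
  adj m c c' -> isSome (t m) -> e m = true -> (forall n, (L n <= 2)%N) ->
  (forall n, t n = None -> (size (q n) <= k - L n)%N) ->
  fun3 (dof_fun c t e q) (F c) = fun3 (dof_fun c t e q) (F c').
Proof.
move=> td sv [eC sC] tm em L2 sq.
pose G : box R := Box (\row_n if t n is Some _ then end_of c (e n) n else clo c n)
  (\row_n if t n is Some _ then end_of c (e n) n else chi c n).
have inD n : (n \in unzip1 d.2) = ~~ isSome (t n) by case: (td n).
have fG : face_of (unzip1 d.2) G (cell c).
  move=> n; rewrite inD !mxE; case: (t n) => //= r.
  by split=> //; rewrite /end_of; case: (e n); [right|left].
have fG' : face_of (unzip1 d.2) G (cell c').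
  move=> n; have [nm|nm] := eqVneq n m.
    rewrite inD nm !mxE; case: (t m) tm => // r _ /=; rewrite em; split=> //.
    by left.
  have [e1 e2] := sC n nm; rewrite inD !mxE; case: (t n) => /= [r|]; last by split.
  by split=> //; rewrite /end_of -/(clo c' n) -/(chi c' n) -e1 -e2; case: (e n); [right|left].
have leG i : lo G 0 i <= hi G 0 i.
  by rewrite !mxE; case: (t i) => // ; apply: ltW; exact: clo_lt_chi.
pose q' n := if t n is Some _ then 1%:P else q n.
have qQ : Qspace d.2 (tens q').
  pose D n := if t n is Some _ then 1%N else (k - L n)%N.
  have dq : deglt D (tens q').
    by apply: deglt_tens => i; rewrite /q' /D; case et: (t i) => [r|]; rewrite ?size_poly1 // sq.
  move=> a /dq aD i; have := aD i; rewrite /D; have [_ _ dg] := td i.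
  case et: (t i) => [r|] ai; first by rewrite degbound_notin ?inD ?et //; lia.
  by rewrite dg // ; have := L2 i; lia.
have := sv d (mem_head _ _) G c c' fG fG' _ qQ; rewrite !integral_onE //.
have bs i : scalar (box_fun G i) by exact: box_fun_scalar.
have bs' i : scalar (fun f => box_fun G i (f * q' i)).
  by move=> x u v; rewrite mulrDl -scalerAl bs.
rewrite !fun3_tensM // !fun3_derivs //.
have E x : fun3 (fun i f => box_fun G i (f^`(count_mem i d.1) * q' i)) x = fun3 (dof_fun c t e q) x.
  apply: eq_fun3 => n f; have [-> _ _] := td n; rewrite /dof_fun /q' /box_fun /intf !mxE.
  case: (t n) => [r|] /=; first by rewrite eqxx mulr1.
  by rewrite lt_eqF ?clo_lt_chi.
by rewrite !E.
Qed.

(** Univariate unisolvence is applied in the two directions tangential to the face. The jet normal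
    to the face combined with univariate functionals in these directions is again a degree of
    freedom, so all such products annihilate the jump of the jet. *)
Lemma single_valued_conf L F : (forall n, (L n <= 2)%N) ->
  (forall c, deglt (fun i => (k + L i)%N) (F c)) ->
  (forall t : 'I_3 -> option nat, (forall n r, t n = Some r -> (r < L n)%N) ->
     (exists m, isSome (t m)) -> exists2 d, dof_matches L t d & single_valued [:: d] F) ->
  conf k L F.
Proof.
move=> L2 dF sv; split=> // m c c' r cc' rl.
pose Theta n := [set mu : {poly R} -> R | exists t e q,
  [/\ forall r', t = Some r' -> (r' < L n)%N, t = None -> (size (q : {poly R}) <= k - L n)%N &
      mu = if t is Some r' then jet r' (end_of c e n)
           else fun f => defint (clo c n) (chi c n) (f * q)]].
have Tlin n mu : Theta n mu -> scalar mu.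
  move=> [[r'|] [e [q [_ _ ->]]]]; first exact: jet_scalar.
  by move=> x u v; rewrite mulrDl -scalerAl defint_scalar.
have Tsep n (f : {poly R}) : (size f <= k + L n)%N -> (forall mu, Theta n mu -> mu f = 0) -> f = 0.
  move=> sf h; apply: (unisolvence1 k2 (L2 n) (clo_lt_chi c n) sf).
    by move=> r' r'l; split; apply: h; [exists (Some r'), false, 0|exists (Some r'), true, 0]; split=> // s [<-].
  by move=> q hq; apply: (h (fun f => defint (clo c n) (chi c n) (f * q))); exists None, true, q; split.
have dconst n mu (x : poly3) : deglt (fun i => (k + L i)%N) x ->
    deglt (fun i => (k + L i)%N) (lift n (fun f => (mu f : R)%:P) x).
  by apply: deglt_lift_same => f _; rewrite (leq_trans (size_polyC_leq1 _)) //; lia.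
apply/eqP; rewrite -subr_eq0 -linearB; apply/eqP; set J := F c - F c'.
have dJ : deglt (fun i => (k + L i)%N) J by exact: degltB.
have [n1 n2 n3] := ord3_neq m; have nn : m + 2%:R != m + 1 by rewrite eq_sym.
apply: (@lift_separate _ (m + 1) (fun i => (k + L i)%N) _ (Theta (m + 1))) => //; first exact: Tlin.
- exact: Tsep.
- exact: dconst.
move=> mu1 T1; apply: (@lift_separate _ (m + 2%:R) (fun i => (k + L i)%N) _ (Theta (m + 2%:R))) => //.
- exact: Tlin.
- exact: Tsep.
- by apply: (dconst); exact: (dconst).
move=> mu2 T2; case: T1 => t1 [e1 [q1 [h1 h1' E1]]]; case: T2 => t2 [e2 [q2 [h2 h2' E2]]].
pose t n := if n == m then Some r else if n == m + 1 then t1 else t2.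
pose e n := if n == m then true else if n == m + 1 then e1 else e2.
pose q n := if n == m + 1 then q1 else q2.
have [|| d td svd] := sv t.
- move=> n r'; rewrite /t; case: (ord3_rel m n) => ->; rewrite ?eqxx ?ord3F.
  + by move=> [<-].
  + exact: h1.
  + exact: h2.
- by exists m; rewrite /t eqxx.
have mueq : [/\ dof_fun c t e q m = jet r (chi c m), dof_fun c t e q (m + 1) = mu1 &
    dof_fun c t e q (m + 2%:R) = mu2].
  rewrite E1 E2 /dof_fun /t /e /q !eqxx (negbTE n1) (negbTE n2) (negbTE nn).
  by split; apply: funext => f //; [case: (t1)|case: (t2)].
have := lift_const m J (dof_fun_scalar c t e q); case: mueq => -> -> -> => ->.
rewrite /J fun3B (single_valued_dof (e := e) (q := q) td svd cc') ?subrr ?mpolyC0 ?/t ?/e ?eqxx //.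
move=> n; rewrite /q; case: (ord3_rel m n) => ->; rewrite ?eqxx ?ord3F //.
Qed.
End DegreesOfFreedom.

(** * The four finite element spaces as spline spaces *)

Section SpaceCharacterizations.
Variables (R : realType) (M : mesh R) (k : nat).
Hypothesis k2 : (2 <= k)%N.
Local Notation poly3 := (mpoly 3 R).
Local Notation cells := 'I_(ncells M).
Implicit Types (c : cells) (m n i j l : 'I_3) (L : 'I_3 -> nat) (F : cells -> poly3).

Lemma Qspace_deglt (b : seq ('I_3 * int)) (D : 'I_3 -> nat) (p : poly3) :
  (forall n, degbound b n = (D n)%:Z - 1) -> Qspace b p <-> deglt D p.
Proof.
move=> bD; split=> h a ap i; have := h a ap i; rewrite bD; lia.
Qed.

Lemma uniq3P i j l : uniq [:: i; j; l] -> [/\ i != j, i != l & j != l].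
Proof. by rewrite /= !inE negb_or andbT => /andP[/andP[]]. Qed.

Lemma uniq3_cases i j l n : uniq [:: i; j; l] -> [\/ n = i, n = j | n = l].
Proof.
move=> u; have : n \in [:: i; j; l].
  by move: u; case: (ord3P i) => ->; case: (ord3P j) => ->; case: (ord3P l) => -> //;
    case: (ord3P n) => ->.
by rewrite !inE => /or3P[] /eqP->; [constructor 1|constructor 2|constructor 3].
Qed.

Lemma uniq3_perm i j l : uniq [:: i; j; l] -> uniq [:: i; l; j].
Proof. by rewrite /= !inE [j == l]eq_sym orbC. Qed.

Lemma third i j : i != j -> exists l, uniq [:: i; j; l].
Proof.
move=> ij; have [|l] := @proper_dim [:: i; j]; first by [].
by exists l; rewrite /= !inE in p *; rewrite negb_or ij /= andbT; move: p; rewrite negb_or ![l == _]eq_sym.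
Qed.

(** The entry that a list of degrees of freedom has to contain for the pattern [t]. The order of the
    axes is a parameter because membership in a list compares the axes literally. *)
Definition dof_of (o : seq 'I_3) (beta : 'I_3 -> int) (t : 'I_3 -> option nat) : dof :=
  ([seq n <- o | t n == Some 1%N], [seq (n, beta n) | n <- o & t n == None]).

Lemma dof_of_matches L o beta t : uniq o -> (forall n, n \in o) ->
  (forall n, beta n = k%:Z - 1 - (L n)%:Z) -> (forall n r, t n = Some r -> (r <= 1)%N) ->
  dof_matches k L t (dof_of o beta t).
Proof.
move=> u oT bL t1 n.
have u1 : unzip1 (dof_of o beta t).2 = [seq n <- o | t n == None].
  by rewrite /dof_of /unzip1 -map_comp map_id.
split.
- rewrite /dof_of count_uniq_mem ?filter_uniq // mem_filter oT andbT.
  case tn: (t n) => [r|] //=; have := t1 n r tn; case: r tn => [|[|r]] //.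
- by rewrite u1 mem_filter oT andbT; case: (t n).
- move=> tn; rewrite /degbound u1 -bL.
  have nin : n \in [seq n <- o | t n == None] by rewrite mem_filter oT tn.
  by rewrite /dof_of /unzip2 -map_comp (nth_map n) ?index_mem // nth_index.
Qed.

Lemma mem_uniq3 i j l n : uniq [:: i; j; l] -> n \in [:: i; j; l].
Proof. by move=> u; rewrite !inE; case: (uniq3_cases n u) => ->; rewrite eqxx ?orbT. Qed.

Lemma single_valued_sub (ds : seq dof) d F : d \in ds -> single_valued ds F -> single_valued [:: d] F.
Proof. by move=> dds h e; rewrite inE => /eqP->; exact: h. Qed.

(* [bi], [bj], [bl] are the moment degrees; the order [i; l; j] serves the
   degrees of freedom in which [j] and [l] play symmetric roles. *)
Definition covers i j l (Li Lj Ll : nat) (bi bj bl : int) (ds : seq dof) :=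
  forall (beta : 'I_3 -> int) (t : 'I_3 -> option nat),
  (forall r, t i = Some r -> (r < Li)%N) -> (forall r, t j = Some r -> (r < Lj)%N) ->
  (forall r, t l = Some r -> (r < Ll)%N) -> [|| isSome (t i), isSome (t j) | isSome (t l)] ->
  beta i = bi -> beta j = bj -> beta l = bl ->
  exists2 o, o \in [:: [:: i; j; l]; [:: i; l; j]] & dof_of o beta t \in ds.

Lemma conf_of_dofs L i j l F (ds : seq dof) (Li Lj Ll : nat) (bi bj bl : int) :
  uniq [:: i; j; l] -> [/\ L i = Li, L j = Lj & L l = Ll] -> (maxn Li (maxn Lj Ll) <= 2)%N ->
  [/\ bi = k%:Z - 1 - Li%:Z, bj = k%:Z - 1 - Lj%:Z & bl = k%:Z - 1 - Ll%:Z] ->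
  covers i j l Li Lj Ll bi bj bl ds ->
  (forall c, deglt (fun n => (k + L n)%N) (F c)) -> single_valued ds F -> conf k L F.
Proof.
move=> u [Ei Ej El] L2 [Bi Bj Bl] cov dF sv; have L2' n : (L n <= 2)%N.
  by move: L2; rewrite !geq_max => /andP[h1 /andP[h2 h3]]; case: (uniq3_cases n u) => ->; rewrite ?Ei ?Ej ?El.
apply: single_valued_conf => // t ht [m tm].
pose beta n := k%:Z - 1 - (L n)%:Z.
subst bi bj bl; have [|||||||w win wd] := cov beta t; rewrite /beta ?Ei ?Ej ?El //.
- by move=> r /ht; rewrite Ei.
- by move=> r /ht; rewrite Ej.
- by move=> r /ht; rewrite El.
- by case: (uniq3_cases m u) tm => -> ->; rewrite ?orbT.
exists (dof_of w beta t); last exact: single_valued_sub wd sv.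
have t1 n r : t n = Some r -> (r <= 1)%N by move=> /ht; have := L2' n; lia.
have u' := uniq3_perm u.
by move: win; rewrite !inE => /orP[] /eqP->; apply: dof_of_matches => // n; exact: mem_uniq3.
Qed.

Definition dof_okb L i j l (d : dof) :=
  all (fun m => (m \in unzip1 d.2) || (count_mem m d.1 < L m)%N) [:: i; j; l].

Lemma dof_okP L i j l ds : uniq [:: i; j; l] -> all (dof_okb L i j l) ds ->
  forall d, d \in ds -> dof_ok L d.
Proof.
move=> u /allP h d /h /allP hd m mD; have /hd : m \in [:: i; j; l].
  by rewrite !inE; case: (uniq3_cases m u) => ->; rewrite eqxx ?orbT.
by rewrite (negbTE mD).
Qed.

Ltac case3 i j l u := move: u; case: (ord3P i) => ->; case: (ord3P j) => ->; case: (ord3P l) => -> //= _.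

Lemma X_dofs_ok i j l : uniq [:: i; j; l] -> all (dof_okb (lvX i) i j l) (X_dofs k i j l).
Proof. by move=> u; case3 i j l u. Qed.

Lemma Phi_diag_dofs_ok i j l : uniq [:: i; j; l] ->
  all (dof_okb (lvPhi i i) i j l) (Phi_diag_dofs k i j l).
Proof. by move=> u; case3 i j l u. Qed.

Lemma Phi_offdiag_dofs_ok i j l : uniq [:: i; j; l] ->
  all (dof_okb (lvPhi i j) i j l) (Phi_offdiag_dofs k i j l).
Proof. by move=> u; case3 i j l u. Qed.

Lemma Gamma_diag_dofs_ok i j l : uniq [:: i; j; l] ->
  all (dof_okb (lvGamma i i) i j l) (Gamma_diag_dofs k i j l).
Proof. by move=> u; case3 i j l u. Qed.

Lemma Gamma_offdiag_dofs_ok i j l : uniq [:: i; j; l] ->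
  all (dof_okb (lvGamma i j) i j l) (Gamma_offdiag_dofs k i j l).
Proof. by move=> u; case3 i j l u. Qed.

Lemma Z_dofs_ok i j l : uniq [:: i; j; l] -> all (dof_okb (lvZ i) i j l) (Z_dofs k i j l).
Proof. by move=> u; case3 i j l u. Qed.

Lemma degbound3 i j l (a b c : int) n : uniq [:: i; j; l] ->
  degbound [:: (i, a); (j, b); (l, c)] n = if n == i then a else if n == j then b else c.
Proof.
move=> u; have [ij il jl] := uniq3P u; rewrite /degbound /=.
by case: (uniq3_cases n u) => ->; rewrite ?eqxx ?(negbTE ij) ?(negbTE il) ?(negbTE jl) //
  ?[j == i]eq_sym ?(negbTE ij) ?[l == i]eq_sym ?(negbTE il) ?[l == j]eq_sym ?(negbTE jl) ?eqxx.
Qed.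

Lemma QspaceE L i j l (Li Lj Ll : nat) (a b d : int) (p : poly3) : uniq [:: i; j; l] ->
  [/\ L i = Li, L j = Lj & L l = Ll] ->
  [/\ a = (k + Li)%:Z - 1, b = (k + Lj)%:Z - 1 & d = (k + Ll)%:Z - 1] ->
  Qspace [:: (i, a); (j, b); (l, d)] p <-> deglt (fun n => (k + L n)%N) p.
Proof.
move=> u [<- <- <-] [ea eb ed]; apply: Qspace_deglt => n; rewrite degbound3 //.
have [ij il jl] := uniq3P u.
by case: (uniq3_cases n u) => ->; rewrite ?eqxx ?[j == i]eq_sym ?(negbTE ij) ?[l == i]eq_sym
  ?(negbTE il) ?[l == j]eq_sym ?(negbTE jl).
Qed.

Lemma conf_of_space L i j l F (ds : seq dof) (Li Lj Ll : nat) (a b d bi bj bl : int) :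
  (forall c, Qspace [:: (i, a); (j, b); (l, d)] (F c)) -> single_valued ds F ->
  uniq [:: i; j; l] -> [/\ L i = Li, L j = Lj & L l = Ll] -> covers i j l Li Lj Ll bi bj bl ds ->
  (maxn Li (maxn Lj Ll) <= 2)%N ->
  [/\ bi = k%:Z - 1 - Li%:Z, bj = k%:Z - 1 - Lj%:Z & bl = k%:Z - 1 - Ll%:Z] ->
  [/\ a = (k + Li)%:Z - 1, b = (k + Lj)%:Z - 1 & d = (k + Ll)%:Z - 1] -> conf k L F.
Proof.
move=> QF sv u lv cov L2 eb ea; apply: (conf_of_dofs u lv L2 eb cov _ sv) => c.
exact: (proj1 (QspaceE (F c) u lv ea) (QF c)).
Qed.

Lemma space_of_conf L i j l F (Li Lj Ll : nat) (a b d : int) c : conf k L F ->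
  uniq [:: i; j; l] -> [/\ L i = Li, L j = Lj & L l = Ll] ->
  [/\ a = (k + Li)%:Z - 1, b = (k + Lj)%:Z - 1 & d = (k + Ll)%:Z - 1] ->
  Qspace [:: (i, a); (j, b); (l, d)] (F c).
Proof. by move=> [dF _] u lv ea; exact: (proj2 (QspaceE (F c) u lv ea) (dF c)). Qed.

Ltac refute h := try (by exfalso; have := h _ erefl).

(** Goes through the patterns with a moment or a jet of order 0 or 1 in each direction. The levels
    exclude some of them, the hypothesis on jets excludes the pattern with three moments, and the
    others are looked up in the list. *)
Ltac cover_dofs i j l :=
  let t := fresh "t" in let hi := fresh in let hj := fresh in let hl := fresh in
  let hm := fresh in let bi := fresh in let bj := fresh in let bl := fresh in
  let ti := fresh "ti" in let tj := fresh "tj" in let tl := fresh "tl" in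
  move=> ? t hi hj hl hm bi bj bl;
  case ti: (t i) hi => [[|[|?]]|] hi; refute hi;
  case tj: (t j) hj => [[|[|?]]|] hj; refute hj;
  case tl: (t l) hl => [[|[|?]]|] hl; refute hl;
  first [ by exfalso; move: hm; rewrite ti tj tl
        | exists [:: i; j; l]; [exact: mem_head
            |rewrite /dof_of /= ti tj tl /= ?bi ?bj ?bl; by rewrite !inE eqxx ?orbT]
        | exists [:: i; l; j]; [by rewrite inE mem_head orbT
            |rewrite /dof_of /= ti tj tl /= ?bi ?bj ?bl; by rewrite !inE eqxx ?orbT]
        ].

Lemma X_cover i j l : covers i j l 1 2 2 (k%:Z - 2) (k%:Z - 3) (k%:Z - 3)
  (X_dofs k i j l ++ X_dofs k i l j).
Proof. cover_dofs i j l. Qed.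

Lemma Phi_diag_cover i j l : covers i j l 0 2 2 (k%:Z - 1) (k%:Z - 3) (k%:Z - 3)
  (Phi_diag_dofs k i j l ++ Phi_diag_dofs k i l j).
Proof. cover_dofs i j l. Qed.

Lemma Phi_offdiag_cover i j l : covers i j l 1 1 2 (k%:Z - 2) (k%:Z - 2) (k%:Z - 3)
  (Phi_offdiag_dofs k i j l).
Proof. cover_dofs i j l. Qed.

Lemma Gamma_diag_cover i j l : covers i j l 2 0 0 (k%:Z - 3) (k%:Z - 1) (k%:Z - 1)
  (Gamma_diag_dofs k i j l).
Proof. cover_dofs i j l. Qed.

Lemma Gamma_offdiag_cover i j l : covers i j l 1 1 0 (k%:Z - 2) (k%:Z - 2) (k%:Z - 1)
  (Gamma_offdiag_dofs k i j l).
Proof. cover_dofs i j l. Qed.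

Lemma Z_cover i j l : covers i j l 1 0 0 (k%:Z - 2) (k%:Z - 1) (k%:Z - 1) (Z_dofs k i j l).
Proof. cover_dofs i j l. Qed.

Lemma single_valued_cat (d1 d2 : seq dof) F : single_valued d1 F -> single_valued d2 F ->
  single_valued (d1 ++ d2) F.
Proof. by move=> h1 h2 d; rewrite mem_cat => /orP[/h1|/h2]. Qed.

Lemma lvX3 i j l : uniq [:: i; j; l] -> [/\ lvX i i = 1%N, lvX i j = 2%N & lvX i l = 2%N].
Proof. by move=> u; case3 i j l u. Qed.

Lemma lvPhi_diag3 i j l : uniq [:: i; j; l] ->
  [/\ lvPhi i i i = 0%N, lvPhi i i j = 2%N & lvPhi i i l = 2%N].
Proof. by move=> u; case3 i j l u. Qed.

Lemma lvPhi_offdiag3 i j l : uniq [:: i; j; l] ->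
  [/\ lvPhi i j i = 1%N, lvPhi i j j = 1%N & lvPhi i j l = 2%N].
Proof. by move=> u; case3 i j l u. Qed.

Lemma lvGamma_diag3 i j l : uniq [:: i; j; l] ->
  [/\ lvGamma i i i = 2%N, lvGamma i i j = 0%N & lvGamma i i l = 0%N].
Proof. by move=> u; case3 i j l u. Qed.

Lemma lvGamma_offdiag3 i j l : uniq [:: i; j; l] ->
  [/\ lvGamma i j i = 1%N, lvGamma i j j = 1%N & lvGamma i j l = 0%N].
Proof. by move=> u; case3 i j l u. Qed.

Lemma lvZ3 i j l : uniq [:: i; j; l] -> [/\ lvZ i i = 1%N, lvZ i j = 0%N & lvZ i l = 0%N].
Proof. by move=> u; case3 i j l u. Qed.

Lemma uniq_succ i : uniq [:: i; i + 1; i + 2%:R].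
Proof. by case: (ord3P i) => ->. Qed.

Lemma XhP (u : vfield M) : star_connected M ->
  Xh M k u <-> forall i, conf k (lvX i) (fun c => u c 0 i).
Proof.
move=> sc; split=> [hu i|cu i j l uq].
  (* The list is not symmetric in its last two indices; the conditions for both orders together
     cover all patterns. *)
  have uq := uniq_succ i; have [d1 s1] := hu _ _ _ uq; have [_ s2] := hu _ _ _ (uniq3_perm uq).
  by apply: conf_of_space d1 (single_valued_cat s1 s2) uq (lvX3 uq) (@X_cover _ _ _) _ _ _ => //; split; lia.
split=> [c|]; first by apply: space_of_conf (cu i) uq (lvX3 uq) _; split; lia.
by apply: (conf_single_valued sc (cu i)); exact: (dof_okP uq (X_dofs_ok uq)).
Qed.

Lemma ZhP (q : vfield M) : star_connected M ->
  Zh M k q <-> forall i, conf k (lvZ i) (fun c => q c 0 i).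
Proof.
move=> sc; split=> [hu i|cu i j l uq].
  have uq := uniq_succ i; have [d1 s1] := hu _ _ _ uq.
  by apply: conf_of_space d1 s1 uq (lvZ3 uq) (@Z_cover _ _ _) _ _ _ => //; split; lia.
split=> [c|]; first by apply: space_of_conf (cu i) uq (lvZ3 uq) _; split; lia.
by apply: (conf_single_valued sc (cu i)); exact: (dof_okP uq (Z_dofs_ok uq)).
Qed.

Lemma sym_pairs (s : mfield M) (L : 'I_3 -> 'I_3 -> 'I_3 -> nat) : (forall c, (s c)^T = s c) ->
  (forall i j n, L i j n = L j i n) -> (forall i, conf k (L i i) (fun c => s c i i)) ->
  (forall i j l, (i < j)%N -> uniq [:: i; j; l] -> conf k (L i j) (fun c => s c i j)) ->
  forall i j, conf k (L i j) (fun c => s c i j).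
Proof.
move=> ss Ls cd co i j; wlog ij : i j / (i <= j)%N.
  move=> h; case: (leqP i j) => [|/ltnW ji]; first exact: h.
  have -> : (fun c => s c i j) = (fun c => s c j i) by apply: funext => c; rewrite -{1}ss mxE.
  by apply: eq_conf (h j i ji) => n; rewrite Ls.
have [->//|ne] := eqVneq i j; have [l uq] := third ne; apply: (co i j l) => //.
by rewrite ltn_neqAle ij andbT.
Qed.

Lemma PhihP (s : mfield M) : star_connected M -> Phih M k s <->
  (forall c, (s c)^T = s c) /\ (forall i j, conf k (lvPhi i j) (fun c => s c i j)).
Proof.
move=> sc; split=> [[ss hs]|[ss cs]]; (split; first exact: ss).
  apply: sym_pairs => [//|i j n|i|i j l ij uq]; first by rewrite /lvPhi; lia.
    have uq := uniq_succ i; have [d1 s1 _ _] := hs _ _ _ uq; have [_ s2 _ _] := hs _ _ _ (uniq3_perm uq).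
    by apply: conf_of_space d1 (single_valued_cat s1 s2) uq (lvPhi_diag3 uq) (@Phi_diag_cover _ _ _) _ _ _ => //;
      split; lia.
  have [_ _ d1 /(_ ij) s1] := hs _ _ _ uq.
  by apply: conf_of_space d1 s1 uq (lvPhi_offdiag3 uq) (@Phi_offdiag_cover _ _ _) _ _ _ => //; split; lia.
move=> i j l uq; split=> [c||c|_].
- by apply: space_of_conf (cs i i) uq (lvPhi_diag3 uq) _; split; lia.
- by apply: (conf_single_valued sc (cs i i)); exact: (dof_okP uq (Phi_diag_dofs_ok uq)).
- by apply: space_of_conf (cs i j) uq (lvPhi_offdiag3 uq) _; split; lia.
by apply: (conf_single_valued sc (cs i j)); exact: (dof_okP uq (Phi_offdiag_dofs_ok uq)).
Qed.

Lemma GammahP (s : mfield M) : star_connected M -> Gammah M k s <->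
  (forall c, (s c)^T = s c) /\ (forall i j, conf k (lvGamma i j) (fun c => s c i j)).
Proof.
move=> sc; split=> [[ss hs]|[ss cs]]; (split; first exact: ss).
  apply: sym_pairs => [//|i j n|i|i j l ij uq]; first by rewrite /lvGamma addnC.
    have uq := uniq_succ i; have [d1 s1 _ _] := hs _ _ _ uq.
    by apply: conf_of_space d1 s1 uq (lvGamma_diag3 uq) (@Gamma_diag_cover _ _ _) _ _ _ => //; split; lia.
  have [_ _ d1 /(_ ij) s1] := hs _ _ _ uq.
  by apply: conf_of_space d1 s1 uq (lvGamma_offdiag3 uq) (@Gamma_offdiag_cover _ _ _) _ _ _ => //; split; lia.
move=> i j l uq; split=> [c||c|_].
- by apply: space_of_conf (cs i i) uq (lvGamma_diag3 uq) _; split; lia.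
- by apply: (conf_single_valued sc (cs i i)); exact: (dof_okP uq (Gamma_diag_dofs_ok uq)).
- by apply: space_of_conf (cs i j) uq (lvGamma_offdiag3 uq) _; split; lia.
by apply: (conf_single_valued sc (cs i j)); exact: (dof_okP uq (Gamma_offdiag_dofs_ok uq)).
Qed.
End SpaceCharacterizations.

(** * The elasticity complex modulo the topology of the mesh *)

Section Complex.
Variables (R : realType) (M : mesh R) (k : nat).
Hypothesis k2 : (2 <= k)%N.
Local Notation poly3 := (mpoly 3 R).
Local Notation cells := 'I_(ncells M).
Implicit Types (c : cells) (m n i j l : 'I_3).

Definition mesh_connected := forall c c' : cells,
  connect (fun c1 c2 => `[< exists m, adj m c1 c2 \/ adj m c2 c1 >]) c c'.

Lemma rigid_motion_coef (a b : 'rV[R]_3) i : rigid_motion a b 0 i =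
  mpolyC 3 (a 0 i) + (mpolyC 3 (b 0 (i + 1)) * Xvar R (i + 2%:R) -
                      mpolyC 3 (b 0 (i + 2%:R)) * Xvar R (i + 1)).
Proof. by rewrite !mxE. Qed.

Lemma mderiv_Xvar m n : mderiv m (Xvar R n) = mpolyC 3 (m == n)%:R.
Proof.
rewrite mderivX mnm1E eq_sym; case: eqVneq => [->|]; last by rewrite scale0r.
rewrite scale1r (_ : mnm_sub _ _ = @mnm0 3) ?mpolyX0 ?mpolyC1 //.
by apply/mnmP => i; rewrite mnmBE subnn mnm0E.
Qed.

Lemma deglt_Xvar (d : 'I_3 -> nat) n : (1 < d n)%N -> (forall i, (0 < d i)%N) -> deglt d (Xvar R n).
Proof.
move=> dn d0 a; rewrite msuppX inE => /eqP-> i; rewrite mnm1E.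
by case: eqVneq => [<-|].
Qed.

Lemma deglt_mpolyC (d : 'I_3 -> nat) (x : R) : (forall i, (0 < d i)%N) -> deglt d (mpolyC 3 x).
Proof. by move=> d0 a; rewrite msuppC; case: ifP => // _; rewrite inE => /eqP-> i; rewrite mnm0E. Qed.

Lemma deglt_rigid_motion (a b : 'rV[R]_3) i :
  deglt (fun n => (k + lvX i n)%N) (rigid_motion a b 0 i).
Proof.
have d0 n : (0 < k + lvX i n)%N by lia.
rewrite rigid_motion_coef !mul_mpolyC; apply: degltD; first exact: deglt_mpolyC.
by apply: degltB; apply: degltZ; apply: deglt_Xvar => //; rewrite /lvX ?ord3F; lia.
Qed.

Lemma mderiv_rigid_motion (a b : 'rV[R]_3) i n : mderiv n (rigid_motion a b 0 i) =
  mpolyC 3 (b 0 (i + 1) * (n == i + 2%:R)%:R - b 0 (i + 2%:R) * (n == i + 1)%:R).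
Proof.
rewrite rigid_motion_coef mderivD mderivC add0r mderivB !mul_mpolyC !mderivZ !mderiv_Xvar.
by rewrite mpolyCB !mpolyCM !mul_mpolyC.
Qed.

Lemma sym_grad_eq0 (u : 'rV[poly3]_3) : sym (grad u) = 0 <->
  forall i j, mderiv j (u 0 i) + mderiv i (u 0 j) = 0.
Proof.
split=> [h i j|h]; last first.
  by apply/matrixP => i j; rewrite sym_coef ![grad _ _ _]mxE h scaler0 mxE.
have := congr1 (fun s : 'M[poly3]_3 => s i j) h; rewrite sym_coef ![grad _ _ _]mxE [RHS]mxE.
by move/eqP; rewrite scaler_eq0 invr_eq0 pnatr_eq0 /= => /eqP.
Qed.

Lemma sym_grad_rigid_motion (a b : 'rV[R]_3) : sym (grad (rigid_motion a b)) = 0.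
Proof.
apply/sym_grad_eq0 => i j; rewrite !mderiv_rigid_motion -mpolyCD.
rewrite (_ : _ + _ = 0 :> R) ?mpolyC0 //.
case: (ord3_rel i j) => ->; rewrite ?ord3A ?eqxx ?ord3F /=; ring.
Qed.

(** Second derivatives are symmetric in the two differentiations and, for a vanishing symmetric
    gradient, antisymmetric when the component is exchanged with one of them. Rotating the three
    indices gives each one as its own negative. *)
Lemma sym_grad0_const (u : 'rV[poly3]_3) : sym (grad u) = 0 ->
  forall i n, mderiv n (u 0 i) = mpolyC 3 (mcoeff (@mnm0 3) (mderiv n (u 0 i))).
Proof.
move/sym_grad_eq0 => h i b; apply: const_mderiv => a.
have sw x y : mderiv y (u 0 x) = - mderiv x (u 0 y) by apply/eqP; rewrite -addr_eq0 h.
have e : mderiv a (mderiv b (u 0 i)) = - mderiv a (mderiv b (u 0 i)).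
  rewrite [in LHS](sw i b) mderivN (mderiv_comm i a) [in LHS](sw b a) mderivN opprK.
  by rewrite (mderiv_comm b i) [in LHS](sw a i) mderivN (mderiv_comm a b).
apply/eqP; have /eqP : mderiv a (mderiv b (u 0 i)) *+ 2 = 0 by rewrite mulr2n {1}e addNr.
by rewrite -scaler_nat scaler_eq0 pnatr_eq0.
Qed.

Lemma sym_grad0_rigid (u : 'rV[poly3]_3) : sym (grad u) = 0 -> exists a b, u = rigid_motion a b.
Proof.
move=> h0; have cst := sym_grad0_const h0; have /sym_grad_eq0 h := h0.
pose Mx i n := mcoeff (@mnm0 3) (mderiv n (u 0 i)).
have anti i n : Mx i n = - Mx n i.
  by rewrite /Mx -mcoeffN; congr (mcoeff _ _); apply/eqP; rewrite -addr_eq0 h.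
have M0 i : Mx i i = 0 by have := anti i i; lra.
pose b : 'rV[R]_3 := \row_m Mx (m + 2%:R) (m + 1).
pose a : 'rV[R]_3 := \row_i mcoeff (@mnm0 3) (u 0 i - rigid_motion 0 b 0 i).
exists a, b; apply/rowP => i.
have -> : rigid_motion a b 0 i = mpolyC 3 (a 0 i) + rigid_motion 0 b 0 i.
  have z : (0 : 'rV[R]_3) 0 i = 0 by rewrite mxE.
  by rewrite !rigid_motion_coef z mpolyC0 add0r.
rewrite {1}mxE -const_mderiv ?subrK // => n.
rewrite mderivB mderiv_rigid_motion cst -mpolyCB -/(Mx i n) !mxE.
rewrite !ord3A (_ : _ - _ = 0 :> R) ?mpolyC0 //.
by case: (ord3_rel i n) => ->; rewrite ?eqxx ?ord3F ?M0 ?(anti (i + 1) i) /=; ring.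
Qed.

(** The difference of the gradients is a constant skew matrix. Its columns for directions tangential
    to the face vanish because the traces agree, and skewness kills the remaining column. What is
    left is a constant with zero trace. *)
Lemma rigid_glue (u : vfield M) : (forall i, conf k (lvX i) (fun c => u c 0 i)) ->
  (forall c, sym (grad (u c)) = 0) -> forall m c c', adj m c c' -> u c = u c'.
Proof.
move=> cu h0 m c c' cc'.
have c0 n i : mderiv n (u c 0 i) - mderiv n (u c' 0 i) =
    mpolyC 3 (mcoeff (@mnm0 3) (mderiv n (u c 0 i)) - mcoeff (@mnm0 3) (mderiv n (u c' 0 i))).
  by rewrite mpolyCB -(sym_grad0_const (h0 c)) -(sym_grad0_const (h0 c')).
have t0 i : trace 0 m (chi c m) (u c 0 i) = trace 0 m (chi c m) (u c' 0 i).
  by apply: (cu i).2 => //; rewrite /lvX; lia.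
have d1 n i : n != m -> mderiv n (u c 0 i) - mderiv n (u c' 0 i) = 0.
  move=> nm; have := congr1 (trace 0 m (chi c m)) (c0 n i).
  rewrite trace_mpolyC linearB /= !trace_mderiv_comm 1?eq_sym // t0 subrr c0 => <-//.
have d2 n i : mderiv n (u c 0 i) - mderiv n (u c' 0 i) = 0.
  have [->|nm] := eqVneq n m; last exact: d1.
  have sw t x y : mderiv y (u t 0 x) = - mderiv x (u t 0 y).
    by apply/eqP; rewrite -addr_eq0; have /sym_grad_eq0 -> := h0 t.
  have [->|im] := eqVneq i m; last by rewrite !(sw _ i m) -opprD d1 ?oppr0.
  have z t : mderiv m (u t 0 m) = 0.
    apply/eqP; have /eqP : mderiv m (u t 0 m) *+ 2 = 0 by rewrite mulr2n {1}(sw t m m) addNr.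
    by rewrite -scaler_nat scaler_eq0 pnatr_eq0.
  by rewrite !z subrr.
apply/rowP => i; apply/eqP; rewrite -subr_eq0; apply/eqP.
have e : u c 0 i - u c' 0 i = mpolyC 3 (mcoeff (@mnm0 3) (u c 0 i - u c' 0 i)).
  by apply: const_mderiv => n; rewrite mderivB d2.
have := congr1 (trace 0 m (chi c m)) e; rewrite trace_mpolyC -e => <-.
by rewrite linearB /= t0 subrr.
Qed.

Lemma curlT_sym_grad (u : 'rV[poly3]_3) i j : curlT (sym (grad u)) i j =
  mderiv j ((2^-1 : R) *: (mderiv (i + 1) (u 0 (i + 2%:R)) - mderiv (i + 2%:R) (u 0 (i + 1)))).
Proof.
have gE a b : grad u a b = mderiv b (u 0 a) by rewrite mxE.
rewrite curlT_coef !sym_coef !gE !mderivZ -scalerBr; congr (_ *: _).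
rewrite mderivB [X in X - _]mderivD [X in _ - X]mderivD.
rewrite (mderiv_comm j (i + 1)) (mderiv_comm j (i + 2%:R)) (mderiv_comm (i + 2%:R) (i + 1)).
by rewrite opprD addrACA subrr addr0.
Qed.

Lemma curl_curlT_sym_grad (u : 'rV[poly3]_3) : curl (curlT (sym (grad u))) = 0.
Proof.
by apply/matrixP => i m; rewrite curl_coef !curlT_sym_grad curl_gradient0 mxE.
Qed.

Lemma div_curl (s : 'M[poly3]_3) : div (curl s) = 0.
Proof.
apply/rowP => i; rewrite !mxE (sum3 _ 0) !curl_coef !mderivB.
rewrite !ord3A.
rewrite (mderiv_comm 0 (0 + 1)) (mderiv_comm 0 (0 + 2%:R)) (mderiv_comm (0 + 1) (0 + 2%:R)).
by rewrite !addrA [LHS](ACl (1*4*(2*5)*(3*6))) /= !subrr !addNr !addr0.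
Qed.

Theorem elasticity_complex_exact : star_connected M -> mesh_connected ->
  jumps_removable M -> closed_coboundary M ->
  [/\ RM M `<=` Xh M k, (@sym_grad R M) @` Xh M k `<=` Phih M k,
      (@curl_curlT R M) @` Phih M k `<=` Gammah M k
    & (@divh R M) @` Gammah M k `<=` Zh M k] /\
  [/\ Xh M k `&` [set u : vfield M | sym_grad u = 0] = RM M,
      Phih M k `&` [set s : mfield M | curl_curlT s = 0] = (@sym_grad R M) @` Xh M k,
      Gammah M k `&` [set s : mfield M | divh s = 0] = (@curl_curlT R M) @` Phih M k
    & (@divh R M) @` Gammah M k = Zh M k].
Proof.
move=> sc mc jr cc.
have XP u := @XhP R M k k2 u sc; have PP s := @PhihP R M k k2 s sc.
have GP s := @GammahP R M k k2 s sc; have ZP q := @ZhP R M k k2 q sc.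
have sgE (u : vfield M) c : sym_grad u c = sym (grad (u c)) by rewrite ffunE.
have ccE (s : mfield M) c : curl_curlT s c = curl (curlT (s c)) by rewrite ffunE.
have dvE (s : mfield M) c : divh s c = div (s c) by rewrite ffunE.
have RX : RM M `<=` Xh M k.
  move=> u [a [b uab]]; apply/XP => i; split=> [c|m c c' r _ _]; rewrite ?uab //.
  exact: deglt_rigid_motion.
have XPhi : (@sym_grad R M) @` Xh M k `<=` Phih M k.
  move=> _ [u /XP cu <-]; apply/PP; split=> [c|i j].
    by rewrite sgE; apply/matrixP => i j; rewrite mxE !sym_coef addrC.
  rewrite (_ : (fun c => _) = (fun c => sym (grad (u c)) i j)); last by apply: funext => c; rewrite sgE.
  exact: conf_sym_grad.
have PhiG : (@curl_curlT R M) @` Phih M k `<=` Gammah M k.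
  move=> _ [s /PP[ss cs] <-]; apply/GP; split=> [c|i j].
    by rewrite ccE curl_curlT_sym.
  rewrite (_ : (fun c => _) = (fun c => curl (curlT (s c)) i j)); last by apply: funext => c; rewrite ccE.
  exact: conf_curl_curlT.
have GZ : (@divh R M) @` Gammah M k `<=` Zh M k.
  move=> _ [s /GP[ss cs] <-]; apply/ZP => i.
  rewrite (_ : (fun c => _) = (fun c => div (s c) 0 i)); last by apply: funext => c; rewrite dvE.
  exact: conf_div.
split; split=> //.
- apply/seteqP; split=> [u [/XP cu u0]|u uRM]; last first.
    split; first exact: RX.
    by case: uRM => a [b uab]; apply/ffunP => c; rewrite sgE uab sym_grad_rigid_motion ffunE.
  have h0 c : sym (grad (u c)) = 0 by rewrite -sgE u0 ffunE.
  have ue c c' : u c = u c'.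
    apply: (@connect_eq _ _ _ (fun c => u c)) (mc c c') => x y /asboolP[m [a|a]].
      exact: rigid_glue a.
    by apply/esym; exact: rigid_glue a.
  case: (pickP (fun c : cells => true)) => [c _|no]; last by exists 0, 0 => c; have := no c.
  by have [a [b e]] := sym_grad0_rigid (h0 c); exists a, b => c'; rewrite -e; exact: ue.
- apply/seteqP; split=> [s [/PP[ss cs] s0]|s [u ux <-]]; last first.
    split; first by apply: XPhi; exists u.
    by apply/ffunP => c; rewrite ccE sgE curl_curlT_sym_grad ffunE.
  have [|u cu eu] := inc_free_sym_grad k2 jr ss cs.
    by move=> c; rewrite -ccE s0 ffunE.
  by exists u; [apply/XP|apply/ffunP => c; rewrite sgE eu].
- apply/seteqP; split=> [s [/GP[ss cs] s0]|s [t tp <-]]; last first.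
    split; first by apply: PhiG; exists t.
    by apply/ffunP => c; rewrite dvE ccE div_curl ffunE.
  have [|t [ts ct et]] := div_free_inc k2 cc ss cs.
    by move=> c; rewrite -dvE s0 ffunE.
  by exists t; [apply/PP|apply/ffunP => c; rewrite ccE et].
apply/seteqP; split=> // q /ZP cq.
have [s [ss cs es]] := div_onto cq.
by exists s; [apply/GP|apply/ffunP => c; rewrite dvE es].
Qed.
End Complex.

(** * Connectedness of stars *)

Section Geometry.
Variable R : realType.
Implicit Types (p q v x y : 'rV[R]_3) (e r t : R) (n m : 'I_3).

Definition cube p e : set 'rV[R]_3 := [set y | forall n, `|y 0 n - p 0 n| < e].

Lemma cube_nbhs p e : 0 < e -> nbhs p (cube p e).
Proof.
move=> e0; apply/nbhs_ballP; exists e => // y pe n.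
by case: pe => _ /(_ 0 n); rewrite /ball /= distrC.
Qed.

Lemma nbhs_cube p (A : set 'rV[R]_3) : nbhs p A -> exists2 e, 0 < e & cube p e `<=` A.
Proof.
move=> /nbhs_ballP[e e0 eA]; exists e => // y py; apply: eA; split=> // i n.
by rewrite ord1 /ball /= distrC.
Qed.

Lemma cube_center p e : 0 < e -> cube p e p.
Proof. by move=> e0 n; rewrite subrr normr0. Qed.

Lemma subset_cube p e e' : e <= e' -> cube p e `<=` cube p e'.
Proof. by move=> ee' y py n; apply: lt_le_trans (py n) ee'. Qed.

Lemma cube_segment p e x y t : cube p e x -> cube p e y -> 0 <= t <= 1 ->
  cube p e (x + t *: (y - x)).
Proof.
move=> px py /andP[]; rewrite le_eqVlt => /orP[/eqP<- _|t0 t1] n.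
  by rewrite scale0r addr0; exact: px.
have := px n; have := py n; rewrite !mxE !ltr_norml => /andP[y1 y2] /andP[x1 x2].
have := mulr_gt0 t0 (_ : 0 < e - (y 0 n - p 0 n)); have := mulr_gt0 t0 (_ : 0 < e + (y 0 n - p 0 n)).
have := mulr_ge0 (_ : 0 <= 1 - t) (_ : 0 <= e - (x 0 n - p 0 n)).
have := mulr_ge0 (_ : 0 <= 1 - t) (_ : 0 <= e + (x 0 n - p 0 n)).
move=> h1 h2 h3 h4; have := h1 _ _; have := h2 _ _; have := h3 _; have := h4 _; lra.
Qed.

Lemma seq_lower_bound (I : eqType) (s : seq I) (P : I -> R -> Prop) :
  (forall i, i \in s -> exists2 e, 0 < e & P i e) ->
  (forall i e e', 0 < e -> e <= e' -> P i e' -> P i e) ->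
  exists2 e, 0 < e & forall i, i \in s -> P i e.
Proof.
move=> + mono; elim: s => [|i s IH] ex; first by exists 1.
have [|e e0 es] := IH; first by move=> j js; apply: ex; rewrite inE js orbT.
have [e' e'0 ei] := ex i (mem_head _ _).
exists (Num.min e' e); first by rewrite lt_min e'0.
move=> j; rewrite inE => /orP[/eqP->|/es ej].
  by apply: mono ei; rewrite ?ge_min ?lexx // lt_min e'0.
by apply: mono ej; rewrite ?ge_min ?lexx ?orbT // lt_min e'0.
Qed.

Lemma fin_lower_bound (I : finType) (P : I -> R -> Prop) :
  (forall i, exists2 e, 0 < e & P i e) -> (forall i e e', 0 < e -> e <= e' -> P i e' -> P i e) ->
  exists2 e, 0 < e & forall i, P i e.
Proof.
move=> ex mono; have [|e e0 es] := @seq_lower_bound I (enum I) P _ mono; first by move=> i _; exact: ex.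
by exists e => // i; apply: es; rewrite mem_enum.
Qed.

Lemma open_interval_avoid (s : seq R) (a b : R) : a < b -> exists t, [/\ a < t, t < b & t \notin s].
Proof.
elim: s b => [|h s IH] b ab; first by exists ((a + b) / 2); split=> //; lra.
have ab' : a < if a < h < b then h else b by case: ifP => // /andP[].
have [t [at_ tb ts]] := IH _ ab'; exists t; split=> //.
  by move: tb; case: ifP => // /andP[_ hb] th; apply: lt_trans hb.
rewrite inE negb_or ts andbT; apply/negP => /eqP e; move: tb; rewrite -e at_ /=.
by case: ifP; lra.
Qed.

Lemma lipschitz_bound (phi : R * R -> R) : lipschitz phi ->
  exists2 C, 0 < C & forall a b a' b' d, `|a - a'| <= d -> `|b - b'| <= d ->
    `|phi (a, b) - phi (a', b')| <= C * d.
Proof.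
move=> [B [_ /(_ (Num.max B 0 + 1))lB]]; exists (Num.max B 0 + 1).
  by rewrite ltr_wpDl // le_max lexx orbT.
move=> a b a' b' d ad bd.
have h : B < Num.max B 0 + 1 by rewrite (le_lt_trans (_ : _ <= Num.max B 0)) ?le_max ?lexx // ltrDl.
have := lB h ((a, b), (a', b')) (conj I I) => /=; move/le_trans; apply.
by rewrite ler_pM2l ?ltr_wpDl ?le_max ?lexx ?orbT // prod_normE /= ge_max ad bd.
Qed.

(** In the interior v = 0 will do. At the boundary v is the vertical direction of the graph: points
    of the closure lie on or above it, and any positive shift takes them strictly above. *)
Lemma inward_direction (Omega : set 'rV[R]_3) p : is_domain Omega -> lipschitz_boundary Omega ->
  closure Omega p -> exists r v, 0 < r /\ forall y t, closure Omega y -> cube p r y ->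
    0 < t -> t < r -> Omega (y + t *: v).
Proof.
move=> [oO _ _] lip clp; have [Op|nOp] := pselect (Omega p).
  have [e e0 eO] := nbhs_cube (open_nbhs_nbhs (conj oO Op)).
  by exists e, 0; split=> // y t _ py _ _; rewrite scaler0 addr0; exact: eO.
have [|Q [r [phi [QQ r0 lphi loc]]]] := lip p.
  by split=> // /interior_subset.
have [C C0 lC] := lipschitz_bound lphi.
pose B := 1 + \sum_i \sum_j `|Q i j|.
have B1 : 1 <= B by rewrite lerDl sumr_ge0 // => i _; rewrite sumr_ge0.
have B0 : 0 < B by apply: lt_le_trans B1.
have bnd y z d j : cube y d z -> `|((z - p) *m Q) 0 j - ((y - p) *m Q) 0 j| <= d * B.
  move=> yz; have d0 : 0 <= d by apply: le_trans (ltW (yz 0)).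
  have -> : ((z - p) *m Q) 0 j - ((y - p) *m Q) 0 j = ((z - y) *m Q) 0 j.
    have -> : z - y = (z - p) - (y - p) by rewrite opprB addrA subrK.
    have mB (u1 u2 : 'rV[R]_3) : (u1 - u2) 0 j = u1 0 j - u2 0 j by rewrite !mxE.
    by rewrite -mB -mulmxBl.
  rewrite mxE (le_trans (ler_norm_sum _ _ _)) // mulrDr mulr1 mulr_sumr ler_wpDl //.
  apply: ler_sum => i _; rewrite normrM ler_pM //; first by rewrite !mxE; exact: ltW (yz i).
  by rewrite (bigD1 j) //= lerDl sumr_ge0.
(* [B] bounds the change of coordinates. The position of a point, the shift and the approximation
   error each take at most a third of r, so the points considered stay in the chart. *)
pose s := r / (3%:R * B); have s0 : 0 < s by rewrite divr_gt0 // mulr_gt0.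
have sB : s * B = r / 3%:R.
  by rewrite /s invfM -!mulrA mulVf ?mulr1 // gt_eqF.
have near0 y j : cube p s y -> `|((y - p) *m Q) 0 j| <= r / 3%:R.
  by move=> py; have := bnd p y s j py; rewrite subrr mul0mx [X in _ - X]mxE subr0 sB.
pose v : 'rV[R]_3 := delta_mx 0 2%:R *m Q^T.
have vQ : v *m Q = delta_mx 0 2%:R by rewrite -mulmxA (mulmx1C QQ) mulmx1.
exists s, v; split=> // y t Oy py t0 ts.
have tr : t < r / 3%:R by rewrite -sB (lt_le_trans ts) // ler_peMr // ltW.
set Y := (y - p) *m Q.
have E j : ((y + t *: v - p) *m Q) 0 j = Y 0 j + t * (j == 2%:R)%:R.
  by rewrite addrAC mulmxDl -scalemxAl vQ !mxE eqxx.
apply/loc => [i|].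
  rewrite E (le_lt_trans (ler_normD _ _)) //.
  have := near0 y i py; rewrite -/Y normrM (gtr0_norm t0).
  by case: eqP => _; rewrite ?normr1 ?normr0; lra.
rewrite !E /= !mulr0 !addr0 mulr1.
suff : phi (Y 0 0, Y 0 1) <= Y 0 2%:R by lra.
rewrite leNgt; apply/negP => gap.
pose g := phi (Y 0 0, Y 0 1) - Y 0 2%:R; have g0 : 0 < g by rewrite subr_gt0.
(* If [y] lay below the graph by [g], a point of [Omega] this close to it could gain at most d B in
   height while the graph drops by at most C d B. Together this is at most [g], so that point would
   not be above the graph either. *)
pose d := Num.min s (g / ((C + 1) * B)).
have CB0 : 0 < (C + 1) * B by rewrite mulr_gt0 // addr_gt0.
have d0 : 0 < d by rewrite lt_min s0 divr_gt0.
have dg : C * (d * B) + d * B <= g.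
  have : d <= g / ((C + 1) * B) by rewrite ge_min lexx orbT.
  by rewrite ler_pdivlMr //; lra.
have ds : d * B <= r / 3%:R by rewrite -sB ler_pM2r // ge_min lexx.
have [y' [Oy' yy']] := Oy _ (cube_nbhs y d0).
set Y' := (y' - p) *m Q.
have YY' j : `|Y' 0 j - Y 0 j| <= d * B by exact: bnd.
have : phi (Y' 0 0, Y' 0 1) < Y' 0 2%:R.
  apply/loc => // i; rewrite -/Y'.
  have -> : Y' 0 i = (Y' 0 i - Y 0 i) + Y 0 i by rewrite subrK.
  rewrite (le_lt_trans (ler_normD _ _)) //.
  by have := YY' i; have := near0 y i py; rewrite -/Y; lra.
have := lC _ _ _ _ _ (YY' 0) (YY' 1); have := YY' 2%:R; rewrite !ler_norml.
move=> /andP[_ u1] /andP[u2 _]; move: dg u1 u2; rewrite /g; lra.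
Qed.
End Geometry.

Section Stars.
Variables (R : realType) (Omega : set 'rV[R]_3) (M : mesh R).
Hypothesis Omega_domain : is_domain Omega.
Hypothesis Omega_lipschitz : lipschitz_boundary Omega.
Hypothesis M_mesh : partitions M Omega.
Local Notation cells := 'I_(ncells M).
Implicit Types (c : cells) (p q x y z v : 'rV[R]_3) (e : rel cells) (m n : 'I_3).

Lemma closure_cells p : closure Omega p <-> exists c, incell c p.
Proof.
by rewrite M_mesh; split=> [[c _ cp]|[c cp]]; exists c.
Qed.

Lemma Omega_covered p : Omega p -> exists c, incell c p.
Proof. by move=> Op; apply/closure_cells; exact: subset_closure. Qed.

Lemma incell_closed c : closed (incell c).
Proof.
have -> : incell c = \bigcap_(n in [set: 'I_3])
    ((fun p => p 0 n) @^-1` [set t | clo c n <= t] `&` (fun p => p 0 n) @^-1` [set t | t <= chi c n]).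
  apply/seteqP; split=> p.
    by move=> cp n _; have /andP[] := cp n.
  by move=> cp n; apply/andP; case: (cp n I).
apply: closed_bigI => n _; apply: closedI.
  apply: preimage_closed; last exact: closed_ge.
  by move=> q _; exact: coord_continuous.
apply: preimage_closed; last exact: closed_le.
by move=> q _; exact: coord_continuous.
Qed.

Lemma near_cells p : exists2 r, 0 < r & forall c q, cube p r q -> incell c q -> incell c p.
Proof.
have [c|c r r' _ rr' h q rq|r r0 h] := @fin_lower_bound R cells
  (fun c r => forall q, cube p r q -> incell c q -> incell c p).
- have [cp|ncp] := pselect (incell c p); first by exists 1.
  have /nbhs_cube[r r0 rc] : nbhs p (~` incell c).
    by apply: open_nbhs_nbhs; split=> //; apply: closed_openC; exact: incell_closed.
  by exists r => // q /rc.
- by apply: h; exact: subset_cube rq.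
by exists r => // c q; exact: h.
Qed.

(** The cells linked to [c] and the remaining ones form two finite families with closed unions.
    These are disjoint on [A], so connectedness leaves only the first. *)
Lemma linked_along e (A : set 'rV[R]_3) : connected A ->
  (forall z, A z -> (exists c, incell c z) /\
     forall c c', incell c z -> incell c' z -> connect e c c') ->
  forall c c' z z', A z -> A z' -> incell c z -> incell c' z' -> connect e c c'.
Proof.
move=> cA lA c c' z z' Az Az' cz c'z'.
pose U (b : bool) := \bigcup_(c1 in [set c1 | connect e c c1 = b]) incell c1.
have cU b : closed (U b).
  apply: closed_bigcup; first exact: finite_finset.
  by move=> *; exact: incell_closed.
have AU : A `&` U true = A `&` ~` U false.
  apply/seteqP; split=> y [Ay Uy]; split=> //.
    move=> [c2 /= + c2y]; case: Uy => c1 /= cc1 c1y cc2.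
    by have := connect_trans cc1 ((lA y Ay).2 c1 c2 c1y c2y); rewrite cc2.
  have [[c1 c1y] _] := lA y Ay; exists c1 => //=.
  case cc1: (connect e c c1) => //; by case: Uy; exists c1.
have h : A `&` U true = A.
  apply: cA.
  - by exists z; split=> //; exists c => //=; exact: connect0.
  - by exists (~` U false) => //; exact: closed_openC.
  - by exists (U true).
have [_ [c1 /= cc1 c1z']] : (A `&` U true) z' by rewrite h.
apply: connect_trans cc1 _.
exact: (lA z' Az').2.
Qed.

Lemma linked_segment e x y c c' :
  (forall t, 0 <= t <= 1 -> (exists c, incell c (x + t *: (y - x))) /\
     forall c c', incell c (x + t *: (y - x)) -> incell c' (x + t *: (y - x)) -> connect e c c') ->
  incell c x -> incell c' y -> connect e c c'.
Proof.
move=> lA cx c'y; pose f t := x + t *: (y - x).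
apply: (@linked_along e (f @` `[0, 1]) _ _ c c' x y) => //.
- apply: connected_continuous_connected; first exact: segment_connected.
  apply: continuous_subspaceT => t; apply: cvgD; first exact: cvg_cst.
  by apply: cvgZr_tmp; exact: cvg_id.
- by move=> z [t t01 <-]; apply: lA; move: t01; rewrite /= in_itv.
- by exists 0; rewrite /f /= ?in_itv /= ?lexx ?ler01 // scale0r addr0.
- by exists 1; rewrite /f /= ?in_itv /= ?lexx ?ler01 // scale1r addrC subrK.
Qed.

Lemma star_link_near p q c c' : (forall c, incell c q -> incell c p) ->
  connect (@star_link R M q) c c' -> connect (@star_link R M p) c c'.
Proof.
move=> qp; apply: connect_sub => x y /asboolP[xq yq h]; apply: connect1.
by apply/asboolP; split=> //; exact: qp.
Qed.

Lemma axis_linked z r x y m c c' : cube z r `<=` Omega ->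
  (forall c q, cube z r q -> incell c q -> incell c z) ->
  cube z r x -> cube z r y -> (forall n, n != m -> x 0 n = y 0 n) ->
  (forall n, n != m -> forall c, x 0 n != clo c n /\ x 0 n != chi c n) ->
  incell c x -> incell c' y -> connect (star_link z) c c'.
Proof.
move=> zO near zx zy xy nc cx c'y; apply: (linked_segment (x := x) (y := y)) => // t t01.
set q := x + _; have zq : cube z r q.
  exact: cube_segment.
have qn n : n != m -> q 0 n = x 0 n by move=> nm; rewrite !mxE (xy n nm) subrr mulr0 addr0.
split=> [|c1 c2 c1q c2q]; first by apply: Omega_covered; exact: zO.
have [->|c12] := eqVneq c1 c2; first exact: connect0.
apply: connect1; apply/asboolP; split; [exact: near c1q|exact: near c2q|exists m].
have [tri [n nn]] := cells_meet c12 c1q c2q.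
have same n' : n' != m -> clo c1 n' = clo c2 n' /\ chi c1 n' = chi c2 n'.
  move=> nm; case: (tri n') => // -[]; rewrite (qn _ nm) => e _; have [n1 n2] := nc n' nm c1.
    by rewrite e eqxx in n2.
  by rewrite e eqxx in n1.
have nm : n = m by apply/eqP/negPn/negP => /same.
case: (tri m) => [|[_ e]|[_ e]]; first by rewrite -nm.
  by left.
by right; split=> // n' /same[-> ->].
Qed.

Lemma noncritical z r c : 0 < r -> incell c z -> exists x, [/\ incell c x, cube z r x,
  forall n, clo c n < x 0 n < chi c n & forall n c', x 0 n != clo c' n /\ x 0 n != chi c' n].
Proof.
move=> r0 cz.
have ex n : exists t, [/\ clo c n < t < chi c n, `|t - z 0 n| < r &
    forall c', t != clo c' n /\ t != chi c' n].
  pose s := [seq clo c' n | c' : cells] ++ [seq chi c' n | c' : cells].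
  have lt : Num.max (clo c n) (z 0 n - r) < Num.min (chi c n) (z 0 n + r).
    have := clo_lt_chi c n; have /andP[] := cz n; rewrite -/(clo _ _) -/(chi _ _) => h1 h2 h3.
    by rewrite gt_max !lt_min; apply/andP; split; apply/andP; split; lra.
  have [t [t1 t2 ts]] := open_interval_avoid s lt.
  move: t1 t2; rewrite gt_max lt_min => /andP[t1 t2] /andP[t3 t4].
  exists t; split; first by rewrite t1.
    by rewrite ltr_norml; lra.
  move=> c'; move: ts; rewrite mem_cat negb_or => /andP[s1 s2]; split.
    by apply: contra s1 => /eqP->; apply/mapP; exists c'; rewrite ?mem_enum.
  by apply: contra s2 => /eqP->; apply/mapP; exists c'; rewrite ?mem_enum.
pose f n := projT1 (cid (ex n)); exists (\row_n f n).
have fP n := projT2 (cid (ex n)); rewrite -/(f _) in fP.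
split=> [n|n|n|n]; rewrite ?mxE; case: (fP n) => // /andP[h1 h2] _ _.
by rewrite -/(clo _ _) -/(chi _ _) /f !ltW.
Qed.

(** A generic point of each cell is chosen near z, and the two points are joined by changing one
    coordinate at a time. The points [mix k] are the corners of this path, whose segments satisfy
    the conditions of [axis_linked]. *)
Lemma open_star z c c' : Omega z -> incell c z -> incell c' z -> connect (star_link z) c c'.
Proof.
move=> Oz cz c'z; have [oO _ _] := Omega_domain.
have [r1 r10 zO] := nbhs_cube (open_nbhs_nbhs (conj oO Oz)).
have [r2 r20 near] := near_cells z.
pose r := Num.min r1 r2; have r0 : 0 < r by rewrite lt_min r10.
have zO' : cube z r `<=` Omega.
  by apply: subset_trans zO; apply: subset_cube; rewrite ge_min lexx.
have near' c1 q : cube z r q -> incell c1 q -> incell c1 z.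
  by move=> zq; apply: near; apply: subset_cube zq; rewrite ge_min lexx orbT.
have [x [cx zx _ nx]] := noncritical r0 cz; have [y [c'y zy _ ny]] := noncritical r0 c'z.
pose mix (k : nat) : 'rV[R]_3 := \row_n (if (n < k)%N then y 0 n else x 0 n).
have zmix k : cube z r (mix k) by move=> n; rewrite mxE; case: ifP.
have nmix k n c1 : mix k 0 n != clo c1 n /\ mix k 0 n != chi c1 n by rewrite mxE; case: ifP.
have step (m : 'I_3) c1 c2 : incell c1 (mix m) -> incell c2 (mix m.+1) -> connect (star_link z) c1 c2.
  apply: (@axis_linked z r _ _ m) => // n nm; rewrite !mxE.
  by rewrite [(n < m.+1)%N]ltnS (leq_eqVlt n) [(_ == _ :> nat)](negbTE nm).
have cmix k : exists c1, incell c1 (mix k) by apply: Omega_covered; exact: zO'.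
have [c1 c1m] := cmix 1%N; have [c2 c2m] := cmix 2%N.
have mx0 : mix 0%N = x by apply/rowP => n; rewrite mxE.
have my3 : mix 3%N = y by apply/rowP => n; rewrite mxE ltn_ord.
apply: connect_trans (step 0 c c1 _ _) _; rewrite ?mx0 //.
by apply: connect_trans (step 1 c1 c2 _ _) (step 2%:R c2 c' _ _); rewrite ?my3.
Qed.

Lemma open_segment_star p x y c c' :
  (forall c q, (exists2 t, 0 <= t <= 1 & q = x + t *: (y - x)) -> incell c q -> incell c p) ->
  (forall t, 0 <= t <= 1 -> Omega (x + t *: (y - x))) ->
  incell c x -> incell c' y -> connect (star_link p) c c'.
Proof.
move=> near O; apply: linked_segment => t t01; split; first by apply: Omega_covered; exact: O.
move=> c1 c2 c1q c2q; apply: star_link_near (open_star (O t t01) c1q c2q) => c3.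
by apply: near; exists t.
Qed.

Lemma star_link_connect_sym p : fingraph.connect_sym (star_link p : rel cells).
Proof.
apply: sym_connect_sym => c c'; apply/asboolP/asboolP => -[cp c'p [m [a|a]]];
  by split=> //; exists m; by [left|right].
Qed.

(** Near a boundary point an axis-parallel path may leave the domain. Points of both cells are
    therefore first pushed inward and then joined inside a cube around [p + t0 *: v] contained in
    [Omega]. Everything stays so close to p that only cells at p are met. *)
Lemma mesh_star_connected : star_connected M.
Proof.
move=> p c c' cp c'p.
have clp : closure Omega p by apply/closure_cells; exists c.
have [r1 [v [r10 inw]]] := inward_direction Omega_domain Omega_lipschitz clp.
have [r2 r20 near] := near_cells p.
pose V := 1 + \sum_n `|v 0 n|.
have vV n : `|v 0 n| < V.
  by rewrite /V (bigD1 n) //= addrCA ltrDl ltr_wpDr // sumr_ge0.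
have V0 : 0 < V by apply: le_lt_trans (vV 0).
pose t0 := Num.min (r1 / 2) (r2 / (2 * V)).
have t00 : 0 < t0 by rewrite lt_min !divr_gt0 // mulr_gt0.
have t0r1 : t0 < r1 by rewrite gt_min; apply/orP; left; lra.
have t0v t n : 0 <= t <= t0 -> `|t * v 0 n| < r2 / 2.
  move=> /andP[tp tt]; rewrite normrM ger0_norm // (le_lt_trans (_ : _ <= t0 * `|v 0 n|)) ?ler_wpM2r //.
  rewrite (lt_le_trans (_ : _ < t0 * V)) ?ltr_pM2l //.
  have : t0 <= r2 / (2 * V) by rewrite ge_min lexx orbT.
  by rewrite ler_pdivlMr ?mulr_gt0 //; lra.
have Op0 : Omega (p + t0 *: v) by apply: inw => //; exact: cube_center.
have [oO _ _] := Omega_domain.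
have [r3 r30 r3O] := nbhs_cube (open_nbhs_nbhs (conj oO Op0)).
pose s := Num.min (Num.min r1 r3) (r2 / 2).
have s0 : 0 < s by rewrite !lt_min r10 r30 divr_gt0.
have [sr1 sr3 sr2] : [/\ s <= r1, s <= r3 & s <= r2 / 2].
  by rewrite /s !ge_min !lexx !orbT.
have nearv x t : cube p s x -> 0 <= t <= t0 -> cube p r2 (x + t *: v).
  move=> px tt n; have := px n; have := t0v t n tt; rewrite !mxE => h1 h2.
  by rewrite addrAC (le_lt_trans (ler_normD _ _)) //; lra.
have shaft c1 x : incell c1 x -> (forall n, clo c1 n < x 0 n < chi c1 n) -> cube p s x ->
    exists c2, incell c2 (x + t0 *: v) /\ connect (star_link p) c1 c2.
  move=> c1x inx px; have xO t : 0 < t <= t0 -> Omega (x + t *: v).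
    move=> /andP[tp tt]; apply: inw => //; last exact: le_lt_trans t0r1.
      by apply/closure_cells; exists c1.
    exact: subset_cube px.
  have [|c2 c2x] := Omega_covered (xO t0 _); first by rewrite t00 lexx.
  exists c2; split=> //.
  pose P n (e : R) := forall t : R, 0 <= t <= e -> clo c1 n <= x 0 n + t * v 0 n <= chi c1 n.
  have [e e0 eP] : exists2 e : R, 0 < e & forall n, P n e.
    apply: fin_lower_bound; last first.
      by move=> n e e' _ ee' h t /andP[tp te]; apply: h; rewrite tp (le_trans te).
    move=> n; have /andP[h1 h2] := inx n; pose g := Num.min (x 0 n - clo c1 n) (chi c1 n - x 0 n).
    have g0 : 0 < g by rewrite lt_min !subr_gt0 h1.
    exists (g / V) => [|t /andP[tp tg]]; first exact: divr_gt0.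
    have : `|t * v 0 n| <= g.
      rewrite normrM ger0_norm // (le_trans (_ : _ <= g / V * V)) //; last by rewrite divfK // gt_eqF.
      by apply: ler_pM => //; exact: ltW.
    by rewrite /g le_min !ler_norml; lra.
  (* The inward direction gives points of [Omega] only for positive times; up to time [e] the moving
     point is still in [c1], so the path can start at [t1]. *)
  pose t1 := Num.min e t0; have t10 : 0 < t1 by rewrite lt_min e0.
  have t1e : t1 <= e by rewrite ge_min lexx.
  have t1t0 : t1 <= t0 by rewrite ge_min lexx orbT.
  have seg t : 0 <= t <= 1 -> exists2 t', 0 < t' <= t0 &
      x + t1 *: v + t *: (x + t0 *: v - (x + t1 *: v)) = x + t' *: v.
    move=> /andP[tp tl]; exists (t1 + t * (t0 - t1)).
      have := mulr_ge0 tp (_ : 0 <= t0 - t1); have := mulr_ge0 (_ : 0 <= 1 - t) (_ : 0 <= t0 - t1).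
      by move=> H1 H2; have := H1 _ _; have := H2 _; lra.
    by apply/rowP => n; rewrite !mxE; ring.
  apply: (@open_segment_star p (x + t1 *: v) (x + t0 *: v)) => [c3 q [t t01 ->]|t t01|n|].
  - have [t' /andP[t'0 t't] ->] := seg t t01; apply: near; apply: nearv => //.
    by rewrite (ltW t'0).
  - by have [t' t't ->] := seg t t01; exact: xO.
  - by rewrite !mxE; apply: eP; rewrite (ltW t10).
  exact: c2x.
have [x [cx px inx _]] := noncritical s0 cp; have [y [c'y py iny _]] := noncritical s0 c'p.
have [c1 [c1x cc1]] := shaft c x cx inx px; have [c2 [c2y c'c2]] := shaft c' y c'y iny py.
apply: connect_trans cc1 _; rewrite star_link_connect_sym; apply: connect_trans c'c2 _.
rewrite star_link_connect_sym.
have moved z : cube p s z -> cube (p + t0 *: v) s (z + t0 *: v).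
  by move=> pz n; have := pz n; rewrite !mxE opprD addrACA subrr addr0.
apply: (open_segment_star (x := x + t0 *: v) (y := y + t0 *: v)) => // [c3 q [t t01 ->]|t t01].
  apply: near; have := cube_segment (moved x px) (moved y py) t01; set w := x + t0 *: v + _ => h n.
  have := h n; have := t0v t0 n; rewrite lexx ltW // => /(_ isT) h1.
  rewrite [(p + _) 0 n]mxE [(t0 *: v) 0 n]mxE => h2.
  have -> : w 0 n - p 0 n = (w 0 n - (p 0 n + t0 * v 0 n)) + t0 * v 0 n by ring.
  by rewrite (le_lt_trans (ler_normD _ _)) //; lra.
apply: r3O; apply: (subset_cube sr3); apply: cube_segment => //; exact: moved.
Qed.

(** The centre of a cell is in the closure, so each cell meets [Omega]. Along the connected [Omega],
    stars of interior points link the cells. *)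
Lemma domain_mesh_connected : mesh_connected M.
Proof.
have [oO cO _] := Omega_domain.
have meets c : exists2 z, Omega z & incell c z.
  pose p : 'rV[R]_3 := \row_n ((clo c n + chi c n) / 2).
  have pn n : p 0 n = (clo c n + chi c n) / 2 by rewrite mxE.
  have cl : closure Omega p.
    by apply/closure_cells; exists c => n; have := clo_lt_chi c n; rewrite pn /clo /chi; lra.
  have [r r0 rc] : exists2 r, 0 < r & forall n, r <= (chi c n - clo c n) / 2.
    apply: (@fin_lower_bound R 'I_3 (fun n r => r <= (chi c n - clo c n) / 2)).
      by move=> n; exists ((chi c n - clo c n) / 2) => //; have := clo_lt_chi c n; lra.
    by move=> n e e' _; exact: le_trans.
  have [z [Oz pz]] := cl _ (cube_nbhs p r0); exists z => // n.
  by have := pz n; have := rc n; rewrite pn -/(clo _ _) -/(chi _ _) ltr_norml; lra.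
move=> c c'; have [z Oz cz] := meets c; have [z' Oz' c'z'] := meets c'.
apply: (linked_along (A := Omega)) Oz Oz' cz c'z' => // x Ox.
split=> [|c1 c2 c1x c2x]; first exact: Omega_covered.
apply: connect_sub (open_star Ox c1x c2x) => a b /asboolP[_ _ h]; apply: connect1; exact/asboolP.
Qed.
End Stars.

(** * Contraction of the closed domain in small steps *)

Section Deformable.
Variable R : realType.
Implicit Types (A : set 'rV[R]_3) (p q x y z : 'rV[R]_3) (e : R).

Lemma cube_sym p e x : cube p e x -> cube x e p.
Proof. by move=> px n; rewrite distrC. Qed.

Lemma cube_trans p x y (e e' : R) : cube p e x -> cube x e' y -> cube p (e + e') y.
Proof.
move=> px xy n; have -> : y 0 n - p 0 n = (x 0 n - p 0 n) + (y 0 n - x 0 n) by ring.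
by rewrite (le_lt_trans (ler_normD _ _)) // ltrD.
Qed.


(* A contraction of A in N steps whose continuity is only required up to the
   scale e; the maps h i need not be continuous. *)
Definition deformable A := forall e, 0 < e -> exists (e' : R) (N : nat) (h : nat -> 'rV[R]_3 -> 'rV[R]_3),
  [/\ 0 < e', forall x, h 0%N x = x, forall i x, (i <= N)%N -> A x -> A (h i x) &
     [/\ exists z, forall x, A x -> h N x = z,
        forall i x y, (i <= N)%N -> A x -> A y -> cube x e' y -> cube (h i x) e (h i y) &
        forall i x y, (i < N)%N -> A x -> A y -> cube x e' y -> cube (h i x) e (h i.+1 y)]].

Lemma star_shaped_deformable A (c : 'rV[R]_3) (B : R) :
  (forall x t, A x -> 0 <= t <= 1 -> A (x + t *: (c - x))) ->
  (forall x n, A x -> `|c 0 n - x 0 n| <= B) -> deformable A.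
Proof.
move=> cA AB e e0; pose B' := Num.max B 1; have B'0 : 0 < B' by rewrite lt_max ltr01 orbT.
have e2 : 0 < e / 2 by rewrite divr_gt0.
pose N := Num.bound (B' / (e / 2)).
have hN : B' < N%:R * (e / 2).
  by rewrite -ltr_pdivrMr //; apply: archi_boundP; rewrite divr_ge0 // ltW.
have N0 : 0 < N%:R :> R by rewrite -(pmulr_lgt0 _ e2); apply: lt_trans hN.
have t01 (i : nat) : (i <= N)%N -> 0 <= (i%:R / N%:R : R) <= 1.
  by move=> iN; rewrite divr_ge0 ?ler0n //= ler_pdivrMr // mul1r ler_nat.
exists (e / 2), N, (fun i x => x + (i%:R / N%:R) *: (c - x)).
have close (i : nat) x y : (i <= N)%N -> cube x (e / 2) y ->
    cube (x + (i%:R / N%:R) *: (c - x)) (e / 2) (y + (i%:R / N%:R) *: (c - y)).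
  move=> iN xy n; have /andP[t0 t1] := t01 i iN; rewrite !mxE; move: t0 t1; set t := _ / _ => t0 t1.
  rewrite (_ : _ - _ = (1 - t) * (y 0 n - x 0 n)); last by ring.
  rewrite normrM ger0_norm ?subr_ge0 //; apply: le_lt_trans (xy n).
  by rewrite -[leRHS]mul1r ler_wpM2r // gerBl.
split=> //; last split.
- by move=> x; rewrite mul0r scale0r addr0.
- by move=> i x iN Ax; apply: cA => //; exact: t01.
- by exists c => x Ax; rewrite divff ?gt_eqF // scale1r addrC subrK.
- by move=> i x y iN _ _ xy; apply: subset_cube (close i x y iN xy); lra.
move=> i x y iN _ Ay xy; rewrite [e]splitr; apply: cube_trans (close i x y (ltnW iN) xy) _ => n.
rewrite -natr1 !mxE (_ : _ - _ = (c 0 n - y 0 n) / N%:R); last by field; rewrite gt_eqF.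
rewrite normrM normfV (ger0_norm (ler0n _ _)) ltr_pdivrMr // mulrC.
by apply: le_lt_trans (AB y n Ay) (le_lt_trans _ hN); rewrite le_max lexx.
Qed.

Lemma locally_constant A (U : Type) (g : 'rV[R]_3 -> U) e : 0 < e -> deformable A ->
  (forall x y, A x -> A y -> cube x e y -> g x = g y) ->
  forall x y, A x -> A y -> g x = g y.
Proof.
move=> e0 /(_ e e0)[e' [N [h [e'0 h0 hA [[z hz] _ hs]]]]] lc.
suff gz x : A x -> g x = g z by move=> x y /gz-> /gz->.
move=> Ax; rewrite -(hz x Ax); have : (N <= N)%N by [].
move: {1 3}N => j; elim: j => [_|j IH jN]; first by rewrite h0.
rewrite IH; last exact: ltnW.
apply: lc; [exact/hA/Ax/ltnW|exact: hA|].
by apply: hs => //; exact: cube_center.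
Qed.

(** The prism operator in degree one: [b] sums [u] along the trajectory of a point. Each square
    between two neighbouring trajectories is cut into two small triangles, and the sum
    telescopes. *)
Lemma additive_coboundary A (u : 'rV[R]_3 -> 'rV[R]_3 -> R) e : 0 < e -> deformable A ->
  (forall x y z, A x -> A y -> A z -> cube x e y -> cube y e z -> cube x e z ->
     u x y + u y z = u x z) ->
  exists (b : 'rV[R]_3 -> R) (e' : R), 0 < e' /\
    forall x y, A x -> A y -> cube x e' y -> u x y = b x - b y.
Proof.
move=> e0 /(_ e e0)[e' [N [h [e'0 h0 hA [[z hz] hh hs]]]]] uD.
exists (fun x => \sum_(i < N) u (h i x) (h i.+1 x)), e'; split=> // x y Ax Ay xy.
rewrite -sumrB; pose g i := - u (h i x) (h i y).
have Az : A z by rewrite -(hz x Ax); exact: hA.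
have uz : u z z = 0.
  by have := uD z z z Az Az Az (cube_center z e0) (cube_center z e0) (cube_center z e0); lra.
have -> : u x y = g N - g 0%N by rewrite /g !h0 !hz // uz oppr0 sub0r opprK.
rewrite -[LHS](telescope_sumr g (leq0n N)) big_mkord; apply: eq_bigr => i _; rewrite /g opprK.
have iN := ltn_ord i; have iN' := ltnW iN.
have c z' := cube_center z' e'0.
have Ah v (j : nat) : A v -> (j <= N)%N -> A (h j v) by move=> Av jN; exact: hA.
have := uD (h i x) (h i.+1 x) (h i.+1 y) (Ah _ _ Ax iN') (Ah _ _ Ax iN) (Ah _ _ Ay iN)
  (hs _ _ _ iN Ax Ax (c x)) (hh _ _ _ iN Ax Ay xy) (hs _ _ _ iN Ax Ay xy).
have := uD (h i x) (h i y) (h i.+1 y) (Ah _ _ Ax iN') (Ah _ _ Ay iN') (Ah _ _ Ay iN)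
  (hh _ _ _ iN' Ax Ay xy) (hs _ _ _ iN Ay Ay (c y)) (hs _ _ _ iN Ax Ay xy).
by lra.
Qed.

(** The prism between the triangles at times i and i + 1 is cut into three tetrahedra, on which the
    cocycle identity is used. At the final time all points coincide, and the leftover constant
    [u w w w] is absorbed into [b]. *)
Lemma cocycle_coboundary A (u : 'rV[R]_3 -> 'rV[R]_3 -> 'rV[R]_3 -> R) e : 0 < e -> deformable A ->
  (forall x y z t, A x -> A y -> A z -> A t -> cube x e y -> cube x e z -> cube x e t ->
     cube y e z -> cube y e t -> cube z e t -> u y z t - u x z t + u x y t - u x y z = 0) ->
  exists (b : 'rV[R]_3 -> 'rV[R]_3 -> R) (e' : R), 0 < e' /\
    forall x y z, A x -> A y -> A z -> cube x e' y -> cube y e' z -> cube x e' z ->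
      u x y z = b x y + b y z - b x z.
Proof.
move=> e0 /(_ e e0)[e' [N [h [e'0 h0 hA [[w hw] hh hs]]]]] uD.
pose P i x y := u (h i x) (h i y) (h i.+1 y) - u (h i x) (h i.+1 x) (h i.+1 y).
exists (fun x y => \sum_(i < N) P i x y + u w w w), e'; split=> // x y z Ax Ay Az xy yz xz.
suff : \sum_(i < N) (P i x y + P i y z - P i x z) = u x y z - u w w w.
  by rewrite sumrB big_split /=; lra.
pose g i := - u (h i x) (h i y) (h i z).
have -> : u x y z - u w w w = g N - g 0%N by rewrite /g !h0 !hw // opprK addrC.
rewrite -[RHS](telescope_sumr g (leq0n N)) big_mkord; apply: eq_bigr => i _; rewrite /g opprK /P.
have iN := ltn_ord i; have iN' := ltnW iN; have c z' := cube_center z' e'0.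
have Ah v (j : nat) : A v -> (j <= N)%N -> A (h j v) by move=> Av jN; exact: hA.
have := uD (h i x) (h i y) (h i z) (h i.+1 z) (Ah _ _ Ax iN') (Ah _ _ Ay iN') (Ah _ _ Az iN') (Ah _ _ Az iN)
  (hh _ _ _ iN' Ax Ay xy) (hh _ _ _ iN' Ax Az xz) (hs _ _ _ iN Ax Az xz)
  (hh _ _ _ iN' Ay Az yz) (hs _ _ _ iN Ay Az yz) (hs _ _ _ iN Az Az (c z)).
have := uD (h i x) (h i y) (h i.+1 y) (h i.+1 z) (Ah _ _ Ax iN') (Ah _ _ Ay iN') (Ah _ _ Ay iN) (Ah _ _ Az iN)
  (hh _ _ _ iN' Ax Ay xy) (hs _ _ _ iN Ax Ay xy) (hs _ _ _ iN Ax Az xz)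
  (hs _ _ _ iN Ay Ay (c y)) (hs _ _ _ iN Ay Az yz) (hh _ _ _ iN Ay Az yz).
have := uD (h i x) (h i.+1 x) (h i.+1 y) (h i.+1 z) (Ah _ _ Ax iN') (Ah _ _ Ax iN) (Ah _ _ Ay iN) (Ah _ _ Az iN)
  (hs _ _ _ iN Ax Ax (c x)) (hs _ _ _ iN Ax Ay xy) (hs _ _ _ iN Ax Az xz)
  (hh _ _ _ iN Ax Ay xy) (hh _ _ _ iN Ax Az xz) (hh _ _ _ iN Ay Az yz).
by lra.
Qed.
End Deformable.

Section Deformation.
Variables (R : realType) (Omega : set 'rV[R]_3) (M : mesh R).
Hypothesis Omega_domain : is_domain Omega.
Hypothesis Omega_contractible : contractible Omega.
Hypothesis Omega_lipschitz : lipschitz_boundary Omega.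
Hypothesis M_mesh : partitions M Omega.
Local Notation cells := 'I_(ncells M).
Local Notation K := (closure Omega).
Implicit Types (c : cells) (p q x y z v : 'rV[R]_3) (m n : 'I_3).

Lemma cube_norm p (e : R) x : cube p e x <-> 0 < e /\ `|x - p| < e.
Proof.
split=> [px|[e0 px] n].
  have e0 : 0 < e by apply: le_lt_trans (px 0).
  split=> //; have : ball p e x by split=> // i n; rewrite ord1 /ball /= distrC.
  by rewrite mx_norm_ball /ball_ /= distrC.
have : ball p e x by rewrite mx_norm_ball /ball_ /= distrC.
by case=> _ /(_ 0 n); rewrite /ball /= distrC.
Qed.

Lemma closure_compact : compact K.
Proof.
have -> : K = \big[setU/set0]_(c <- enum [set: cells]) incell c.
  rewrite M_mesh -bigcup_seq; apply/seteqP; split=> x [c _ cx]; exists c => //=.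
  by rewrite mem_enum inE.
elim/big_ind: _ => [|A B|c _]; [exact: compact0|exact: compactU|].
have -> : incell c = [set v : 'rV[R]_3 | forall n, `[clo c n, chi c n]%classic (v 0 n)].
  by apply/seteqP; split=> x cx n; have := cx n; rewrite /= in_itv.
apply: (@rV_compact R 3 (fun n => `[clo c n, chi c n]%classic)) => n; exact: segment_compact.
Qed.

(** Inward directions of finitely many charts are added with continuous weights, one after the
    other. A summand of positive weight moves a point of the closure into [Omega] and one of weight
    zero does not move it, so directions of different charts never have to be compatible. *)
Lemma inside_retraction (e : R) : 0 < e -> exists f : 'rV[R]_3 -> 'rV[R]_3,
  [/\ continuous f, forall x, K x -> Omega (f x) & forall x, K x -> cube x e (f x)].
Proof.
move=> e0.
have dir p : exists rv : R * 'rV[R]_3, K p -> 0 < rv.1 /\ forall y t, K y -> cube p rv.1 y ->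
    0 < t -> t < rv.1 -> Omega (y + t *: rv.2).
  have [Kp|nKp] := pselect (K p); last by exists (0, 0).
  by have [r [v h]] := inward_direction Omega_domain Omega_lipschitz Kp; exists (r, v).
pose r p := (projT1 (cid (dir p))).1; pose v p := (projT1 (cid (dir p))).2.
have r0 p : K p -> 0 < r p by move=> Kp; case: (projT2 (cid (dir p)) Kp).
have inw p y t : K p -> K y -> cube p (r p) y -> 0 < t -> t < r p -> Omega (y + t *: v p).
  by move=> Kp; case: (projT2 (cid (dir p)) Kp) => _; exact.
have [S SK cov] : exists2 S : seq 'rV[R]_3, forall p, p \in S -> K p &
    forall x, K x -> exists2 p, p \in S & cube p (r p / 2) x.
  have := closure_compact; rewrite compact_cover => /(_ _ K (fun p => (cube p (r p / 2))°)).
  case=> [p _|x Kx|D DK cov]; first exact: open_interior.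
    by exists x => //; apply: cube_nbhs; rewrite divr_gt0 // r0.
  exists (finmap.enum_fset D) => [p pD|x /cov[p pD /interior_subset px]]; last by exists p.
  by have := DK p pD; rewrite inE.
(* [d * B] bounds all displacements together; for small [d] every intermediate point remains in the
   cubes where the directions still to be added point inward. *)
pose B := 1 + \sum_(p <- S) r p * `|v p|.
have B0 : 0 < B.
  by rewrite ltr_wpDr // big_seq sumr_ge0 // => p /SK/r0/ltW rp; rewrite mulr_ge0.
have [d1 d10 d1P] : exists2 d, 0 < d & forall p, p \in S -> d * B < r p / 2.
  apply: seq_lower_bound => [p pS|p d d' _ dd']; last first.
    by apply: le_lt_trans; rewrite ler_pM2r.
  have rp := r0 p (SK p pS); exists (r p / 3 / B); first by rewrite !divr_gt0.
  by rewrite divfK ?gt_eqF //; lra.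
pose d := Num.min d1 (Num.min (e / 2 / B) 1).
have d0 : 0 < d by rewrite !lt_min d10 !divr_gt0 //=.
have dS p : p \in S -> d * B < r p / 2.
  by move=> pS; apply: le_lt_trans (d1P p pS); rewrite ler_pM2r // /d ge_min lexx.
have de : d * B < e.
  apply: le_lt_trans (_ : e / 2 / B * B < e); first by rewrite ler_pM2r // /d !ge_min lexx !orbT.
  by rewrite divfK ?gt_eqF //; lra.
have d1' : d <= 1 by rewrite /d !ge_min lexx !orbT.
pose chi p x := Num.max 0 (r p / 2 - `|x - p|).
pose f s x := x + d *: \sum_(p <- s) chi p x *: v p.
have chi_ge0 p x : 0 <= chi p x by rewrite le_max lexx.
have chi_le p x : K p -> chi p x <= r p / 2.
  by move=> /r0 rp; have := normr_ge0 (x - p); rewrite ge_max; lra.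
have main x s : K x -> (exists s', S = s' ++ s) -> [/\ `|f s x - x| <= d * \sum_(p <- s) r p * `|v p|,
    K (f s x) & has (fun p => 0 < chi p x) s -> Omega (f s x)].
  move=> Kx; elim: s => [|p s IH] sS.
    by rewrite /f !big_nil scaler0 addr0 subrr normr0 mulr0 /=.
  have [s' eS] := sS; have [|h1 h2 h3] := IH; first by exists (rcons s' p); rewrite cat_rcons.
  have pS : p \in S by rewrite eS mem_cat mem_head orbT.
  have Kp := SK p pS; have rp := r0 p Kp.
  have fE : f (p :: s) x = f s x + (d * chi p x) *: v p.
    by rewrite /f big_cons scalerDr scalerA addrA addrAC.
  have step : 0 < chi p x -> Omega (f s x + (d * chi p x) *: v p).
    move=> c0; apply: inw => //; first 1 last.
    - exact: mulr_gt0.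
    - rewrite (le_lt_trans (_ : _ <= 1 * (r p / 2))) //; last by rewrite mul1r; lra.
      by apply: ler_pM => //; [exact: ltW|exact: chi_le].
    apply/cube_norm; split=> //; have : `|x - p| < r p / 2 by move: c0; rewrite lt_max ltxx subr_gt0.
    have : `|f s x - x| < r p / 2.
      apply: le_lt_trans h1 (le_lt_trans _ (dS p pS)); rewrite ler_pM2l //.
      have s'0 : 0 <= \sum_(q <- s') r q * `|v q|.
        rewrite big_seq sumr_ge0 // => q qs'; rewrite mulr_ge0 // ltW // r0 //; apply: SK.
        by rewrite eS mem_cat qs'.
      have := mulr_ge0 (ltW rp) (normr_ge0 (v p)).
      by rewrite /B eS big_cat big_cons /=; lra.
    rewrite -[f s x - p](subrKA x); have := ler_normD (f s x - x) (x - p); lra.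
  split.
  - rewrite fE addrAC big_cons mulrDr addrC (le_trans (ler_normD _ _)) // lerD //.
    rewrite normrZ normrM (gtr0_norm d0) (ger0_norm (chi_ge0 _ _)) -mulrA ler_pM2l //.
    by rewrite ler_wpM2r // (le_trans (chi_le p x Kp)) //; lra.
  - rewrite fE; have := chi_ge0 p x; rewrite le_eqVlt => /orP[/eqP<-|c0].
      by rewrite mulr0 scale0r addr0.
    exact/subset_closure/step.
  rewrite fE /= => /orP[/step //|h]; have := chi_ge0 p x; rewrite le_eqVlt => /orP[/eqP<-|/step //].
  by rewrite mulr0 scale0r addr0; exact: h3.
exists (f S); split.
- suff h x : f S @ nbhs x --> f S x by exact: h.
  apply: (@cvgD _ _ _ (nbhs x) _ id); first exact: cvg_id.
  apply: cvgZ; first exact: cvg_cst.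
  move: (S) => s; elim: s => [|p s IH].
    rewrite big_nil (_ : (fun y => _) = fun=> 0); first exact: cvg_cst.
    by apply: funext => y; rewrite big_nil.
  rewrite big_cons (_ : (fun y => _) = fun y => chi p y *: v p + \sum_(q <- s) chi q y *: v q).
    apply: cvgD IH; apply: cvgZ; last exact: cvg_cst.
    apply: (@continuous_max R _ (fun=> 0) (fun y => r p / 2 - `|y - p|) x); first exact: cst_continuous.
    suff h : (r p / 2 - `|y - p|) @[y --> nbhs x] --> r p / 2 - `|x - p| by exact: h.
    apply: cvgB; first exact: cvg_cst.
    by apply: cvg_norm; apply: cvgB; [exact: cvg_id|exact: cvg_cst].
  by apply: funext => y; rewrite big_cons.
- move=> x Kx; have [_ _ h] := main x S Kx (ex_intro _ [::] erefl); apply: h.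
  have [p pS /cube_norm[_ px]] := cov x Kx; apply/hasP; exists p => //.
  by rewrite lt_max subr_gt0 px orbT.
move=> x Kx; have [h _ _] := main x S Kx (ex_intro _ [::] erefl).
apply/cube_norm; split=> //; apply: le_lt_trans h (le_lt_trans _ de).
by rewrite ler_pM2l // lerDr.
Qed.

Definition near2 (d : R) (a b : R * 'rV[R]_3) := `|b.1 - a.1| < d /\ cube a.2 d b.2.

Lemma near2_nbhs (d : R) a : 0 < d -> nbhs a (near2 d a).
Proof.
move=> d0; exists ([set t | `|t - a.1| < d], cube a.2 d).
  split; last exact: cube_nbhs.
  by apply/nbhs_ballP; exists d => // t; rewrite /ball /= distrC.
by move=> [t x] [].
Qed.

Lemma nbhs_near2 a (A : set (R * 'rV[R]_3)) : nbhs a A -> exists2 d : R, 0 < d & near2 d a `<=` A.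
Proof.
move=> [[U V] [/nbhs_ballP[d d0 dU] /nbhs_cube[e e0 eV]] UV].
exists (Num.min d e) => [|[t x] [/= at_ ax]]; first by rewrite lt_min d0.
apply: UV; split=> /=.
  by apply: dU; rewrite /ball /= distrC (lt_le_trans at_) // ge_min lexx.
by apply: eV; apply: subset_cube ax; rewrite ge_min lexx orbT.
Qed.

(** Heine-Cantor relative to [C], because the contraction is only assumed to be continuous within
    its domain. *)
Lemma compact_uniform (C : set (R * 'rV[R]_3)) (G : R * 'rV[R]_3 -> 'rV[R]_3) :
  compact C ->
  (forall a (e : R), C a -> 0 < e ->
     exists2 d : R, 0 < d & forall b, C b -> near2 d a b -> cube (G a) e (G b)) ->
  forall e : R, 0 < e ->
     exists2 d : R, 0 < d & forall a b, C a -> C b -> near2 d a b -> cube (G a) e (G b).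
Proof.
move=> cC contG e e0; have e2 : 0 < e / 2 by rewrite divr_gt0.
pose r a := if pselect (C a) is left Ca then s2val (cid2 (contG a _ Ca e2)) else 1.
have r0 a : 0 < r a by rewrite /r; case: pselect => // Ca; case: (cid2 _).
have rP a b : C a -> C b -> near2 (r a) a b -> cube (G a) (e / 2) (G b).
  by move=> Ca; rewrite /r; case: pselect => // Ca'; case: (cid2 _) => d d0 h; exact: h.
pose P (d : R) a := forall b, C b -> near2 d a b -> cube (G a) e (G b).
have /near_covering_withinP cov := (compact_near_coveringP C).1 cC.
have FF : Filter (0^'+ : set_system R) by exact: at_right_proper_filter.
have near_all : \forall d \near (0 : R)^'+, C `<=` P d.
  apply: cov => c Cc; have r2 : 0 < r c / 2 by rewrite divr_gt0.
  exists (near2 (r c / 2) c, [set d | d < r c / 2]); first by split; [exact: near2_nbhs|exact: nbhs_right_lt].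
  move=> [a d] [/= [ca1 ca2] dc] Ca b Cb [ab1 ab2].
  rewrite [e]splitr; apply: (cube_trans (x := G c)).
    apply: cube_sym; apply: rP => //; split.
      by apply: lt_le_trans ca1 _; have := r0 c; lra.
    by apply: subset_cube ca2; have := r0 c; lra.
  apply: rP => //; split.
    have -> : b.1 - c.1 = (a.1 - c.1) + (b.1 - a.1) by ring.
    by rewrite (le_lt_trans (ler_normD _ _)) // [ltRHS]splitr ltrD // (lt_trans ab1).
  by rewrite [r c]splitr; apply: (cube_trans ca2); apply: subset_cube ab2; exact: ltW.
have [d [/= d0 dP]] := filter_ex (filterI (nbhs_right_gt (0 : R)) near_all).
by exists d => // a b Ca; exact: dP.
Qed.

Lemma closure_deformable : deformable K.
Proof.
move=> e e0; have e2 : 0 < e / 2 by rewrite divr_gt0.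
have [f [cf fO fe]] := inside_retraction e2.
have [x0 [H [Ox0 cH HO H0 H1]]] := Omega_contractible.
pose G a := H (a.1, f a.2).
have [||d d0 dP] := @compact_uniform (`[0, 1]%classic `*` K) G _ _ e e0.
- apply: compact_setX; [exact: segment_compact|exact: closure_compact].
- move=> [t x] d [/= t01 Kx] d0.
  have := cH; rewrite -[X in X -> _]/(continuous _) => /subspace_continuousP/(_ (t, f x)).
  case/(_ (conj t01 (fO _ Kx)) _ (cube_nbhs (G (t, x)) d0)) => [[U V] [tU fV] UV].
  have [d1 d10 h1] : exists2 d1 : R, 0 < d1 & near2 d1 (t, x) `<=` [set b | U b.1 /\ V (f b.2)].
    apply: nbhs_near2; exists (U, f @^-1` V); last by move=> [].
    by split=> //; apply: cf.
  exists d1 => // [[t' x']] [/= t'01 Kx'] /h1[/= Ut' Vx'].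
  by apply: (UV (t', f x')) => //; split=> //; exact: fO.
have [N Nd] : exists N : nat, 1 / N.+1%:R < d.
  have dd : 0 <= 1 / d by rewrite divr_ge0 // ltW.
  exists (Num.bound (1 / d)); have := archi_boundP dd; rewrite !ltr_pdivrMr // => hN.
  by apply: lt_trans hN _; rewrite mulrC ltr_pM2l // ltr_nat.
(* Index 0 is the identity, index 1 is the inward push [f], and the last N + 1 steps follow the
   contraction in time steps shorter than [d]. *)
exists (Num.min d (e / 2)), N.+2, (fun i x => if i is j.+1 then G (j%:R / N.+1%:R, x) else x).
have j01 (j : nat) : (j <= N.+1)%N -> j%:R / N.+1%:R \in `[(0 : R), 1].
  by move=> jN; rewrite in_itv /= divr_ge0 //= ler_pdivrMr // mul1r ler_nat.
have xy2 x y : cube x (Num.min d (e / 2)) y -> cube x (e / 2) y.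
  by apply: subset_cube; rewrite ge_min lexx orbT.
have xyd x y : cube x (Num.min d (e / 2)) y -> cube x d y.
  by apply: subset_cube; rewrite ge_min lexx.
split=> //; last split.
- by rewrite lt_min d0.
- move=> [|j] x //= jN Kx; apply: subset_closure; apply: HO; [exact: j01|exact: fO].
- by exists x0 => x Kx /=; rewrite /G /= divff ?H1 //; exact: fO.
- move=> [|j] x y jN Kx Ky xy /=; first by apply: subset_cube (xy2 _ _ xy); lra.
  apply: dP; try (by split=> //; apply: j01); split=> /=; last exact: xyd.
  by rewrite subrr normr0.
move=> [|j] x y jN Kx Ky xy /=.
  rewrite /G /= mul0r H0; last exact: fO.
  by rewrite [e]splitr; apply: cube_trans (xy2 _ _ xy) _; exact: fe.
apply: dP; try (by split=> //; apply: j01; lia); split=> /=; last exact: xyd.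
by rewrite -mulrBl -natrB // subSnn ger0_norm // divr_ge0.
Qed.
End Deformation.

(** * Cohomology of the mesh *)

Section Jumps.
Variables (R : realType) (Omega : set 'rV[R]_3) (M : mesh R).
Hypothesis Omega_domain : is_domain Omega.
Hypothesis Omega_contractible : contractible Omega.
Hypothesis Omega_lipschitz : lipschitz_boundary Omega.
Hypothesis M_mesh : partitions M Omega.
Local Notation cells := 'I_(ncells M).
Local Notation K := (closure Omega).
Implicit Types (c : cells) (p q x y z v : 'rV[R]_3) (m n : 'I_3).

Definition meet c c' := forall n, clo c n <= chi c' n /\ clo c' n <= chi c n.

Lemma incell_meet c c' p : incell c p -> incell c' p -> meet c c'.
Proof.
move=> cp c'p n; have /andP[h1 h2] := cp n; have /andP[h3 h4] := c'p n.
by split; [apply: le_trans h1 h4|apply: le_trans h3 h2].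
Qed.

(** For boxes, pairwise intersection is enough: it holds interval by interval, where the largest
    lower end is a common point. *)
Lemma hellyP c1 c2 c3 : meet c1 c2 -> meet c2 c3 -> meet c1 c3 ->
  let p := \row_n Num.max (clo c1 n) (Num.max (clo c2 n) (clo c3 n)) in
  [/\ incell c1 p, incell c2 p & incell c3 p].
Proof.
move=> h12 h23 h13 /=.
have key n (c : cells) : clo c1 n <= chi c n -> clo c2 n <= chi c n -> clo c3 n <= chi c n ->
    Num.max (clo c1 n) (Num.max (clo c2 n) (clo c3 n)) <= chi c n.
  by move=> h1 h2 h3; rewrite !ge_max h1 h2 h3.
have ch c n : clo c n <= chi c n by exact/ltW/clo_lt_chi.
by split=> n; rewrite mxE -/(clo _ _) -/(chi _ _); apply/andP; split;
  rewrite ?le_max ?lexx ?orbT //; apply: key; rewrite ?ch //;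
  have [h1 h2] := h12 n; have [h3 h4] := h23 n; have [h5 h6] := h13 n.
Qed.

Lemma helly4 c1 c2 c3 c4 : meet c1 c2 -> meet c1 c3 -> meet c1 c4 -> meet c2 c3 -> meet c2 c4 ->
  meet c3 c4 -> exists p, [/\ incell c1 p, incell c2 p, incell c3 p & incell c4 p].
Proof.
move=> h12 h13 h14 h23 h24 h34.
exists (\row_n Num.max (Num.max (clo c1 n) (clo c2 n)) (Num.max (clo c3 n) (clo c4 n))).
have key n (c : cells) : clo c1 n <= chi c n -> clo c2 n <= chi c n -> clo c3 n <= chi c n ->
    clo c4 n <= chi c n ->
    Num.max (Num.max (clo c1 n) (clo c2 n)) (Num.max (clo c3 n) (clo c4 n)) <= chi c n.
  by move=> h1 h2 h3 h4; rewrite !ge_max h1 h2 h3 h4.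
have ch c n : clo c n <= chi c n by exact/ltW/clo_lt_chi.
by split=> n; rewrite mxE -/(clo _ _) -/(chi _ _); apply/andP; split;
  rewrite ?le_max ?lexx ?orbT //; apply: key; rewrite ?ch //;
  have [? ?] := h12 n; have [? ?] := h23 n; have [? ?] := h13 n;
  have [? ?] := h14 n; have [? ?] := h24 n; have [? ?] := h34 n.
Qed.

Lemma cell_gap : exists2 e : R, 0 < e & forall c c' x y,
  incell c x -> incell c' y -> cube x e y -> meet c c'.
Proof.
have [|i e e' _ ee' h lt|e e0 eP] := @fin_lower_bound R (cells * cells * 'I_3)%type
  (fun i e => clo i.1.1 i.2 < chi i.1.2 i.2 + e -> clo i.1.1 i.2 <= chi i.1.2 i.2).
- move=> [[c c'] n] /=; have [le|lt] := leP (clo c n) (chi c' n); first by exists 1.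
  by exists (clo c n - chi c' n); rewrite ?subr_gt0 // addrC subrK ltxx.
- by apply: h; apply: lt_le_trans lt _; rewrite lerD2l.
exists e => // c c' x y cx c'y xy n.
have /andP[h1 h2] := cx n; have /andP[h3 h4] := c'y n; have := xy n; rewrite ltr_norml => /andP[h5 h6].
by rewrite /clo /chi; split; [apply: (eP (c, c', n))|apply: (eP (c', c, n))]; rewrite /clo /chi /=; lra.
Qed.

Lemma segment_incell c x y t : incell c x -> incell c y -> 0 <= t <= 1 ->
  incell c (x + t *: (y - x)).
Proof.
move=> cx cy /andP[t0 t1] n; have /andP[h1 h2] := cx n; have /andP[h3 h4] := cy n.
have t1' : 0 <= 1 - t by rewrite subr_ge0.
rewrite !mxE; apply/andP; split; rewrite -subr_ge0.
  have := mulr_ge0 t0 (_ : 0 <= y 0 n - lo (cell c) 0 n); have := mulr_ge0 t1' (_ : 0 <= x 0 n - lo (cell c) 0 n).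
  by rewrite !subr_ge0 => /(_ h1) + /(_ h3); lra.
have := mulr_ge0 t0 (_ : 0 <= hi (cell c) 0 n - y 0 n); have := mulr_ge0 t1' (_ : 0 <= hi (cell c) 0 n - x 0 n).
by rewrite !subr_ge0 => /(_ h2) + /(_ h4); lra.
Qed.

Lemma cells_deformable c c' : deformable (incell c `&` incell c').
Proof.
have [[p [cp c'p]]|no] := pselect (exists p, incell c p /\ incell c' p); last first.
  move=> e e0; exists e, 0%N, (fun=> id); split=> //; last split=> //.
  by exists 0 => x [cx c'x]; case: no; exists x.
apply: (@star_shaped_deformable _ _ p (\sum_n (chi c n - clo c n))).
  by move=> x t [cx c'x] t01; split; exact: segment_incell.
move=> x n [cx _]; rewrite (bigD1 n) //= ler_wpDr //.
  by rewrite sumr_ge0 // => i _; rewrite subr_ge0 ltW // clo_lt_chi.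
have /andP[h1 h2] := cx n; have /andP[h3 h4] := cp n.
by rewrite ler_norml /clo /chi; lra.
Qed.

(** An arbitrary cell at x, through which a Cech cochain on cells becomes an Alexander-Spanier
    cochain on points. By [cell_gap], nearby points get intersecting cells. *)
Definition cell_at c0 x : cells := odflt c0 [pick c | `[< incell c x >]].

Lemma cell_atP c0 x : K x -> incell (cell_at c0 x) x.
Proof.
move=> /(closure_cells M_mesh)[c cx]; rewrite /cell_at; case: pickP => [c' /asboolP //|/(_ c)].
by rewrite asboolT.
Qed.

Section ConstantJumps.
Variable w : cells -> 'rV[R]_3 -> R.
Hypothesis w_jump : forall m c c', adj m c c' -> forall p q, incell c p -> incell c' p ->
  incell c q -> incell c' q -> w c p - w c' p = w c q - w c' q.

(** Constancy is assumed only for cells sharing a face; it passes to all intersecting cells along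
    links in the star of a suitable point. *)
Lemma jump_constant c c' p q : incell c p -> incell c' p -> incell c q -> incell c' q ->
  w c p - w c' p = w c q - w c' q.
Proof.
move=> cp c'p cq c'q; have [->|cc'] := eqVneq c c'; first by rewrite !subrr.
pose same n := (clo c n == clo c' n) && (chi c n == chi c' n).
(* [z] keeps the coordinates in which p and q are forced to agree and is central in the others, so
   that every cell at z contains both p and q. *)
pose z : 'rV[R]_3 := \row_n (if same n then (clo c n + chi c n) / 2 else p 0 n).
have ch n := clo_lt_chi c n; have ch' n := clo_lt_chi c' n.
have cz : incell c z.
  move=> n; rewrite mxE -/(clo _ _) -/(chi _ _); case: ifP => _; last exact: cp.
  by have := ch n; lra.
have c'z : incell c' z.
  move=> n; rewrite mxE -/(clo _ _) -/(chi _ _); case: ifP => [/andP[/eqP<- /eqP<-]|_]; last exact: c'p.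
  by have := ch n; lra.
have pq n : ~~ same n -> p 0 n = q 0 n.
  rewrite /same => ns; have [/(_ n) tp _] := cells_meet cc' cp c'p; have [/(_ n) tq _] := cells_meet cc' cq c'q.
  have := ch n; have := ch' n.
  case: tp => [[e1 e2]|[-> e1]|[-> e1]]; first by rewrite e1 e2 !eqxx in ns.
    case: tq => [[e3 e4]|[-> e3]|[-> e3]] //; first by rewrite e3 e4 !eqxx in ns.
    by lra.
  case: tq => [[e3 e4]|[-> e3]|[-> e3]] //; first by rewrite e3 e4 !eqxx in ns.
  by lra.
have near c2 : incell c2 z -> incell c2 p /\ incell c2 q.
  move=> c2z; have [<- //|cc2] := eqVneq c c2; have [tri _] := cells_meet cc2 cz c2z.
  have inc r : incell c r -> (forall n, ~~ same n -> p 0 n = r 0 n) -> incell c2 r.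
    move=> cr pr n; have := c2z n; have := tri n; rewrite mxE; case: ifP => [_|/negbT/pr <- //].
    have lt := ch n; case=> [[e1 e2]|[e1 _]|[e1 _]] => _; [|lra|lra].
    by have := cr n; rewrite /clo /chi in e1 e2; rewrite e1 e2.
  by split; exact: inc.
suff : w c p - w c q = w c' p - w c' q by lra.
apply: (@connect_eq _ (star_link z) R (fun c => w c p - w c q)); last first.
  exact: (mesh_star_connected Omega_domain Omega_lipschitz M_mesh).
move=> c1 c2 /asboolP[/near[c1p c1q] /near[c2p c2q] [m [a|a]]].
  by have := w_jump a c1p c2p c1q c2q; lra.
by have := w_jump a c2p c1p c2q c1q; lra.
Qed.

Definition jump c c' : R :=
  let p := \row_n Num.max (clo c n) (clo c' n) in w c p - w c' p.

Lemma jumpE c c' p : incell c p -> incell c' p -> jump c c' = w c p - w c' p.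
Proof.
move=> cp c'p; have h := incell_meet cp c'p.
by apply: jump_constant => // n; rewrite mxE -/(clo _ _) -/(chi _ _) le_max lexx ?orbT /= ge_max;
  have [h1 h2] := h n; rewrite ?h1 ?h2 ltW ?clo_lt_chi.
Qed.

Lemma jump_add c1 c2 c3 : meet c1 c2 -> meet c2 c3 -> meet c1 c3 ->
  jump c1 c2 + jump c2 c3 = jump c1 c3.
Proof.
move=> h12 h23 h13; have [p1 p2 p3] := hellyP h12 h23 h13.
by rewrite (jumpE p1 p2) (jumpE p2 p3) (jumpE p1 p3) addrA subrK.
Qed.
End ConstantJumps.

(** The jumps form a Cech 1-cocycle, and [b] is a primitive at small scale of its transfer to
    points. Adding the jump from the fixed cell [c] to the cell at x makes [g c] locally constant on
    the convex cell [c], hence constant. *)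
Lemma mesh_jumps_removable : jumps_removable M.
Proof.
move=> w w_jump; have [_ _ [x0 Ox0]] := Omega_domain.
have [c0 _] := Omega_covered M_mesh Ox0; have [e e0 gap] := cell_gap.
pose T := cell_at c0; have TP x : K x -> incell (T x) x by exact: cell_atP.
pose u x y := jump w (T x) (T y).
have uD (x y t : 'rV[R]_3) : K x -> K y -> K t -> cube x e y -> cube y e t -> cube x e t -> u x y + u y t = u x t.
  move=> Kx Ky Kt xy yt xt.
  apply: jump_add => //; [exact: gap (TP x Kx) (TP y Ky) xy|exact: gap (TP y Ky) (TP t Kt) yt|].
  exact: gap (TP x Kx) (TP t Kt) xt.
have cK := closure_deformable Omega_domain Omega_contractible Omega_lipschitz M_mesh.
have [b [e' [e'0 bB]]] := additive_coboundary e0 cK uD.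
have Kc c x : incell c x -> K x by move=> cx; apply/(closure_cells M_mesh); exists c.
pose g c x := jump w c (T x) + b x.
have gc c x y : incell c x -> incell c y -> g c x = g c y.
  pose d := Num.min e e'; have d0 : 0 < d by rewrite lt_min e0.
  move=> cx cy; apply: (locally_constant d0 (cells_deformable c c) (g := g c)) => // {cx cy}{}x {}y [cx _] [cy _] xy.
  have [Kx Ky] := (Kc _ _ cx, Kc _ _ cy).
  have xye : cube x e y by apply: subset_cube xy; rewrite ge_min lexx.
  have := bB x y Kx Ky (subset_cube (_ : d <= e') xy); rewrite ge_min lexx orbT => /(_ isT).
  have := @jump_add w w_jump c (T x) (T y).
  move=> /(_ (incell_meet cx (TP x Kx)) (gap _ _ _ _ (TP x Kx) (TP y Ky) xye) (incell_meet cy (TP y Ky))).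
  by rewrite /g /u; lra.
exists (fun c => g c (lo (cell c))) => m c c' cc' p cp c'p.
have cl c1 : incell c1 (lo (cell c1)) by move=> n; rewrite lexx ltW // cell_nondegenerate.
have Kp := Kc _ _ cp.
rewrite (gc c _ p (cl c) cp) (gc c' _ p (cl c') c'p) /g.
rewrite !(jumpE w_jump (p := p)) //; first by lra.
all: exact: TP.
Qed.


(** The zigzag: [f] is a primitive of the difference of the [psi c] on an overlap, [r] the resulting
    Cech 2-cocycle of constants, [rho] a Cech primitive of [r], and [g] splits [f] minus [rho].
    After correction by [g] the [psi c] agree on overlaps and glue to [B]. *)
Lemma cellwise_cocycle_coboundary (Phi : 'rV[R]_3 -> 'rV[R]_3 -> 'rV[R]_3 -> R)
  (psi : cells -> 'rV[R]_3 -> 'rV[R]_3 -> R) :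
  (forall c p q t, incell c p -> incell c q -> incell c t ->
     Phi p q t = psi c p q + psi c q t - psi c p t) ->
  exists B : 'rV[R]_3 -> 'rV[R]_3 -> R, forall c p q t,
    incell c p -> incell c q -> incell c t -> Phi p q t = B p q + B q t - B p t.
Proof.
move=> dpsi; have [_ _ [x0 Ox0]] := Omega_domain.
have [c0 _] := Omega_covered M_mesh Ox0; have [e e0 gap] := cell_gap.
have cK := closure_deformable Omega_domain Omega_contractible Omega_lipschitz M_mesh.
have Kc c x : incell c x -> K x by move=> cx; apply/(closure_cells M_mesh); exists c.
pose T := cell_at c0; have TP x : K x -> incell (T x) x by exact: cell_atP.
pose p0 c c' : 'rV[R]_3 := \row_n Num.max (clo c n) (clo c' n).
have p0P c c' p : incell c p -> incell c' p -> incell c (p0 c c') /\ incell c' (p0 c c').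
  move=> cp c'p; have h := incell_meet cp c'p.
  by split=> n; rewrite mxE -/(clo _ _) -/(chi _ _) le_max lexx ?orbT /= ge_max;
    have [h1 h2] := h n; rewrite ?h1 ?h2 ltW ?clo_lt_chi.
pose f c c' p := psi c (p0 c c') p - psi c' (p0 c c') p.
have fB c c' p q : incell c p -> incell c' p -> incell c q -> incell c' q ->
    f c c' q - f c c' p = psi c p q - psi c' p q.
  move=> cp c'p cq c'q; have [h1 h2] := p0P _ _ _ cp c'p.
  by have := dpsi c _ _ _ h1 cp cq; have := dpsi c' _ _ _ h2 c'p c'q; rewrite /f; lra.
pose r c1 c2 c3 := let p := \row_n Num.max (clo c1 n) (Num.max (clo c2 n) (clo c3 n)) in
  f c1 c2 p + f c2 c3 p - f c1 c3 p.
have rE c1 c2 c3 p : incell c1 p -> incell c2 p -> incell c3 p ->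
    r c1 c2 c3 = f c1 c2 p + f c2 c3 p - f c1 c3 p.
  move=> h1 h2 h3.
  have [q1 q2 q3] := hellyP (incell_meet h1 h2) (incell_meet h2 h3) (incell_meet h1 h3).
  have := fB c1 c2 p _ h1 h2 q1 q2; have := fB c2 c3 p _ h2 h3 q2 q3; have := fB c1 c3 p _ h1 h3 q1 q3.
  by rewrite /r; lra.
have r_cocycle c1 c2 c3 c4 : meet c1 c2 -> meet c1 c3 -> meet c1 c4 -> meet c2 c3 -> meet c2 c4 ->
    meet c3 c4 -> r c2 c3 c4 - r c1 c3 c4 + r c1 c2 c4 - r c1 c2 c3 = 0.
  move=> m12 m13 m14 m23 m24 m34; have [p [h1 h2 h3 h4]] := helly4 m12 m13 m14 m23 m24 m34.
  by rewrite !(rE _ _ _ p) //; lra.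
have mT x y : K x -> K y -> cube x e y -> meet (T x) (T y).
  by move=> Kx Ky; exact: gap (TP x Kx) (TP y Ky).
have mc c x : incell c x -> meet c (T x) by move=> cx; exact: incell_meet cx (TP x (Kc _ _ cx)).
have [|b [e1 [e10 bE]]] := cocycle_coboundary (u := fun x y z => r (T x) (T y) (T z)) e0 cK.
  by move=> x y z t Kx Ky Kz Kt xy xz xt yz yt zt; apply: r_cocycle; exact: mT.
pose d := Num.min e e1; have d0 : 0 < d by rewrite lt_min e0.
have [de de1] : d <= e /\ d <= e1 by rewrite /d !ge_min !lexx orbT.
have near c x y : incell c x -> incell c y -> cube x d y -> [/\ K x, K y, meet (T x) (T y) & cube x e1 y].
  move=> cx cy xy; have [Kx Ky] := (Kc _ _ cx, Kc _ _ cy); split=> //.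
    by apply: mT => //; exact: subset_cube xy.
  exact: subset_cube xy.
have aP c : exists ae : ('rV[R]_3 -> R) * R, 0 < ae.2 /\ forall x y, incell c x -> incell c y ->
    cube x ae.2 y -> b x y - r c (T x) (T y) = ae.1 x - ae.1 y.
  have [|a [e2 [e20 aE]]] := additive_coboundary (u := fun x y => b x y - r c (T x) (T y)) d0 (cells_deformable c c).
    move=> x y z [cx _] [cy _] [cz _] xy yz xz.
    have [Kx Ky mxy xy1] := near _ _ _ cx cy xy; have [_ Kz myz yz1] := near _ _ _ cy cz yz.
    have [_ _ mxz xz1] := near _ _ _ cx cz xz.
    have := bE x y z Kx Ky Kz xy1 yz1 xz1.
    by have := r_cocycle c (T x) (T y) (T z) (mc _ _ cx) (mc _ _ cy) (mc _ _ cz) mxy mxz myz; lra.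
  by exists (a, e2); split=> // x y cx cy xy; exact: aE.
pose a c := (projT1 (cid (aP c))).1; pose e2 c := (projT1 (cid (aP c))).2.
have e20 c : 0 < e2 c by case: (projT2 (cid (aP c))).
have aE c x y : incell c x -> incell c y -> cube x (e2 c) y -> b x y - r c (T x) (T y) = a c x - a c y.
  by case: (projT2 (cid (aP c))) => _; exact.
(* The cocycle identity for [c], [c'] and the cells chosen at two nearby points makes this locally
   constant on the overlap. In an alternating sum over three cells the terms [a] cancel and [r]
   remains, so the constants are a Cech primitive of [r]. *)
pose s c c' x := a c' x - a c x + r c c' (T x).
have sE c c' x y : incell c x -> incell c' x -> incell c y -> incell c' y -> s c c' x = s c c' y.
  move=> cx c'x cy c'y; pose d' := Num.min d (Num.min (e2 c) (e2 c')).
  have d'0 : 0 < d' by rewrite lt_min d0 lt_min !e20.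
  have [h1 h2 h3] : [/\ d' <= d, d' <= e2 c & d' <= e2 c'].
    by split; rewrite /d' ge_min ?lexx //; rewrite [X in _ || X]ge_min lexx !orbT.
  apply: (locally_constant d'0 (cells_deformable c c') (g := s c c')) => // {cx c'x cy c'y}.
  move=> {}x {}y [cx c'x] [cy c'y] xy.
  have [Kx Ky mxy _] := near _ _ _ cx cy (subset_cube h1 xy).
  have := aE c x y cx cy (subset_cube h2 xy); have := aE c' x y c'x c'y (subset_cube h3 xy).
  have := r_cocycle c c' (T x) (T y) (incell_meet cx c'x) (mc _ _ cx) (mc _ _ cy) (mc _ _ c'x) (mc _ _ c'y) mxy.
  by rewrite /s; lra.
pose rho c c' := s c c' (p0 c c').
have rhoE c c' x : incell c x -> incell c' x -> rho c c' = s c c' x.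
  by move=> cx c'x; have [h1 h2] := p0P _ _ _ cx c'x; exact: sE.
pose g c p := f c (T p) p - rho c (T p).
have gE c c' p : incell c p -> incell c' p -> g c p - g c' p = f c c' p - rho c c'.
  move=> cp c'p; have Kp := Kc _ _ cp; have Tp := TP _ Kp.
  have := rE c c' (T p) p cp c'p Tp; rewrite /g !(rhoE _ _ p) // /s.
  have := rE c (T p) (T p) p cp Tp Tp; have := rE c' (T p) (T p) p c'p Tp Tp.
  by rewrite /f; lra.
pose B c p q := psi c p q - g c q + g c p.
have BE c c' p q : incell c p -> incell c' p -> incell c q -> incell c' q -> B c p q = B c' p q.
  move=> cp c'p cq c'q; have := fB c c' p q cp c'p cq c'q.
  by have := gE c c' p cp c'p; have := gE c c' q cq c'q; rewrite /B; lra.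
pose C p q := odflt c0 [pick c | `[< incell c p /\ incell c q >]].
have CP c p q : incell c p -> incell c q -> incell (C p q) p /\ incell (C p q) q.
  move=> cp cq; rewrite /C; case: pickP => [c' /asboolP //|/(_ c)].
  by rewrite asboolT.
exists (fun p q => B (C p q) p q) => c p q t cp cq ct.
have BC x y : incell c x -> incell c y -> B (C x y) x y = B c x y.
  by move=> cx cy; have [h1 h2] := CP _ _ _ cx cy; exact: BE.
by rewrite !BC // (dpsi c) // /B; lra.
Qed.
End Jumps.

(** * From face cochains of the mesh to cochains on points *)

Section CellularCohomology.
Variables (R : realType) (Omega : set 'rV[R]_3) (M : mesh R).
Hypothesis Omega_domain : is_domain Omega.
Hypothesis Omega_contractible : contractible Omega.
Hypothesis Omega_lipschitz : lipschitz_boundary Omega.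
Hypothesis M_mesh : partitions M Omega.
Local Notation cells := 'I_(ncells M).
Implicit Types (c : cells) (p q x y z v : 'rV[R]_3) (m n i : 'I_3) (a b : bool).
Implicit Types (f : 'I_3 -> bool -> R) (e : 'I_3 -> bool -> bool -> R) (s : 'I_3 -> bool).

Definition cube_coboundary e f := forall m a,
  f m a = (e (m + 2%:R) a true - e (m + 2%:R) a false) - (e (m + 1) true a - e (m + 1) false a).

(** The potential is chosen with zero values on edges of direction 2. Five of the six face equations
    then hold by construction, and the sixth is the vanishing of the total flux. *)
Lemma cube_potential f : \sum_m (f m true - f m false) = 0 -> exists e, cube_coboundary e f.
Proof.
rewrite (sum3 _ 0) => f0; exists (fun i a b =>
  if i == 0 then (if b then f 1 a else 0) + (if a then - f 2%:R false else 0)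
  else if i == 1 then (if a then - f 0 b else 0) else 0) => m a.
rewrite !ord3E in f0.
by case: (ord3P m) => ->; rewrite !ord3E /=; case: a => //; lra.
Qed.

Notation d s s' n := ((s' n)%:R - (s n)%:R : R).

(** The edge values summed along the lattice path from [s] to [s'] that moves in the directions 0,
    1, 2 in turn. Steps down count negatively and unchanged coordinates contribute nothing. *)
Definition path_sum e s s' : R :=
  d s s' 0 * e 0 (s 1) (s 2%:R) + d s s' 1 * e 1 (s 2%:R) (s' 0) + d s s' 2%:R * e 2%:R (s' 0) (s' 1).

(* The face terms picked up when the monotone lattice path from s to s' to s''
   is reordered into the one from s to s''. *)
Definition flux f s s' s'' : R :=
  d s' s'' 0 * d s s' 2%:R * f 1 (s' 1) - d s' s'' 0 * d s s' 1 * f 2%:R (s 2%:R)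
  - d s' s'' 1 * d s s' 2%:R * f 0 (s'' 0).

Lemma flux_path e f s s' s'' : cube_coboundary e f ->
  flux f s s' s'' = path_sum e s s' + path_sum e s' s'' - path_sum e s s''.
Proof.
move=> fe; rewrite /flux !fe.
rewrite !ord3E /path_sum.
(* A function of two bits is a polynomial of degree at most one in each, which reduces the claim to
   a polynomial identity. *)
have bil i : exists A B C D : R, forall a b, e i a b = A + a%:R * B + b%:R * C + a%:R * b%:R * D.
  exists (e i false false), (e i true false - e i false false), (e i false true - e i false false),
    (e i true true - e i true false - e i false true + e i false false).
  by move=> [] [] /=; ring.
have [A0 [B0 [C0 [D0 E0]]]] := bil 0; have [A1 [B1 [C1 [D1 E1]]]] := bil 1.
have [A2 [B2 [C2 [D2 E2]]]] := bil 2%:R; rewrite !(E0, E1, E2) /=.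
ring.
Qed.

(** Sends every point of a cell to one of its vertices, counting coordinates below the upper end as
    the lower end. In this way cochains on vertices extend to all points of the closure. *)
Definition vertex_bit c p : 'I_3 -> bool := fun n => p 0 n == chi c n.

Definition face_value (phi : 'I_3 -> key R -> R) c m a : R := phi m (side m a (ckey c)).

Lemma vertex_bit_diff c c' p q n : incell c p -> incell c' p -> incell c q -> incell c' q ->
  (clo c n = clo c' n /\ chi c n = chi c' n) \/
  (vertex_bit c p n = vertex_bit c q n /\ vertex_bit c' p n = vertex_bit c' q n).
Proof.
move=> cp c'p cq c'q; have [->|cc'] := eqVneq c c'; first by left.
have [/(_ n) tp _] := cells_meet cc' cp c'p; have [/(_ n) tq _] := cells_meet cc' cq c'q.
have := clo_lt_chi c n; have := clo_lt_chi c' n; rewrite /vertex_bit.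
case: tp => [e|[-> e]|[-> e]]; first by left.
  by case: tq => [e'|[-> e']|[-> e']]; [left|right|lra].
by case: tq => [e'|[-> e']|[-> e']]; [left|lra|right].
Qed.

Lemma vertex_bit_side c c' p m : incell c p -> incell c' p ->
  (forall n, n != m -> clo c n = clo c' n /\ chi c n = chi c' n) ->
  side m (vertex_bit c p m) (ckey c) = side m (vertex_bit c' p m) (ckey c').
Proof.
move=> cp c'p same; have [->//|cc'] := eqVneq c c'.
have e : (if vertex_bit c p m then chi c m else clo c m) =
         (if vertex_bit c' p m then chi c' m else clo c' m).
  have [/(_ m) tp _] := cells_meet cc' cp c'p; rewrite /vertex_bit.
  have := clo_lt_chi c m; have := clo_lt_chi c' m.
  case: tp => [[-> ->]//|[-> e]|[-> e]] l1 l2.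
    by rewrite eqxx e lt_eqF.
  by rewrite (lt_eqF l2) e eqxx.
have v c1 b : (if b then (ckey c1).2 0 m else (ckey c1).1 0 m) = if b then chi c1 m else clo c1 m by [].
rewrite /side !v e; congr (_, _); apply/rowP => n; rewrite !mxE; case: eqVneq => // nm.
  by case: (same n nm).
by case: (same n nm).
Qed.

Lemma flux_term phi c c' m n n' (p q p' q' x : 'rV[R]_3) :
  (forall i, i != m -> i = n \/ i = n') ->
  incell c p -> incell c' p -> incell c q -> incell c' q -> incell c p' -> incell c' p' ->
  incell c q' -> incell c' q' -> incell c x -> incell c' x ->
  d (vertex_bit c p) (vertex_bit c q) n * d (vertex_bit c p') (vertex_bit c q') n' *
    face_value phi c m (vertex_bit c x m) =
  d (vertex_bit c' p) (vertex_bit c' q) n * d (vertex_bit c' p') (vertex_bit c' q') n' *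
    face_value phi c' m (vertex_bit c' x m).
Proof.
move=> mn cp c'p cq c'q cp' c'p' cq' c'q' cx c'x.
have [s1|[-> ->]] := vertex_bit_diff n cp c'p cq c'q; last by rewrite !subrr !mul0r.
have [s2|[-> ->]] := vertex_bit_diff n' cp' c'p' cq' c'q'; last by rewrite !subrr !mulr0 !mul0r.
have vb y i : clo c i = clo c' i /\ chi c i = chi c' i -> vertex_bit c y i = vertex_bit c' y i.
  by rewrite /vertex_bit => -[_ ->].
rewrite !(vb _ n) // !(vb _ n') //; congr (_ * _); congr (phi _ _).
by apply: vertex_bit_side => // i /mn[->|->].
Qed.

(** Each term of [flux] carries a bit difference for both directions of its face. By
    [vertex_bit_diff] these vanish unless the two cells have equal intervals in both directions, and
    then the face is the same for both cells. *)
Lemma flux_cell phi c c' p q t : incell c p -> incell c' p -> incell c q -> incell c' q ->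
  incell c t -> incell c' t ->
  flux (face_value phi c) (vertex_bit c p) (vertex_bit c q) (vertex_bit c t) =
  flux (face_value phi c') (vertex_bit c' p) (vertex_bit c' q) (vertex_bit c' t).
Proof.
move=> *; rewrite /flux; congr (_ - _ - _); apply: flux_term => // i.
- by case: (ord3P i) => ->; [left|move=> /eqP|right].
- by case: (ord3P i) => ->; [left|right|move=> /eqP].
by case: (ord3P i) => ->; [move=> /eqP|left|right].
Qed.

Lemma flux_square f m s00 s10 s01 s11 :
  (forall n, n != m -> s00 n = false /\ s11 n = true) ->
  (forall n, s10 n = if n == m + 1 then true else s00 n) ->
  (forall n, s01 n = if n == m + 2%:R then true else s00 n) -> s00 m = s11 m ->
  flux f s00 s10 s11 - flux f s00 s01 s11 = f m (s11 m).
Proof.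
move=> h h10 h01 hm; rewrite /flux !h10 !h01; move: h hm.
case: (ord3P m) => -> h hm; rewrite !ord3E /=.
- by have [h1 h2] := h 1 isT; have [h3 h4] := h 2%:R isT; rewrite ?h1 ?h2 ?h3 ?h4 hm /=; ring.
- by have [h1 h2] := h 0 isT; have [h3 h4] := h 2%:R isT; rewrite ?h1 ?h2 ?h3 ?h4 hm /=; ring.
by have [h1 h2] := h 0 isT; have [h3 h4] := h 1 isT; rewrite ?h1 ?h2 ?h3 ?h4 hm /=; ring.
Qed.

Lemma side_corners i b (F : key R) (x y : 'rV[R]_3) :
  (forall n, (if n == i then (if b then F.2 0 i else F.1 0 i) else F.1 0 n) = x 0 n /\
     (if n == i then (if b then F.2 0 i else F.1 0 i) else F.2 0 n) = y 0 n) ->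
  side i b F = (x, y).
Proof. by move=> h; congr (_, _); apply/rowP => n; rewrite mxE; case: (h n). Qed.

(** The face cochain becomes the point cochain [Phi], which on every cell is a coboundary. A face
    square is cut along its diagonal into two triangles, on which the difference of the values of
    [Phi] is the value of the face; evaluating the primitive [B] at the two ends of each edge
    therefore gives the required edge cochain. *)
Lemma mesh_closed_coboundary : closed_coboundary M.
Proof.
move=> phi closed.
pose Phi p q t : R := if [pick c | `[< [/\ incell c p, incell c q & incell c t] >]] is Some c
  then flux (face_value phi c) (vertex_bit c p) (vertex_bit c q) (vertex_bit c t) else 0.
have PhiE c p q t : incell c p -> incell c q -> incell c t ->
    Phi p q t = flux (face_value phi c) (vertex_bit c p) (vertex_bit c q) (vertex_bit c t).
  move=> cp cq ct; rewrite /Phi; case: pickP => [c' /asboolP[c'p c'q c't]|/(_ c)].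
    exact: flux_cell.
  by rewrite asboolT.
have ex c : exists e, cube_coboundary e (face_value phi c) by apply: cube_potential; exact: closed.
pose e c := projT1 (cid (ex c)); have eP c : cube_coboundary (e c) (face_value phi c) := projT2 (cid (ex c)).
have [|B BE] := cellwise_cocycle_coboundary Omega_domain Omega_contractible Omega_lipschitz M_mesh
  (Phi := Phi) (psi := fun c p q => path_sum (e c) (vertex_bit c p) (vertex_bit c q)).
  by move=> c p q t cp cq ct; rewrite (PhiE c) //; exact: flux_path.
exists (fun _ E => B E.1 E.2) => c m a.
set F := side m a (ckey c); pose q00 := F.1; pose q11 := F.2.
pose q10 := setc F.1 (m + 1) (F.2 0 (m + 1)); pose q01 := setc F.1 (m + 2%:R) (F.2 0 (m + 2%:R)).
have [n1 n2 n3] := ord3_neq m.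
have F1 n : F.1 0 n = if n == m then (if a then chi c m else clo c m) else clo c n.
  by have [-> _] := sideE m a (ckey c) n.
have F2 n : F.2 0 n = if n == m then (if a then chi c m else clo c m) else chi c n.
  by have [_ ->] := sideE m a (ckey c) n.
have lt n := clo_lt_chi c n; have le n := ltW (lt n).
have corner (y : 'rV[R]_3) : (forall n, y 0 n = clo c n \/ y 0 n = chi c n) -> incell c y.
  by move=> yc n; rewrite -/(clo _ _) -/(chi _ _); case: (yc n) => ->; rewrite lexx le.
have c1 n : F.1 0 n = clo c n \/ F.1 0 n = chi c n.
  by rewrite F1; case: eqP => [->|_]; [case: (a); [right|left]|left].
have c2 n : F.2 0 n = clo c n \/ F.2 0 n = chi c n.
  by rewrite F2; case: eqP => [->|_]; [case: (a); [right|left]|right].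
have i00 : incell c q00 by exact: corner.
have i11 : incell c q11 by exact: corner.
have i10 : incell c q10 by apply: corner => n; rewrite mxE; case: eqP => [->|_].
have i01 : incell c q01 by apply: corner => n; rewrite mxE; case: eqP => [->|_].
have -> : coboundary (fun _ E => B E.1 E.2) m F = Phi q00 q10 q11 - Phi q00 q01 q11.
  rewrite (BE c q00 q10 q11) // (BE c q00 q01 q11) //.
  rewrite /coboundary.
  have sideF i b x y := @side_corners i b F x y.
  have q10E n : q10 0 n = if n == m + 1 then chi c n else F.1 0 n.
    by rewrite [LHS]mxE; case: eqP => // ->; rewrite F2 (negbTE n1).
  have q01E n : q01 0 n = if n == m + 2%:R then chi c n else F.1 0 n.
    by rewrite [LHS]mxE; case: eqP => // ->; rewrite F2 (negbTE n2).
  rewrite (sideF (m + 1) true q10 q11) => [|n].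
    rewrite (sideF (m + 1) false q00 q01) => [|n].
      rewrite (sideF (m + 2%:R) true q01 q11) => [|n].
        rewrite (sideF (m + 2%:R) false q00 q10) => [|n]; first by rewrite /=; lra.
        by rewrite q10E !F1 !F2; case: (ord3_rel m n) => ->; rewrite ?eqxx ?ord3F.
      by rewrite q01E !F1 !F2; case: (ord3_rel m n) => ->; rewrite ?eqxx ?ord3F.
    by rewrite q01E !F1 !F2; case: (ord3_rel m n) => ->; rewrite ?eqxx ?ord3F.
  by rewrite q10E !F1 !F2; case: (ord3_rel m n) => ->; rewrite ?eqxx ?ord3F.
rewrite !(PhiE c) //.
have b00 n : vertex_bit c q00 n = if n == m then a else false.
  rewrite /vertex_bit F1; case: (n =P m) => [->|_]; last exact: lt_eqF.
  by case: (a); rewrite ?eqxx // lt_eqF.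
have b11 n : vertex_bit c q11 n = if n == m then a else true.
  rewrite /vertex_bit F2; case: (n =P m) => [->|_]; last by rewrite eqxx.
  by case: (a); rewrite ?eqxx // lt_eqF.
rewrite (@flux_square _ m).
- by rewrite b11 eqxx.
- by move=> n nm; rewrite b00 b11 (negbTE nm).
- move=> n; rewrite /vertex_bit [q10 0 n]mxE; case: (n =P m + 1) => [->|_] //.
  by rewrite F2 (negbTE n1) eqxx.
- move=> n; rewrite /vertex_bit [q01 0 n]mxE; case: (n =P m + 2%:R) => [->|_] //.
  by rewrite F2 (negbTE n2) eqxx.
by rewrite b00 b11 eqxx.
Qed.
End CellularCohomology.

Theorem theorem4p1 (R : realType) (Omega : set 'rV[R]_3) (M : mesh R) (k : nat)
  (Omega_domain : is_domain Omega)
  (Omega_contractible : contractible Omega)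
  (Omega_lipschitz : lipschitz_boundary Omega)
  (M_mesh : partitions M Omega)
  (k_ge2 : (2 <= k)%N) :
  [/\ RM M `<=` Xh M k,
      (@sym_grad R M) @` Xh M k `<=` Phih M k,
      (@curl_curlT R M) @` Phih M k `<=` Gammah M k
    & (@divh R M) @` Gammah M k `<=` Zh M k] /\
  [/\ Xh M k `&` [set u : vfield M | sym_grad u = 0] = RM M,
      Phih M k `&` [set s : mfield M | curl_curlT s = 0] = (@sym_grad R M) @` Xh M k,
      Gammah M k `&` [set s : mfield M | divh s = 0] = (@curl_curlT R M) @` Phih M k
    & (@divh R M) @` Gammah M k = Zh M k].
Proof.
apply: (elasticity_complex_exact k_ge2).
- exact: mesh_star_connected Omega_domain Omega_lipschitz M_mesh.
- exact: domain_mesh_connected Omega_domain M_mesh.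
- exact: mesh_jumps_removable Omega_domain Omega_contractible Omega_lipschitz M_mesh.
exact: mesh_closed_coboundary Omega_domain Omega_contractible Omega_lipschitz M_mesh.
Qed.
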